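(* For every odd integer $t\ge 9$ there is a polynomial-time algorithm which, given a finite graph $G$ that contains no induced path on $t$ vertices and no odd cycle of length at most $t-4$, decides whether $G$ is $3$-colourable, and outputs a $3$-colouring of $G$ if one exists.
   Context: Graphs are finite and simple. $P_t$ denotes the path on $t$ vertices and $C_\ell$ the cycle of length $\ell$. A graph is $H$-free if it does not contain $H$ as an induced subgraph, and $\mathcal H$-free, for a family $\mathcal H$ of graphs, if it is $H$-free for every $H\in\mathcal H$. $\mathcal C^{odd}_{\le t-4}$ is the family of odd cycles of length at most $t-4$; a graph is $\mathcal C^{odd}_{\le t-4}$-free if and only if its odd girth (the length of a shortest odd cycle, infinite for bipartite graphs) is at least $t-2$. The graphs in the claim are the $(P_t,\mathcal C^{odd}_{\le t-4})$-free graphs. A $3$-colouring is an assignment of colours from $\{1,2,3\}$ to all the vertices such that adjacent vertices receive distinct colours. Polynomial time means polynomial in the size of $G$, for each fixed $t$. *)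

(* Defs.v *)
From mathcomp Require Import all_boot.

Set Implicit Arguments.
Unset Strict Implicit.
Unset Printing Implicit Defensive.

Record sgraph := SGraph {
  vertex :> finType;
  adj : rel vertex;
  adj_sym : symmetric adj;
  adj_irrefl : irreflexive adj
}.
Arguments adj {s}.

Section PathGraph.
Variable t : nat.

Definition path_adj : rel 'I_t := fun i j => (i.+1 == j) || (j.+1 == i).

Lemma path_adj_sym : symmetric path_adj.
Proof. by move=> i j; rewrite /path_adj orbC. Qed.

Lemma path_adj_irrefl : irreflexive path_adj.
Proof. by move=> i; rewrite /path_adj orbb gtn_eqF. Qed.

Definition path_graph := SGraph path_adj_sym path_adj_irrefl.
End PathGraph.

(* [ordS i] is [i + 1] modulo [l].  This is the cycle on [l] vertices only when
   [3 <= l]; for smaller [l] it is a path. *)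
Section CycleGraph.
Variable l : nat.

Definition cycle_adj : rel 'I_l :=
  fun i j => (i != j) && ((ordS i == j) || (ordS j == i)).

Lemma cycle_adj_sym : symmetric cycle_adj.
Proof. by move=> i j; rewrite /cycle_adj eq_sym orbC. Qed.

Lemma cycle_adj_irrefl : irreflexive cycle_adj.
Proof. by move=> i; rewrite /cycle_adj eqxx. Qed.

Definition cycle_graph := SGraph cycle_adj_sym cycle_adj_irrefl.
End CycleGraph.

Definition induced_subgraph (H G : sgraph) : Prop :=
  exists f : H -> G, injective f /\ forall x y, adj (f x) (f y) = adj x y.

Definition free (H G : sgraph) : Prop := ~ induced_subgraph H G.

Definition family_free (F : sgraph -> Prop) (G : sgraph) : Prop :=
  forall H, F H -> free H G.

Inductive odd_cycles_upto (k : nat) : sgraph -> Prop :=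
  OddCycle l of 3 <= l <= k & odd l : odd_cycles_upto k (cycle_graph l).

Definition colouring3 (G : sgraph) (c : G -> nat) : Prop :=
  (forall x, 1 <= c x <= 3) /\ (forall x y, adj x y -> c x <> c y).

Definition colourable3 (G : sgraph) : Prop := exists c : G -> nat, colouring3 c.

(* Random access machines in the style of Cook and Reckhow (1973), with
   registers X_0, X_1, ... holding natural numbers, a read-once input and a
   write-once output, and unit cost per instruction.  There is no
   multiplication: one instruction at most doubles the largest number among the
   registers, the input and the constants of the program, so [s] steps only
   handle numbers with O(s) more bits than the input, and polynomial time here
   is polynomial time on Turing machines. *)
Inductive instr :=
  | Const of nat & nat         (* X_i := a             *)
  | Sum of nat & nat & nat     (* X_i := X_j + X_k     *)
  | Diff of nat & nat & nat    (* X_i := X_j - X_k, truncated at 0 *)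
  | Fetch of nat & nat         (* X_i := X_(X_j)       *)
  | Store of nat & nat         (* X_(X_i) := X_j       *)
  | JumpPos of nat & nat       (* if X_i > 0 then go to instruction a *)
  | Read of nat                (* X_i := next input number, 0 if there is none *)
  | Write of nat.              (* append X_i to the output *)

Definition program := seq instr.

Record config := Config {
  pc : nat;
  regs : nat -> nat;
  input : seq nat;
  output : seq nat
}.

Definition init (inp : seq nat) : config := Config 0 (fun=> 0) inp [::].

Definition exec (ins : instr) (s : config) : config :=
  let: Config p X inp out := s in
  match ins with
  | Const i a => Config p.+1 [eta X with i |-> a] inp out
  | Sum i j k => Config p.+1 [eta X with i |-> X j + X k] inp out
  | Diff i j k => Config p.+1 [eta X with i |-> X j - X k] inp out
  | Fetch i j => Config p.+1 [eta X with i |-> X (X j)] inp out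
  | Store i j => Config p.+1 [eta X with X i |-> X j] inp out
  | JumpPos i a => Config (if 0 < X i then a else p.+1) X inp out
  | Read i => Config p.+1 [eta X with i |-> head 0 inp] (behead inp) out
  | Write i => Config p.+1 X inp (rcons out (X i))
  end.

(* The machine halts when the program counter leaves the program. *)
Definition step (P : program) (s : config) : option config :=
  omap (fun ins => exec ins s) (onth P (pc s)).

(* The output of [P] started in [s] if it halts after at most [m] steps. *)
Fixpoint run (P : program) (m : nat) (s : config) : option (seq nat) :=
  match step P s, m with
  | None, _ => Some (output s)
  | Some _, 0 => None
  | Some s', m'.+1 => run P m' s'
  end.

(* The number of vertices, then the adjacency matrix row by row. *)
Definition encode (G : sgraph) : seq nat :=
  #|G| :: [seq nat_of_bool (adj x y) | x <- enum G, y <- enum G].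

(* [0] for "not 3-colourable", or 1 followed by the colours of the vertices, in
   the order in which [encode] lists them. *)
Definition answer3col (G : sgraph) (out : seq nat) : Prop :=
  (colourable3 G ->
     exists c : G -> nat, colouring3 c /\ out = 1 :: [seq c x | x <- enum G])
  /\ (~ colourable3 G -> out = [:: 0]).

Definition polytime_3colouring_algorithm (C : sgraph -> Prop) (P : program) :
    Prop :=
  exists c d : nat, forall G : sgraph, C G ->
    exists out, run P (c * #|G| ^ d + c) (init (encode G)) = Some out
                /\ answer3col G out.

(* Main.v *)
(** A vertex set [X] can be deleted from the graph when mapping its vertices into
    a path [p q r] outside [X] is a homomorphism; the algorithm first makes all
    these folds, and then decides by consistency: [k = 8 t + 11] pebbles, each a
    vertex with a colour, and a duplicator who can always extend a legal position.

    Suppose that the duplicator wins on a folded graph, and let [l] be the length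
    of a shortest odd closed walk in a component.  If there is none the component
    is bipartite.  Otherwise [l] is [t] or [t - 2], since [l - 1] consecutive
    vertices of a shortest odd cycle form an induced path.  If [l = t], every
    vertex has a neighbour on the cycle, so pebbling the cycle leaves two colours
    to each vertex.  If [l = t - 2], the vertices without a neighbour on the cycle
    are independent, and each of them either sees all the neighbours of the cycle
    that hang from a certain cycle vertex, or lies in the middle of a window
    [f 0, ..., f 4]; in each window at most six more pebbles leave no vertex with
    three colours, because otherwise the middle of the window could be folded.  In
    all cases two colours remain, and then the strategy can be pinned down one
    vertex at a time.

    A colouring is found by self-reduction, removing colours from lists as long as
    the duplicator still wins. *)

Require Import Defs.
From mathcomp Require Import all_boot zify.
From Stdlib Require Import Classical_Prop ClassicalEpsilon.

Set Implicit Arguments.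
Unset Strict Implicit.
Unset Printing Implicit Defensive.

(** The cycle, the windows and the placed pebbles occur only in the correctness proof: the machine
    merely computes which positions of the pebbles survive, and a play against the surviving
    strategy exposes the structure. Two cases escape the rule that two colours remain. In a window
    whose ends carry the same colour a middle vertex may keep all three, but each of its neighbours
    sees that colour, so the vertex itself can take it. And a component without odd cycles offers
    nothing to pebble; the argument says nothing about it for arbitrary lists. Hence colour 2 is
    removed first, while every list contains 0 and 1: such a component is then colourable anyway,
    and afterwards its lists have at most two colours. Folds are restricted to maps that two
    neighbourhoods determine, so that six vertices specify a candidate and a vertex to be deleted,
    and the set to be folded is a least closed set. The structural lemmas show that these folds
    suffice: what blocks them contradicts the excluded paths and short odd walks, or lets a few
    pebbles force colours. *)

Ltac is_arith P :=
  lazymatch P with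
  | is_true (leq _ _) => idtac
  | is_true (andb (leq _ _) _) => idtac
  | is_true (odd _) => idtac
  | is_true (negb (odd _)) => idtac
  | is_true (negb (leq _ _)) => idtac
  | @eq nat _ _ => idtac
  | @eq bool (leq _ _) _ => idtac
  | @eq bool (andb (leq _ _) _) _ => idtac
  | not ?A => is_arith A
  | or ?A ?B => is_arith A; is_arith B
  | and ?A ?B => is_arith A; is_arith B
  | ?A -> ?B => is_arith A; is_arith B
  | False => idtac
  end.

(* [lia], freed from the hypotheses that are not about numbers: it is very slow
   on contexts with many atoms. *)
Ltac arith :=
  intros;
  (lazymatch goal with |- ?P => tryif is_arith P then idtac else exfalso end);
  repeat match goal with H : ?P |- _ => is_arith P; revert H end;
  clear; intros; lia.

(** * Shortest odd cycles *)

Section Walks.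
Variables (T : finType) (e : rel T).

(** Walks instead of cycles: they concatenate without any check of distinctness, and the girth
    arguments use only the parity of their length. *)
Fixpoint walk k (u v : T) : Prop :=
  if k is k'.+1 then exists2 w, e u w & walk k' w v else u = v.

Lemma walk_cat a b u v w : walk a u v -> walk b v w -> walk (a + b) u w.
Proof.
elim: a u => [|a IH] u /=; first by move->.
by case=> u' eu Wu Wb; exists u' => //; apply: IH.
Qed.

Lemma walk1 u v : e u v -> walk 1 u v.
Proof. by exists v. Qed.

Fixpoint ipath (s : seq T) : bool :=
  if s is x :: s' then
    (if s' is y :: s'' then e x y && all (fun z => ~~ e x z) s'' else true)
      && ipath s'
  else true.

Hypothesis e_sym : symmetric e.
Hypothesis e_irr : irreflexive e.

Lemma walk_sym k u v : walk k u v -> walk k v u.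
Proof.
elim: k u v => [|k IH] u v; first by move=> /= ->.
case=> w euw /IH Ww; rewrite -addn1; apply: walk_cat Ww _.
by apply: walk1; rewrite e_sym.
Qed.

Lemma ipath_nth x0 s : ipath s ->
  forall i j, i < j -> j < size s -> e (nth x0 s i) (nth x0 s j) = (j == i.+1).
Proof.
elim: s => // x s IH /= /andP[Hx /IH {}IH] [|i] [|j] //= lij.
  case: s Hx {IH} => // y s /andP[exy /allP Hs].
  case: j lij => [|j] _ /= ltj; first by rewrite exy.
  by apply/negbTE/Hs/mem_nth.
by rewrite ltnS => ltj; rewrite IH.
Qed.

Lemma ipath_cat s1 x y s2 :
  ipath (rcons s1 x) -> ipath (y :: s2) -> e x y ->
  {in s2, forall v, ~~ e x v} ->
  {in s1, forall u, {in y :: s2, forall v, ~~ e u v}} ->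
  ipath (rcons s1 x ++ y :: s2).
Proof.
move=> H1 H2 exy Hx; elim: s1 H1 => [|u s1 IH] H1 Hs.
  by move: H2 => /= ->; rewrite exy andbT; apply/allP.
rewrite rcons_cons cat_cons.
have Hu : all (fun z => ~~ e u z) (y :: s2).
  by apply/allP; apply: Hs; rewrite mem_head.
move: H1; rewrite rcons_cons => H1.
have {}IH : ipath (rcons s1 x ++ y :: s2).
  apply: IH => [|v vs]; first by case/andP: H1.
  by apply: Hs; rewrite inE vs orbT.
apply/andP; split=> //; move: H1 => /andP[+ _].
by case: (s1) => [|a s1'] /= /andP[-> Ha] //=; rewrite all_cat Ha.
Qed.

(* [ipath] does not ask its vertices to be distinct: for at least four of them
   this is automatic. *)
Lemma ipath_inj x0 s i j : 3 < size s -> ipath s -> i < j -> j < size s ->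
  nth x0 s i <> nth x0 s j.
Proof.
move=> s4 ps lij ltj E; have N := ipath_nth x0 ps.
case: (ltnP j.+1 (size s)) => [ltj1|gej].
  have /esym := N j j.+1 (ltnSn _) ltj1; rewrite eqxx -E N //; last by lia.
  by move/eqP; lia.
case: i lij E => [|i] lij E.
  have := N 0 1 isT (ltnW (ltnW s4)); rewrite eqxx E e_sym N //; last by lia.
  by move/eqP; lia.
have := N i i.+1 (ltnSn _) (ltn_trans lij ltj); rewrite eqxx E N //; last by lia.
by move/eqP; lia.
Qed.

End Walks.

(** The bound 7 is what [t - 2 <= l] and [9 <= t] leave. It excludes closed walks of length 3 and 5,
    hence [triangle] and [pentagon]. *)
Class odd_girth (T : finType) (e : rel T) (l : nat) : Prop := OddGirth {
  girth_sym : symmetric e;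
  girth_irr : irreflexive e;
  girth_odd : odd l;
  girth_ge7 : 7 <= l;
  oddgirth k u : odd k -> k < l -> ~ walk e k u u
}.
Arguments girth_odd {T e l _}.
Arguments girth_ge7 {T e l _}.
Arguments girth_sym {T e l _}.
Arguments girth_irr {T e l _}.

Section Base.
Variables (T : finType) (e : rel T) (l : nat).
Context {G : odd_girth e l}.
Let l_odd : odd l. Proof. exact: girth_odd. Qed.
Let l_ge7 : 7 <= l. Proof. exact: girth_ge7. Qed.
Let e_sym : symmetric e. Proof. exact: girth_sym. Qed.
Let e_irr : irreflexive e. Proof. exact: girth_irr. Qed.

(* A closed walk of length [l], extended periodically to all indices. *)
Definition base (f : nat -> T) :=
  (forall i, f (i + l) = f i) /\ (forall i, e (f i) (f i.+1)).

Definition arc (f : nat -> T) a n := [seq f i | i <- iota a n].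

Implicit Types (f : nat -> T) (u v w x y z : T).

Lemma base_per f m i : base f -> f (i + m * l) = f i.
Proof.
case=> P _; elim: m => [|m IH]; first by rewrite mul0n addn0.
by rewrite mulSn (addnC l) addnA P.
Qed.

Lemma base_mod f i : base f -> f (i %% l) = f i.
Proof. by move=> B; rewrite {2}(divn_eq i l) addnC base_per. Qed.

Definition shift s f := fun i => f (i + s).
(* Multiplication by [l - 1] is negation modulo [l]: the walk is read backwards. *)
Definition refl s f := fun i => f (s + i * l.-1).

Lemma base_shift s f : base f -> base (shift s f).
Proof.
move=> [P A]; split=> i; rewrite /shift ?addSn //.
by rewrite addnAC P.
Qed.

Lemma reflE s f d : base f -> d <= l -> refl s f d = f (s + l - d).
Proof.
move=> B dl; rewrite /refl -(@base_per f 1 (s + d * l.-1)) //.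
rewrite -(@base_per f d (s + l - d)) //; congr f; nia.
Qed.

Lemma base_refl s f : base f -> base (refl s f).
Proof.
move=> B; split=> i; rewrite /refl.
  by rewrite mulnDl addnA (mulnC l) base_per.
case: B (B) => _ A B; rewrite e_sym.
have -> : f (s + i * l.-1) = f (s + i.+1 * l.-1).+1.
  by rewrite -(@base_per f 1 (s + i * l.-1)) //; congr f; nia.
exact: A.
Qed.

Lemma base_walk f i d : base f -> walk e d (f i) (f (i + d)).
Proof.
move=> [_ A]; elim: d i => [|d IH] i /=; first by rewrite addn0.
by exists (f i.+1) => //; rewrite addnS -addSn.
Qed.

Lemma odd_walk k u : walk e k u u -> odd k -> l <= k.
Proof. by move=> W ok; rewrite leqNgt; apply/negP => lk; exact: (oddgirth ok lk W). Qed.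

(* Going from [f i] to [f j] along either side of the cycle closes the two
   walks up; one of the two closed walks is odd. *)
Lemma base_close f a b u v i j c : base f ->
  walk e a u (f i) -> walk e b v (f j) -> walk e c u v -> i <= j <= i + l ->
  (odd (a + b + c + (j - i)) -> l <= a + b + c + (j - i)) /\
  (~~ odd (a + b + c + (j - i)) -> j - i <= a + b + c).
Proof.
move=> B Wa Wb Wc /andP[ij jil].
have W1 := walk_cat (walk_cat (walk_sym e_sym Wc) Wa)
             (walk_cat (base_walk i (j - i) B) (walk_sym e_sym _)).
move: W1 => /(_ b v); rewrite subnKC // => /(_ Wb) /odd_walk H1.
have W2 := walk_cat (walk_cat Wc Wb)
             (walk_cat (base_walk j (i + l - j) B) (walk_sym e_sym _)).
move: W2 => /(_ a u); rewrite subnKC //; case: (B) => -> _ /(_ Wa) /odd_walk H2.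
lia.
Qed.

Lemma base_pos f a b u i j : base f ->
  walk e a u (f i) -> walk e b u (f j) -> i <= j <= i + l ->
  (odd (a + b + (j - i)) -> l <= a + b + (j - i)) /\
  (~~ odd (a + b + (j - i)) -> j - i <= a + b).
Proof. by move=> B Wa Wb H; have := base_close (c := 0) B Wa Wb erefl H; rewrite addn0. Qed.

Lemma base_adj f i j : base f -> e (f i) (f j) -> i <= j <= i + l ->
  j = i.+1 \/ j = i + l - 1.
Proof.
move=> B A H; have := @base_pos f 0 1 (f i) i j B erefl (walk1 A) H.
lia.
Qed.

Lemma base_inj f i j : base f -> f i = f j -> i <= j <= i + l ->
  j = i \/ j = i + l.
Proof.
move=> B A H; have := @base_pos f 0 0 (f i) i j B erefl A H.
lia.
Qed.

Lemma nbr2 f u i j : base f -> e u (f i) -> e u (f j) -> i <= j <= i + l ->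
  [\/ j = i, j = i + 2, j = i + l - 2 | j = i + l].
Proof.
move=> B A1 A2 H; have := base_pos B (walk1 A1) (walk1 A2) H => HH.
have : j = i \/ j = i + 2 \/ j = i + l - 2 \/ j = i + l by lia.
by case=> [|[|[]]]; [constructor 1 | constructor 2 | constructor 3| constructor 4].
Qed.

Lemma mem_arc f a n v : v \in arc f a n -> exists2 i, a <= i < a + n & v = f i.
Proof. by case/mapP=> i; rewrite mem_iota => ? ->; exists i. Qed.

Lemma arcS f a n : arc f a n.+1 = f a :: arc f a.+1 n.
Proof. by []. Qed.

Lemma arcSr f a n : arc f a n.+1 = rcons (arc f a n) (f (a + n)).
Proof. by rewrite /arc -addn1 iotaD map_cat cats1. Qed.

Lemma ipath_arc f a n : base f -> n < l -> ipath e (arc f a n).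
Proof.
move=> B; elim: n a => // n IH a ltn; rewrite arcS.
have := IH a.+1 (ltnW ltn); case: n ltn {IH} => // n ltn.
rewrite arcS /= => ->; rewrite andbT; case: (B) => _ -> /=.
by apply/allP=> v /mem_arc[i ir ->]; apply/negP=> /(base_adj B); lia.
Qed.

Definition far f y := forall i, ~~ e y (f i).
Definition at_ f k x := e x (f k) /\ forall i, k < i < k + l -> ~~ e x (f i).

Lemma triangle u v w : e u v -> e v w -> ~~ e u w.
Proof.
move=> uv vw; apply/negP => uw.
have W : walk e 3 u u.
  by exists v => //; exists w => //; exists u => //; rewrite e_sym.
by have := odd_walk W isT; lia.
Qed.

Lemma pentagon a b c d u : e a b -> e b c -> e c d -> e d u -> ~~ e u a.
Proof.
move=> ? ? ? ?; apply/negP => ua.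
have W : walk e 5 a a.
  by exists b => //; exists c => //; exists d => //; exists u => //; exists a.
by have := odd_walk W isT; lia.
Qed.

Lemma farP f y : base f -> far f y \/ exists2 i, i < l & e y (f i).
Proof.
move=> B; case: (boolP [exists i : 'I_l, e y (f i)]) => [/existsP[i]|/existsPn H].
  by right; exists i.
left=> i; have lt : i %% l < l by rewrite ltn_mod; lia.
by have := H (Ordinal lt); rewrite /= base_mod.
Qed.

Lemma far_refl s f y : base f -> far f y -> far (refl s f) y.
Proof. by move=> B F i; apply: F. Qed.

Lemma far_neq f y i : base f -> far f y -> y <> f i.
Proof. by move=> [_ A] F E; have := A i; rewrite -E (negbTE (F _)). Qed.

End Base.

(** * Folding a vertex set onto a path *)

Section Reduced.
Variables (T : finType) (e : rel T).
(** Five vertices code the map, so that all candidates can be enumerated: the neighbourhoods of [a]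
    and [b] select what goes to the ends [p] and [r], and everything else goes to the centre [q]. *)
Definition fold_map a p q r b u : T :=
  if e u a then p else if e u b then r else q.

(* The vertices of [X] then fold onto [p], [q] and [r], and [X] can be deleted
   without affecting 3-colourability. *)
Definition foldable a p q r b (X : {set T}) :=
  [&& e p q, e q r, p \notin X, q \notin X, r \notin X &
    [forall x in X, forall u, e x u ==>
       e (fold_map a p q r b x)
         (if u \in X then fold_map a p q r b u else u)]].

Definition reduced :=
  forall a p q r b X, foldable a p q r b X -> {in X, forall y u, ~~ e y u}.

(* Isolated vertices are ignored: they are not deleted but remain as padding. *)
Definition connected :=
  forall u u' v v', e u u' -> e v v' -> exists k, walk e k u v.

Definition no_ipath t := forall s : seq T, size s = t -> ~~ ipath e s.

End Reduced.

(** * Adjacencies forced by the absence of induced paths on l + 2 vertices *)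

Section Paths.
Variables (T : finType) (e : rel T) (l : nat).
Context {G : odd_girth e l}.
Let l_odd : odd l. Proof. exact: girth_odd. Qed.
Let l_ge7 : 7 <= l. Proof. exact: girth_ge7. Qed.
Let e_sym : symmetric e. Proof. exact: girth_sym. Qed.
Let e_irr : irreflexive e. Proof. exact: girth_irr. Qed.
Local Notation base_close := (base_close (G := G)).
Local Notation base_pos := (base_pos (G := G)).
Local Notation base_adj := (base_adj (G := G)).
Local Notation base_inj := (base_inj (G := G)).
Local Notation nbr2 := (nbr2 (G := G)).
Notation base := (base e l).
Notation far := (far e).
Notation at_ := (at_ e l).

Implicit Types (f : nat -> T) (u v w x y z : T).

Lemma ipath_pre f a n s1 x : base f -> 0 < n < l -> ipath e (rcons s1 x) ->
  e x (f a) -> (forall i, a < i < a + n -> ~~ e x (f i)) ->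
  {in s1, forall u i, a <= i < a + n -> ~~ e u (f i)} ->
  ipath e (rcons s1 x ++ arc f a n).
Proof.
move=> B; case: n => // n nl p1 exa Hx Hs; rewrite arcS; apply: ipath_cat => //.
- by rewrite -arcS; apply: ipath_arc B _.
- by move=> v /mem_arc[i ir ->]; apply: Hx; arith.
- by move=> u us v; rewrite -arcS => /mem_arc[i ir ->]; apply: Hs.
Qed.

Lemma ipath_post f a n y s2 : base f -> n.+1 < l -> ipath e (y :: s2) ->
  e (f (a + n)) y -> (forall i, a <= i < a + n -> ~~ e y (f i)) ->
  {in s2, forall u i, a <= i <= a + n -> ~~ e u (f i)} ->
  ipath e (arc f a n.+1 ++ y :: s2).
Proof.
move=> B nl p2 exa Hx Hs; rewrite arcSr; apply: ipath_cat => //.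
- by rewrite -arcSr; apply: ipath_arc B _.
- by move=> v vs; rewrite e_sym; apply: Hs => //; arith.
- move=> u /mem_arc[i ir ->] v; rewrite inE => /predU1P[->|vs]; rewrite e_sym.
    exact: Hx.
  by apply: Hs => //; arith.
Qed.

Lemma size_arc f a n : size (arc f a n) = n.
Proof. by rewrite size_map size_iota. Qed.

Lemma atP f k x : base f -> e x (f k) -> ~~ e x (f (k + 2)) ->
  ~~ e x (f (k + l - 2)) -> at_ f k x.
Proof.
move=> B ex n1 n2; split=> // i ir; apply/negP => ei.
have [] := nbr2 B ex ei; try arith.
  by move=> Ei; rewrite -Ei ei in n1.
by move=> Ei; rewrite -Ei ei in n2.
Qed.

Lemma at_shift f s k x : base f -> at_ f (k + s) x -> at_ (shift s f) k x.
Proof.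
by move=> B [H1 H2]; split=> // i ir; apply: H2; arith.
Qed.

Lemma at_add f k m x : base f -> at_ f k x -> at_ f (k + m * l) x.
Proof.
move=> B [H1 H2]; split; first by rewrite (base_per _ _ B).
move=> i ir; have -> : i = (i - m * l) + m * l by arith.
by rewrite (base_per _ _ B); apply: H2; arith.
Qed.

Lemma at_refl f s k x : base f -> k <= l -> at_ f (s + l - k) x -> at_ (refl l s f) k x.
Proof.
move=> B kl [H1 H2]; split; first by rewrite reflE.
move=> i ir; case: (leqP i l) => il.
  rewrite reflE // -(base_per 1 _ B); apply: H2; arith.
have -> : i = (i - l) + 1 * l by arith.
rewrite (base_per _ _ (base_refl _ B)).
by rewrite reflE; [apply: H2; arith| |arith].
Qed.

Hypothesis red : reduced e.
Hypothesis conn : connected e.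
Hypothesis nop : no_ipath e (l + 2).

(** Otherwise [[set y]] folds onto [q] along the degenerate path [u0, q, u0]: with [a = b = q] the
    vertex [y], which is not adjacent to [q], is sent to the centre. *)
Lemma dominated y q u0 : e y u0 -> (forall n, e y n -> e q n) -> y = q.
Proof.
move=> eyu D; apply/eqP/negPn/negP => yq.
have eq := D _ eyu; have nyq : e y q = false.
  by apply/negP=> h; have := D _ h; rewrite e_irr.
suff /red /(_ y) : foldable e q u0 q u0 q [set y].
  by rewrite set11 => /(_ isT u0); rewrite eyu.
rewrite /foldable !inE e_sym eq.
have -> /= : u0 == y = false by apply/eqP=> E; rewrite E e_irr in eyu.
rewrite (eq_sym q) (negbTE yq) /=.
apply/forall_inP => x /set1P-> ; apply/forallP => u.
apply/implyP => eyu'; rewrite inE /fold_map nyq.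
case: eqP => [E|_]; last exact: D.
by rewrite E e_irr in eyu'.
Qed.

Lemma no_path s : size s = l + 2 -> ipath e s -> False.
Proof. by move=> /nop/negP. Qed.

(** A far [z] would start the induced path [z, y, x, f 0, ..., f (l - 2)] on [l + 2] vertices. *)
Lemma far_nbr_at0 f x y z : base f -> at_ f 0 x -> far f y -> e y x -> e y z -> ~ far f z.
Proof.
move=> B [x0 xi] fy eyx eyz fz;
apply: (no_path (s := rcons [:: z; y] x ++ arc f 0 (l - 1))).
  by rewrite size_cat size_arc /=; arith.
apply: ipath_pre => //; first by arith.
- by rewrite /= andbT (e_sym z) eyz eyx !andbT /=; apply: (triangle (v := y)); rewrite // e_sym.
- by move=> i ir; apply: xi; arith.
- by move=> u; rewrite !inE => /orP[]/eqP-> i _.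
Qed.

Lemma base_edge f i : base f -> e (f i) (f i.+1).
Proof. by case. Qed.

Lemma base_l f : base f -> f l = f 0.
Proof. by case=> P _; rewrite -(P 0). Qed.

(** If [y] missed [b], then [b, f 2, ..., f l, a, y] would be an induced path on [l + 2] vertices;
    [a] and [b] are not adjacent by [pentagon]. *)
Lemma far_at_transfer f a b y : base f -> at_ f 0 a -> at_ f 2 b -> far f y ->
  e y a -> e y b.
Proof.
move=> B [a0 ai] [b2 bi] fy eya; apply/negPn/negP => nyb.
have nab : ~~ e b a.
  apply: (pentagon (a := a) (b := f 0) (c := f 1) (d := f 2)) => //.
  - exact: base_edge.
  - exact: base_edge.
  - by rewrite e_sym.
apply: (no_path (s := rcons [::] b ++ f 2 :: (arc f 3 (l - 2) ++ [:: a; y]))).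
  by rewrite /= size_cat size_arc /=; arith.
have E : f 2 :: (arc f 3 (l - 2) ++ [:: a; y]) = arc f 2 (l - 2).+1 ++ [:: a; y].
  by [].
apply: ipath_cat => //.
- rewrite E; apply: ipath_post => //.
  + by arith.
  + by rewrite /= !andbT e_sym.
  + by rewrite subnKC ?base_l ?(e_sym _ a) //; arith.
  + by move=> i ir; apply: ai; arith.
  + by move=> u; rewrite inE => /eqP-> i _.
- move=> u; rewrite mem_cat => /orP[/mem_arc[i ir ->]|].
    by apply: bi; arith.
  by rewrite !inE => /orP[]/eqP->; rewrite // e_sym.
Qed.

Lemma far_at_swap f a b y : base f -> at_ f 0 a -> at_ f 2 b -> far f y ->
  e y a = e y b.
Proof.
move=> B a0 b2 fy; apply/idP/idP; first exact: (far_at_transfer B).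
apply: (far_at_transfer (base_refl 2 B)); try exact: far_refl.
  apply: at_refl => //.
  have -> : 2 + l - 0 = 2 + 1 * l by arith.
  exact: at_add.
apply: at_refl => //; first by arith.
have -> : 2 + l - 2 = 0 + 1 * l by arith.
exact: at_add.
Qed.

(** The forbidden path is [f 3, ..., f l, x, y1, y2, y3]; it starts at [f 3] because [x] sees
    [f 2]. *)
Lemma far_path_nbr02 f x y1 y2 y3 : base f -> e x (f 0) -> e x (f 2) -> e x y1 ->
  e y1 y2 -> e y2 y3 -> far f y1 -> far f y2 -> far f y3 -> e x y3.
Proof.
move=> B x0 x2 xy1 y12 y23 f1 f2 f3; apply/negPn/negP => nxy3.
apply: (no_path (s := arc f 3 (l - 3).+1 ++ [:: x; y1; y2; y3])).
  by rewrite size_cat size_arc /=; arith.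
apply: ipath_post => //; first by arith.
- rewrite /= xy1 y12 y23 nxy3 !andbT.
  by rewrite (triangle xy1 y12) (triangle y12 y23).
- by rewrite subnKC ?base_l 1?e_sym //; arith.
- move=> i ir; apply/negP=> ei.
  have [] := nbr2 B x2 ei; try arith.
  have [] := nbr2 B x0 ei; try arith.
- by move=> u; rewrite !inE => /or3P[]/eqP-> i _.
Qed.

(** The forbidden path is [m, x, v, f 1, ..., f (l - 1)]. *)
Lemma far_at_no_link f m x v : base f -> at_ f 0 x -> far f m -> e m x -> e x v ->
  at_ f 1 v -> False.
Proof.
move=> B [x0 xi] fm mx xv [v1 vi].
apply: (no_path (s := rcons [:: m; x] v ++ arc f 1 (l - 1))).
  by rewrite size_cat size_arc /=; arith.
apply: ipath_pre => //; first by arith.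
- by rewrite /= mx xv (triangle mx xv).
- by move=> i ir; apply: vi; arith.
- move=> u; rewrite !inE => /orP[]/eqP-> i ir //; apply: xi; arith.
Qed.

(** The forbidden path is [f 2, ..., f (l - 1), v, x, m, p]. *)
Lemma no_detour f v x m p : base f -> e (f l.-1) v -> e v x -> e x m -> e m p ->
  ~~ e v m -> ~~ e v p -> ~~ e x p ->
  (forall i, 2 <= i < l.-1 -> ~~ e v (f i)) ->
  (forall i, 2 <= i < l -> ~~ e x (f i)) ->
  (forall i, 2 <= i < l -> ~~ e m (f i)) ->
  (forall i, 2 <= i < l -> ~~ e p (f i)) -> False.
Proof.
move=> B lv vx xm mp nvm nvp nxp Hv Hx Hm Hp.
apply: (no_path (s := arc f 2 (l - 3).+1 ++ [:: v; x; m; p])).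
  by rewrite size_cat size_arc /=; arith.
apply: ipath_post => //; first by arith.
- by rewrite /= vx xm mp nvm nvp nxp.
- by have -> : 2 + (l - 3) = l.-1 by arith.
- by move=> i ir; apply: Hv; arith.
- move=> u; rewrite !inE => /or3P[]/eqP-> i ir; [apply: Hx|apply: Hm|apply: Hp]; arith.
Qed.

Lemma at_or f x i : base f -> e x (f i) ->
  at_ f i x \/ exists2 j, e x (f j) & e x (f (j + 2)).
Proof.
move=> B xi; case: (boolP (e x (f (i + 2)))) => [x2|n2]; first by right; exists i.
case: (boolP (e x (f (i + l - 2)))) => [x2|n2']; last by left; apply: atP.
right; exists (i + l - 2) => //; rewrite subnK; last by arith.
by case: B => -> _.
Qed.

Lemma far_nbr_at f i x y z : base f -> at_ f i x -> far f y -> e y x -> e y z ->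
  ~ far f z.
Proof.
move=> B xi fy eyx eyz fz; apply: (far_nbr_at0 (base_shift i B) _ _ eyx eyz).
- exact: at_shift.
- by move=> j; apply: fy.
- by move=> j; apply: fz.
Qed.

Lemma far_path_nbr f n i y1 y2 y3 : base f -> e n (f i) -> e y1 n -> e y1 y2 ->
  e y2 y3 -> far f y1 -> far f y2 -> far f y3 -> e y3 n.
Proof.
move=> B ni y1n y12 y23 f1 f2 f3.
case: (at_or B ni) => [ati|[j nj nj2]].
  by case: (far_nbr_at B ati f1 y1n y12 f2).
rewrite e_sym; apply: (far_path_nbr02 (base_shift j B) _ _ _ y12 y23) => //.
- by rewrite /shift addnC.
- by rewrite e_sym.
- by move=> k; apply: f1.
- by move=> k; apply: f2.
- by move=> k; apply: f3.
Qed.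

(** Induction along a walk to the cycle. If no neighbour of [v] saw the cycle, then by
    [far_path_nbr] each of them would be adjacent to the vertex [x] two steps ahead, which does, and
    [x] would dominate [v]. *)
Lemma far_near_nbr f y u : base f -> far f y -> e y u ->
  exists2 x, e y x & exists i, e x (f i).
Proof.
move=> B fy eyu.
have [k W] := conn eyu (base_edge 0 B).
suff: forall k v, walk e k v (f 0) -> (exists i, e v (f i)) \/
    (far f v /\ exists2 x, e v x & exists i, e x (f i)).
  case/(_ k y W) => [[i ei]|[]] //; by rewrite (negbTE (fy i)) in ei.
elim=> [|k' IH] v /=; first by move=> ->; left; exists 1; apply: base_edge.
case=> w vw /IH [ [i wi]|[fw [x wx [i xi]]]].
  case: (farP v B) => [fv|[j _ vj]]; last by left; exists j.
  by right; split=> //; exists w => //; exists i.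
case: (farP v B) => [fv|[j _ vj]]; last by left; exists j.
right; split=> //; apply: NNPP => no.
suff E : v = x by have := fv i; rewrite E xi.
apply: (dominated vw) => n vn; rewrite e_sym.
apply: (far_path_nbr B xi wx _ vn) => //; first by rewrite e_sym.
case: (farP n B) => // [[j _ nj]]; by case: no; exists n => //; exists j.
Qed.

(* Two adjacent vertices far from the cycle would fold onto an edge of it. *)
Section FarEdge.
Variables (f : nat -> T).
Hypothesis B : base f.

Definition straddles n j := [/\ j < l, e n (f j) & e n (f (j + 2))].

Lemma far_edge_straddles u w n i : far f u -> far f w -> e u w -> e u n -> e n (f i) ->
  exists j, straddles n j.
Proof.
move=> fu fw uw un ni; case: (at_or B ni) => [ati|[j nj nj2]].
  by case: (far_nbr_at B ati fu un uw fw).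
have jl : j %% l < l by rewrite ltn_mod; arith.
exists (j %% l); split=> //; first by rewrite (base_mod _ B).
by rewrite -(base_mod _ B) modnDml (base_mod _ B).
Qed.

Lemma walk2 u n j : e u n -> e n (f j) -> walk e 2 u (f j).
Proof. by move=> un nj; exists n => //; exists (f j). Qed.

Lemma pos22 u i j : walk e 2 u (f i) -> walk e 2 u (f j) -> i <= j <= i + l ->
  j = i \/ j = i + 2 \/ j = i + 4 \/ j = i + l - 4 \/ j = i + l - 2 \/ j = i + l.
Proof. by move=> W1 W2 H; have := base_pos B W1 W2 H; arith. Qed.

Lemma pos221 u w i j : e u w -> walk e 2 u (f i) -> walk e 2 w (f j) ->
  i <= j <= i + l -> j = i + 1 \/ j = i + 3 \/ j = i + 5 \/ j = i + l - 5 \/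
    j = i + l - 3 \/ j = i + l - 1.
Proof.
by move=> uw W1 W2 H; have := base_close B W1 W2 (walk1 uw) H; arith.
Qed.

(** A difference of 4 would put one of the four positions seen six steps away from another, which
    [pos22] excludes. *)
Lemma straddles_same u n n' j j' : e u n -> e u n' -> straddles n j -> straddles n' j' ->
  j <= j' -> j' = j \/ j' = j + 2 \/ j' = j + l - 2.
Proof.
move=> un un' [jl nj nj2] [jl' nj' nj2'] jj.
have H1 : j <= j' <= j + l by arith.
have C1 := pos22 (walk2 un nj) (walk2 un' nj') H1.
case: (leqP (j' + 2) (j + l)) => H2; last first.
  have W : walk e 2 u (f (j + l)) by case: (B) => -> _; apply: walk2 nj.
  have H3 : j + l <= j' + 2 <= j + l + l by arith.
  have C2 := pos22 W (walk2 un' nj2') H3; arith.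
have H3 : j <= j' + 2 <= j + l by arith.
have C2 := pos22 (walk2 un nj) (walk2 un' nj2') H3.
case: (leqP (j + 2) j') => H4; last by arith.
have H5 : j + 2 <= j' <= j + 2 + l by arith.
have C3 := pos22 (walk2 un nj2) (walk2 un' nj') H5; arith.
Qed.

Lemma straddles_adj u w n n' j j' : e u w -> e u n -> e w n' -> straddles n j ->
  straddles n' j' -> j <= j' ->
  j' = j + 1 \/ j' = j + 3 \/ j' = j + l - 3 \/ j' = j + l - 1.
Proof.
move=> uw un wn' [jl nj nj2] [jl' nj' nj2'] jj.
have H1 : j <= j' <= j + l by arith.
have C1 := pos221 uw (walk2 un nj) (walk2 wn' nj') H1.
have wu : e w u by rewrite e_sym.
case: (leqP (j' + 2) (j + l)) => H2; last first.
  have W : walk e 2 u (f (j + l)) by case: (B) => -> _; apply: walk2 nj.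
  have H3 : j + l <= j' + 2 <= j + l + l by arith.
  have C2 := pos221 uw W (walk2 wn' nj2') H3; arith.
have H3 : j <= j' + 2 <= j + l by arith.
have C2 := pos221 uw (walk2 un nj) (walk2 wn' nj2') H3.
case: (leqP (j + 2) j') => H4; last by arith.
have H5 : j + 2 <= j' <= j + 2 + l by arith.
have C3 := pos221 uw (walk2 un nj2) (walk2 wn' nj') H5; arith.
Qed.

Variables u w : T.
Hypotheses (fu : far f u) (fw : far f w) (uw : e u w).

(** An edge of the cycle onto which the far edge [u w] can be folded: [a] can stand for [u] and [b]
    for [w] without losing an adjacency to a vertex that sees the cycle. *)
Definition common_edge a b := [/\ e a b, exists i, a = f i, exists i, b = f i,
  forall n i, e u n -> e n (f i) -> e n a &
  forall n i, e w n -> e n (f i) -> e n b].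

End FarEdge.

(** Position 3 of [x'] leaves only 0 and 2 to the neighbours of [u], all of which then see [f 2];
    symmetrically those of [w] are left with 1 and 3, and see [f 3]. *)
Lemma far_edge_common3 f u w x x' : base f -> far f u -> far f w -> e u w ->
  e u x -> e w x' -> straddles f x 0 -> straddles f x' 3 -> common_edge f u w (f 2) (f 3).
Proof.
move=> B fu fw uw ux wx' t0 t3; have wu : e w u by rewrite e_sym.
split; [exact: base_edge|by exists 2|by exists 3| |] => n i un ni.
  have [j tj] := far_edge_straddles B fu fw uw un ni.
  have C1 := straddles_same B ux un t0 tj (leq0n _).
  have C2 : j = 0 \/ j = 2.
    case: (leqP j 3) => j3.
      by have := straddles_adj B uw un wx' tj t3 j3; arith.
    by have := straddles_adj B wu wx' un t3 tj (ltnW j3); case: tj; arith.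
  by case: tj => _; case: C2 => ->.
have [j tj] := far_edge_straddles B fw fu wu un ni.
have C1 := straddles_adj B uw ux un t0 tj (leq0n _).
have C2 : j = 1 \/ j = 3.
  case: (leqP j 3) => j3.
    by have := straddles_same B un wx' tj t3 j3; arith.
  by have := straddles_same B wx' un t3 tj (ltnW j3); case: tj; arith.
by case: tj => _; case: C2 => ->.
Qed.

End Paths.

(** * The vertices without a neighbour on the cycle are independent *)

Section FarIndependent.
Variables (T : finType) (e : rel T) (l : nat).
Context {G : odd_girth e l}.
Let l_odd : odd l. Proof. exact: girth_odd. Qed.
Let l_ge7 : 7 <= l. Proof. exact: girth_ge7. Qed.
Let e_sym : symmetric e. Proof. exact: girth_sym. Qed.
Let e_irr : irreflexive e. Proof. exact: girth_irr. Qed.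
Local Notation base_close := (base_close (G := G)).
Local Notation base_pos := (base_pos (G := G)).
Local Notation base_adj := (base_adj (G := G)).
Local Notation base_inj := (base_inj (G := G)).
Local Notation nbr2 := (nbr2 (G := G)).
Notation base := (base e l).
Notation far := (far e).
Notation at_ := (at_ e l).
Notation straddles := (straddles e l).
Hypothesis red : reduced e.
Hypothesis conn : connected e.
Hypothesis nop : no_ipath e (l + 2).
Implicit Types (f : nat -> T) (u v w x y z : T).
Local Notation far_path_nbr := (far_path_nbr (G := G) nop).
Local Notation far_near_nbr := (far_near_nbr (G := G) red conn nop).
Local Notation far_edge_straddles := (far_edge_straddles (G := G) nop).
Local Notation straddles_adj := (straddles_adj (G := G)).
Local Notation straddles_same := (straddles_same (G := G)).
Local Notation far_edge_common3 := (far_edge_common3 (G := G) nop).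

(** The folded set is the component of [w] in the graph induced on the far vertices. By
    [far_path_nbr], two steps inside it preserve the neighbours that see the cycle, so each of its
    vertices has those of [u] or those of [w], alternately along edges; adjacency to [x'] tells the
    two kinds apart. *)
Lemma fold_far_edge f u w a b : base f -> far f u -> far f w -> e u w ->
  common_edge e f u w a b -> False.
Proof.
move=> B fu fw uw [ab [ia Ea] [ib Eb] Ua Wb].
have wu : e w u by rewrite e_sym.
have [x' wx' [i' x'i]] := far_near_nbr B fw wu.
have nx'u : e u x' = false.
  by apply/negbTE; rewrite (triangle (v := w)).
pose farb v := [forall i : 'I_l, ~~ e v (f i)].
have farbP v : reflect (far f v) (farb v).
  apply: (iffP forallP) => [H|H i //].
  by case: (farP v B) => // [[i il]]; have := H (Ordinal il) => /= /negbTE->.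
pose efar v v' := [&& e v v', farb v & farb v'].
have P4' y1 y2 y3 n i : efar y1 y2 -> efar y2 y3 -> e n (f i) ->
    e y1 n = e y3 n.
  move=> /and3P[e12 /farbP f1 /farbP f2] /and3P[e23 _ /farbP f3] ni.
  apply/idP/idP => H; first exact: (far_path_nbr B ni H e12 e23).
  by apply: (far_path_nbr B ni H _ _ f3 f2 f1); rewrite e_sym.
pose N1 v v' := forall n i, e n (f i) -> e v n = e v' n.
have Inv v : connect efar w v -> farb v /\
    ((N1 v w /\ forall n, efar v n -> N1 n u) \/
     (N1 v u /\ forall n, efar v n -> N1 n w)).
  case/connectP=> p; elim/last_ind: p v => [|p v' IH] v.
    move=> _ ->; split; first exact/farbP.
    left; split=> // n wn m i mi; apply/esym; apply: P4' _ wn mi.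
    by rewrite /efar uw /=; apply/andP; split; apply/farbP.
  rewrite rcons_path last_rcons => /andP[pw pv] ->.
  have [_ H] := IH _ pw erefl; set v0 := last w p in pv H.
  have := pv; rewrite {1}/efar => /and3P[_ _ fv']; split=> //.
  case: H => -[H1 H2]; [right|left]; split=> [|n vn m i mi]; try exact: H2;
   by rewrite -(P4' _ _ _ _ _ pv vn mi); apply: H1 mi.
pose X := [set v | connect efar w v].
have Xfar v : v \in X -> far f v by rewrite inE => /Inv[/farbP].
have nXc i : f i \notin X.
  by apply/negP => /Xfar /(_ i.+1); rewrite (base_edge _ B).
have phiW v : N1 v w -> fold_map e x' b a b x' v = b.
  by move=> H; rewrite /fold_map (H _ _ x'i) wx'.
have phiU v : N1 v u -> fold_map e x' b a b x' v = a.
  by move=> H; rewrite /fold_map (H _ _ x'i) nx'u.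
suff F : foldable e x' b a b x' X.
  have wX : w \in X by rewrite inE connect0.
  by have := red F wX x'; rewrite wx'.
rewrite /foldable e_sym ab Ea Eb !nXc /= -Ea -Eb.
apply/forall_inP=> v vX; apply/forallP=> n; apply/implyP=> vn.
have [fv Hv] := Inv v (etrans (esym (in_set _ _)) vX).
case: ifP => nX.
  have fn := Xfar _ nX.
  have en : efar v n by rewrite /efar vn fv; apply/farbP.
  by case: Hv => -[H1 /(_ _ en) H2]; rewrite ?(phiU _ H1) ?(phiW _ H1)
     ?(phiU _ H2) ?(phiW _ H2) // e_sym.
case: (farP n B) => [fn|[i _ ni]]; last first.
  by case: Hv => -[H1 _]; rewrite ?(phiU _ H1) ?(phiW _ H1) e_sym;
    [apply: (Wb _ _ _ ni)|apply: (Ua _ _ _ ni)]; rewrite -(H1 _ _ ni).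
case/negP: (negbT nX); move: vX; rewrite !inE => H.
by apply: connect_trans H (connect1 _); rewrite /efar vn fv; apply/farbP.
Qed.

Lemma straddles_shift f s n k : k < l -> e n (f (k + s)) -> e n (f (k + s + 2)) ->
  straddles (shift s f) n k.
Proof. by move=> kl H1 H2; split=> //; rewrite /shift addnAC. Qed.

Lemma no_straddles3 f u w n n' j j' : base f -> far f u -> far f w -> e u w ->
  e u n -> e w n' -> straddles f n j -> straddles f n' j' ->
  j' = j + 3 \/ j' + l = j + 3 -> False.
Proof.
move=> B fu fw uw un wn' [jl nj nj2] [jl' nj' nj2'] H.
have Bj := base_shift j B.
have fu' : far (shift j f) u by move=> i; apply: fu.
have fw' : far (shift j f) w by move=> i; apply: fw.
apply: (fold_far_edge Bj fu' fw' uw).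
apply: (far_edge_common3 Bj fu' fw' uw un wn').
  by apply: straddles_shift; rewrite ?add0n //; arith.
apply: straddles_shift; first by arith.
  case: H => H; first by rewrite addnC -H.
  by rewrite addnC -H; case: (B) => -> _.
case: H => H; first by rewrite (addnC 3) -H.
by rewrite (addnC 3) -H addnAC; case: (B) => -> _.
Qed.

(** With difference 3 excluded, neighbours of [u] straddle only from 0 or 2 and those of [w] only
    from 1 or [l - 1]. So the former all see [f 2] and the latter all see [f 1]. *)
Lemma no_straddles1 f u w x x' : base f -> far f u -> far f w -> e u w ->
  e u x -> e w x' -> straddles f x 0 -> straddles f x' 1 -> False.
Proof.
move=> B fu fw uw ux wx' t0 t1; have wu : e w u by rewrite e_sym.
apply: (fold_far_edge (a := f 2) (b := f 1) B fu fw uw).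
split; [by rewrite e_sym; apply: (base_edge 1 B)|by exists 2|by exists 1| |] => n i un ni.
  have [j tj] := far_edge_straddles B fu fw uw un ni.
  have C1 := straddles_same B ux un t0 tj (leq0n _).
  have C2 : j = 0 \/ j = 2.
    case: C1; first by left.
    case; first by right.
    by move=> Ej; case: (no_straddles3 B fu fw uw un wx' tj t1); arith.
  by case: tj => _; case: C2 => ->.
have [j tj] := far_edge_straddles B fw fu wu un ni.
have C1 := straddles_adj B uw ux un t0 tj (leq0n _).
have C2 : j = 1 \/ j = l - 1.
  case: C1; first by left.
  case; first by move=> Ej; case: (no_straddles3 B fu fw uw ux un t0 tj); arith.
  case; last by right.
  move=> Ej; have j1 : 1 <= j by arith.
  by have := straddles_same B wx' un t1 tj j1; arith.
case: tj => _; case: C2 => ->; first by [].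
move=> _; have -> : l - 1 + 2 = 1 + l by arith.
by case: (B) => -> _.
Qed.

(** After a rotation a neighbour of [u] straddles from 0. By [straddles_adj] a neighbour of [w]
    straddles at difference 1 or 3 in one of the two directions, and all four cases have been folded
    away. *)
Lemma far_edge_free f u w : base f -> far f u -> far f w -> ~~ e u w.
Proof.
move=> B fu fw; apply/negP=> uw.
have wu : e w u by rewrite e_sym.
have [n un [i ni]] := far_near_nbr B fu uw.
have [n' wn' [i' ni']] := far_near_nbr B fw wu.
have [j [jl nj nj2]] := far_edge_straddles B fu fw uw un ni.
have Bj := base_shift j B.
have fu' : far (shift j f) u by move=> ?; apply: fu.
have fw' : far (shift j f) w by move=> ?; apply: fw.
have t0 : straddles (shift j f) n 0 by apply: straddles_shift; rewrite ?add0n //; arith.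
have {}ni' : e n' (shift j f (i' + j * l.-1)).
  rewrite /shift -addnA -mulnSr prednK; last by arith.
  by rewrite (base_per _ _ B).
have [k tk] := far_edge_straddles Bj fw' fu' wu wn' ni'.
have C := straddles_adj Bj uw un wn' t0 tk (leq0n _).
case: C => [Ek|[Ek|[Ek|Ek]]].
- by subst k; apply: (no_straddles1 Bj fu' fw' uw un wn').
- by apply: (no_straddles3 Bj fu' fw' uw un wn' t0 tk); arith.
- by apply: (no_straddles3 Bj fw' fu' wu wn' un tk t0); arith.
case: (t0) (tk) => _ a0 a2 [_ b0 b2].
have Bk := base_shift k Bj.
apply: (no_straddles1 Bk _ _ wu wn' un).
- by move=> ?; apply: fw.
- by move=> ?; apply: fu.
- by apply: straddles_shift; rewrite ?add0n //; apply: leq_trans l_ge7.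
have E : 1 + k = l by clear -Ek l_ge7; arith.
apply: straddles_shift; rewrite ?E.
- exact: leq_trans l_ge7.
- by have := Bj.1 0 => ->.
- by rewrite addnC; have := Bj.1 2 => ->.
Qed.

End FarIndependent.

(** * Far vertices are saturated or lie in the middle of a window *)

Section FarVertices.
Variables (T : finType) (e : rel T) (l : nat).
Context {G : odd_girth e l}.
Let l_odd : odd l. Proof. exact: girth_odd. Qed.
Let l_ge7 : 7 <= l. Proof. exact: girth_ge7. Qed.
Let e_sym : symmetric e. Proof. exact: girth_sym. Qed.
Let e_irr : irreflexive e. Proof. exact: girth_irr. Qed.
Local Notation base_close := (base_close (G := G)).
Local Notation base_pos := (base_pos (G := G)).
Local Notation base_adj := (base_adj (G := G)).
Local Notation base_inj := (base_inj (G := G)).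
Local Notation nbr2 := (nbr2 (G := G)).
Local Notation pos22 := (pos22 (G := G)).
Notation base := (base e l).
Notation far := (far e).
Notation at_ := (at_ e l).
Notation straddles := (straddles e l).
Hypothesis red : reduced e.
Hypothesis conn : connected e.
Hypothesis nop : no_ipath e (l + 2).
Implicit Types (f g h : nat -> T) (u v w x y z : T).
Local Notation far_at_swap := (far_at_swap (G := G) nop).
Local Notation far_edge_free := (far_edge_free (G := G) red conn nop).
Local Notation dominated := (dominated (G := G) red).

(** A vertex through which the cycle can be rerouted in place of [f 2], its neighbours serving as
    [f 1] and [f 3]; [f 2] itself may be one. The index [l] stands for [f 0]. *)
Definition middle f y := [/\ forall i, 4 <= i <= l -> ~~ e y (f i),
  forall n, e y n -> e n (f 0) || e n (f 4),
  exists2 n, e y n & e n (f 0) & exists2 n, e y n & e n (f 4)].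

Definition pendant f u a := e a u /\ forall i, e a (f i) -> f i = u.

(** The point of the definition: one pebbled pendant vertex at each cycle vertex that has any gives
    every saturated vertex a pebbled neighbour. *)
Definition saturated f y := exists u, [/\ exists i, u = f i,
  exists a, pendant f u a & forall a, pendant f u a -> e y a].

Lemma middle_ext f g y : f =1 g -> middle f y -> middle g y.
Proof.
move=> E [H1 H2 [n0 y0 n00] [n4 y4 n44]]; split.
- by move=> i; rewrite -E; apply: H1.
- by move=> n; rewrite -!E; apply: H2.
- by exists n0; rewrite // -E.
- by exists n4; rewrite // -E.
Qed.

Lemma middle_refl f y : base f -> middle (refl l 4 f) y -> middle f y.
Proof.
move=> B [H1 H2 [n0 y0 n00] [n4 y4 n44]].
have R d : d <= l -> refl l 4 f d = f (4 + l - d) by move=> ?; apply: reflE.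
have l4 : 4 <= l by arith.
have R0 : refl l 4 f 0 = f 4 by rewrite R // subn0; case: B.
have R4 : refl l 4 f 4 = f 0 by rewrite R // addKn -{1}(add0n l); case: B.
move: H2 n00 n44; rewrite R0 R4 => H2 n00 n44; split.
- move=> i ir; have -> : i = 4 + l - (4 + l - i) by arith.
  by rewrite -R; [apply: H1|]; arith.
- by move=> n yn; rewrite orbC; apply: H2.
- by exists n4.
- by exists n0.
Qed.

Lemma saturated_range f g y : (forall i, exists j, f i = g j) ->
  (forall i, exists j, g i = f j) -> saturated g y -> saturated f y.
Proof.
move=> fg gf [u [[i ->] [a ga] H]].
have P b : pendant f (g i) b <-> pendant g (g i) b.
  split=> -[H1 H2]; split=> // j bj.
    by have [k E] := gf j; rewrite E; apply: H2; rewrite -E.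
  by have [k E] := fg j; rewrite E; apply: H2; rewrite -E.
have [j E] := gf i.
exists (g i); split; first by exists j.
  by exists a; apply/P.
by move=> b /P; apply: H.
Qed.

Lemma saturated_shift s f y : base f -> saturated (shift s f) y -> saturated f y.
Proof.
move=> B; apply: saturated_range => i; last by exists (i + s).
exists (i + s * l.-1); rewrite /shift -addnA -mulnSr prednK ?(base_per _ _ B) //.
arith.
Qed.

Lemma saturated_refl s f y : base f -> s <= l -> saturated (refl l s f) y ->
  saturated f y.
Proof.
move=> B sl; apply: saturated_range => i; last by exists (s + i * l.-1).
have il : i %% l < l by rewrite ltn_mod; arith.
exists (s + l - i %% l); rewrite -(base_mod i B).
case: (leqP (s + l - i %% l) l) => H.
  by rewrite reflE //; congr f; arith.
have -> : s + l - i %% l = (s - i %% l) + 1 * l by arith.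
rewrite (base_per _ _ (base_refl s B)) reflE //; last by arith.
by rewrite -(base_per 1 (i %% l) B); congr f; arith.
Qed.

Lemma at_pendant f k a : base f -> k < l -> at_ f k a <-> pendant f (f k) a.
Proof.
move=> B kl; split=> -[H1 H2]; split=> //.
  move=> i; rewrite -(base_mod i B) => ai.
  have il : i %% l < l by rewrite ltn_mod; arith.
  case: (ltngtP (i %% l) k) => [lt|gt|->] //.
    have := H2 (i %% l + l); case: (B) => -> _; rewrite ai; move=> H.
    by have := H _ => /(_ ltac:(arith)).
  by have := H2 _ => /(_ (i %% l) ltac:(arith)); rewrite ai.
move=> i ir; apply/negP=> /H2 E.
by have := base_inj B (esym E); arith.
Qed.

Definition window f y := forall n i, e y n -> e n (f i) -> i < l ->
  i = 0 \/ i = 2 \/ i = 4.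

(** If some vertex is pendant at [f 2], then [far_at_swap] against [n1] joins [y] to all such
    vertices. If none is, each neighbour of [y] that sees [f 2] also sees [f 0] or [f 4]; one sees
    [f 4], since otherwise [f 0] would dominate [y]. *)
Lemma window_cases f y n1 : base f -> far f y -> window f y ->
  e y n1 -> e n1 (f 0) -> ~~ e n1 (f 2) -> saturated f y \/ middle f y.
Proof.
move=> B fy win yn1 n10 n12.
have l4 : 4 < l by arith.
have at0 : at_ f 0 n1.
  split=> // i ir; apply/negP=> ni.
  have il : i < l by arith.
  case: (win _ _ yn1 ni il) => [|[]] Ei; first by arith.
    by rewrite -Ei ni in n12.
  by rewrite Ei in ni; case: (nbr2 B n10 ni _); arith.
case: (classic (exists a, at_ f 2 a)) => [[a at2]|no2].
  left; exists (f 2); split; first by exists 2.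
    by exists a; apply/at_pendant => //; arith.
  by move=> b /at_pendant at2b; rewrite -(far_at_swap B at0 (at2b B _)) //; arith.
right.
have N n : e y n -> e n (f 0) || e n (f 4).
  move=> yn; case: (farP n B) => [fn|[i il ni]].
    by have := far_edge_free B fy fn; rewrite yn.
  case: (win _ _ yn ni il) => [Ei|[Ei|Ei]].
  - by rewrite -Ei ni.
  - apply/negPn/negP; rewrite negb_or => /andP[n0 n4]; case: no2; exists n.
    rewrite Ei in ni; apply/at_pendant => //; first by arith.
    split=> // j; rewrite -(base_mod j B) => nj.
    have jl : j %% l < l by rewrite ltn_mod; arith.
    case: (win _ _ yn nj jl) => [|[]] Ej; rewrite Ej // in nj *.
      by rewrite nj in n0.
    by rewrite nj in n4.
  - by rewrite -Ei ni orbT.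
split=> //.
- by exists n1.
apply: NNPP => no4.
apply: (@far_neq _ _ _ f y 0 B fy).
apply: (dominated yn1) => n yn; rewrite e_sym.
by case/orP: (N _ yn) => // n4; case: no4; exists n.
Qed.

(** By [pos22] the positions reached from [y] by walks of length 2 differ pairwise by 0, 2 or 4
    modulo [l] in one direction or the other; so they fit into three consecutive steps of two. *)
Lemma window_exists f y u : base f -> far f y -> e y u ->
  exists s, window (shift s f) y.
Proof.
move=> B fy yu.
have [n0 yn0 [i0 ni0]] : exists2 x, e y x & exists i, e x (f i).
  exists u => //; case: (farP u B) => [fu|[i _ ui]]; last by exists i.
  by have := far_edge_free B fy fu; rewrite yu.
pose g := shift i0 f.
have Bg : base g by apply: base_shift.
have W0 : walk e 2 y (g 0) by apply: (walk2 yn0).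
have sh s i : s + i = l \/ s + i = 0 \/ True -> shift s g i = shift (s + i0) f i.
  by move=> _; rewrite /g /shift addnA.
suff [s ws] : exists s, window (shift s g) y.
  by exists (s + i0) => n i; rewrite -sh; [apply: ws|right; right].
pose P i := exists2 n, e y n & e n (g i).
have PW i : P i -> walk e 2 y (g i) by case=> n yn ni; apply: walk2 ni.
have C0 i : P i -> i < l -> i = 0 \/ i = 2 \/ i = 4 \/ i = l - 4 \/ i = l - 2.
  by move=> /PW Wi il; have := pos22 Bg W0 Wi; move=> /(_ ltac:(arith)); arith.
have C i j : P i -> P j -> i < l -> i <= j < l ->
    j = i \/ j = i + 2 \/ j = i + 4 \/ j = i + l - 4 \/ j = i + l - 2.
  by move=> /PW Wi /PW Wj il jl; have := pos22 Bg Wi Wj; move=> /(_ ltac:(arith)); arith.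
have shP s n i : s < l -> e y n -> e n (shift s g i) -> i < l ->
    P (if i + s < l then i + s else i + s - l).
  move=> sl yn; rewrite /shift => ni il; exists n => //; case: ifP => // H.
  by rewrite -(base_per 1 _ Bg) mul1n subnK //; arith.
case: (classic (P 4)) => [far_path_nbr02|nP4].
  exists 0 => n i yn; rewrite /shift addn0 => ni il.
  have Pi : P i by exists n.
  have := C0 _ Pi il.
  case: (leqP i 4) => i4; first by have := C _ _ Pi far_path_nbr02 il; arith.
  by have := C _ _ far_path_nbr02 Pi; arith.
case: (classic (P (l - 4))) => [P4'|nP4'].
  exists (l - 4) => n i yn ni il; have := shP _ _ _ _ yn ni il => /(_ ltac:(arith)).
  set k := if _ then _ else _ => Pk.
  have kl : k < l by rewrite /k; case: ifP; arith.
  have D : k = 0 \/ k = l - 4 \/ k = l - 2.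
    have := C0 _ Pk kl.
    case: (leqP k (l - 4)) => k4; first by have := C _ _ Pk P4' kl; arith.
    by have := C _ _ P4' Pk; arith.
  by move: D; rewrite /k; case: ifP; arith.
exists (l - 2) => n i yn ni il; have := shP _ _ _ _ yn ni il => /(_ ltac:(arith)).
set k := if _ then _ else _ => Pk.
have kl : k < l by rewrite /k; case: ifP; arith.
have D : k = 0 \/ k = 2 \/ k = l - 2.
  case: (C0 _ Pk kl) => [|[|[E|[E|]]]]; try by auto.
    by rewrite E in Pk.
  by rewrite E in Pk.
by move: D; rewrite /k; case: ifP; arith.
Qed.

(** Some neighbour [n1] misses the centre [h 2], which would otherwise dominate [y]. It sees [h 0]
    or [h 4], and reflecting the window reduces the second case to the first. *)
Lemma far_cases f y u : base f -> far f y -> e y u ->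
  saturated f y \/ exists2 s, s < l & middle (shift s f) y.
Proof.
move=> B fy yu; have [s win] := window_exists B fy yu.
pose h := shift s f.
have Bh : base h by apply: base_shift.
have fh : far h y by move=> i; apply: fy.
suff [|Mh] : saturated h y \/ middle h y.
- by move=> /(saturated_shift B); left.
- right; exists (s %% l); first by rewrite ltn_mod; arith.
  apply: middle_ext Mh => i; rewrite /h /shift.
  by rewrite -(base_mod (i + s %% l) B) modnDmr (base_mod _ B).
have [n1 [yn1 n12]] : exists n1, e y n1 /\ ~~ e n1 (h 2).
  apply: NNPP => no; apply: (@far_neq _ _ _ h y 2 Bh fh).
  apply: (dominated yu) => n yn; rewrite e_sym; apply/negPn/negP => n2.
  by apply: no; exists n.
have [i il ni] : exists2 i, i < l & e n1 (h i).
  case: (farP n1 Bh) => // fn; have := far_edge_free Bh fh fn.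
  by rewrite yn1.
have l4 : 4 <= l by arith.
case: (win _ _ yn1 ni il) => [Ei|[Ei|Ei]]; rewrite Ei in ni.
- exact: (window_cases Bh fh win yn1 ni n12).
- by rewrite ni in n12.
have Br : base (refl l 4 h) by exact: base_refl.
have R d : d <= l -> refl l 4 h d = h (4 + l - d) by move=> ?; apply: reflE.
have hl k : h (k + l) = h k by case: Bh.
have [|m] : saturated (refl l 4 h) y \/ middle (refl l 4 h) y.
- apply: (window_cases (n1 := n1) Br) => //.
  + by move=> j; apply: fh.
  + move=> n j yn; case: (ltnP j l) => // jl; rewrite R ?(ltnW jl) // => nj _.
    case: (leqP j 4) => j4.
      have Ej : 4 + l - j = (4 - j) + l by arith.
      rewrite Ej hl in nj; have := win _ _ yn nj; arith.
    have := win _ _ yn nj; arith.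
  + by rewrite R; [have -> : 4 + l - 2 = 2 + l by arith|arith]; rewrite hl.
- by move=> /(saturated_refl Bh l4); left.
- by right; apply: middle_refl.
Qed.

End FarVertices.

(** * The middle vertices of one window *)

Section Middle.
Variables (T : finType) (e : rel T) (l : nat).
Context {G : odd_girth e l}.
Let l_odd : odd l. Proof. exact: girth_odd. Qed.
Let l_ge7 : 7 <= l. Proof. exact: girth_ge7. Qed.
Let e_sym : symmetric e. Proof. exact: girth_sym. Qed.
Let e_irr : irreflexive e. Proof. exact: girth_irr. Qed.
Local Notation base_pos := (base_pos (G := G)).
Local Notation nbr2 := (nbr2 (G := G)).
Local Notation triangle := (triangle (G := G)).
Local Notation pos22 := (pos22 (G := G)).
Notation base := (base e l).
Notation far := (far e).
Notation at_ := (at_ e l).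
Notation middle := (middle e l).
Hypothesis red : reduced e.
Hypothesis conn : connected e.
Hypothesis nop : no_ipath e (l + 2).
Implicit Types (f g h : nat -> T) (u v w x y z : T).
Local Notation far_at_swap := (far_at_swap (G := G) nop).
Local Notation far_at_no_link := (far_at_no_link (G := G) nop).
Local Notation no_detour := (no_detour (G := G) nop).
Local Notation far_edge_free := (far_edge_free (G := G) red conn nop).
Local Notation dominated := (dominated (G := G) red).

Definition middleb f y := [&& [forall i : 'I_l.+1, (4 <= i) ==> ~~ e y (f i)],
  [forall n, e y n ==> e n (f 0) || e n (f 4)],
  [exists n, e y n && e n (f 0)] & [exists n, e y n && e n (f 4)]].

Lemma middleP f y : reflect (middle f y) (middleb f y).
Proof.
apply: (iffP and4P) => [[/forallP H1 /forallP H2 /existsP[n /andP[a b]] /existsP[n' /andP[c d]]]|].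
  split; [|by move=> ? ?; apply: (implyP (H2 _))|by exists n|by exists n'].
  by move=> i /andP[i4 il]; apply: (implyP (H1 (Ordinal (il : i < l.+1)))).
case=> H1 H2 [n a b] [n' c d]; split.
- by apply/forallP=> i; apply/implyP=> i4; apply: H1; rewrite i4 -ltnS ltn_ord.
- by apply/forallP=> m; apply/implyP=> ?; apply: H2.
- by apply/existsP; exists n; apply/andP.
- by apply/existsP; exists n'; apply/andP.
Qed.

Lemma refl4E f d : base f -> d <= l -> refl l 4 f d = f (4 + l - d).
Proof. by move=> B dl; apply: reflE. Qed.

Lemma refl40 f : base f -> refl l 4 f 0 = f 4.
Proof. by move=> B; rewrite refl4E // subn0; case: B. Qed.

Lemma refl44 f : base f -> refl l 4 f 4 = f 0.
Proof.
move=> B; rewrite refl4E //; last by arith.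
by rewrite addKn -[l]add0n; case: B.
Qed.

Lemma middle_refl4 f y : base f -> middle (refl l 4 f) y <-> middle f y.
Proof.
move=> B; split; first exact: middle_refl.
case=> [H1 H2 [n0 y0 n00] [n4 y4 n44]].
split; rewrite ?refl40 ?refl44 //.
- by move=> i ir; rewrite refl4E //; [apply: H1|]; arith.
- by move=> n yn; rewrite orbC; apply: H2.
- by exists n4.
- by exists n0.
Qed.

Definition sub4 f a b c d i := let j := i %% l in
  if j == 0 then a else if j == 1 then b else if j == 2 then c
  else if j == 3 then d else f i.

Lemma sub4_0 f a b c d : sub4 f a b c d 0 = a.
Proof. by rewrite /sub4 mod0n. Qed.

Lemma sub4_123 f a b c d : [/\ sub4 f a b c d 1 = b, sub4 f a b c d 2 = c &
  sub4 f a b c d 3 = d].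
Proof. by rewrite /sub4 !modn_small //; arith. Qed.

Lemma sub4_ge f a b c d i : 4 <= i < l -> sub4 f a b c d i = f i.
Proof.
by case/andP=> i4 il; rewrite /sub4 modn_small //; case: i i4 il => [|[|[|[|]]]].
Qed.

Lemma sub4_base f a b c d : base f -> e (f l.-1) a -> e a b -> e b c ->
  e c d -> e d (f 4) -> base (sub4 f a b c d).
Proof.
move=> B la ab bc cd d4; split=> i.
  by rewrite /sub4 modnDr; case: B => -> _.
have E j : f j = f (j %% l) by rewrite (base_mod _ B).
rewrite /sub4 (E i) (E i.+1).
have -> : i.+1 %% l = if (i %% l).+1 == l then 0 else (i %% l).+1.
  rewrite -addn1 -modnDml addn1; case: eqP => [->|ne]; first by rewrite modnn.
  by rewrite modn_small // ltn_neqAle (introN eqP ne) ltn_mod /=; arith.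
have : i %% l < l by rewrite ltn_mod; arith.
move: (i %% l) => j jl.
case: (j.+1 =P l) => [jl1|jl1].
  have -> : j = l.-1 by arith.
  have : 4 <= l.-1 by arith.
  by case: (l.-1) la => [|[|[|[|k]]]].
by case: j jl jl1 => [|[|[|[|j]]]] jl jl1 //=; apply: (base_edge _ B).
Qed.

Lemma sub4_far f a b c d v : base f -> base (sub4 f a b c d) ->
  ~~ e v a -> ~~ e v b -> ~~ e v c -> ~~ e v d ->
  (forall i, 4 <= i < l -> ~~ e v (f i)) -> far (sub4 f a b c d) v.
Proof.
move=> B Bg va vb vc vd H i; rewrite -(base_mod i Bg).
have : i %% l < l by rewrite ltn_mod; arith.
have [E1 E2 E3] := sub4_123 f a b c d.
case: (i %% l) => [|[|[|[|j]]]] jl; rewrite ?sub4_0 ?E1 ?E2 ?E3 //.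
by rewrite sub4_ge //; apply: H.
Qed.

Section Facts.
Variables (f : nat -> T).
Hypothesis B : base f.

Lemma middle_arc m i : middle f m -> 4 <= i <= l -> ~~ e m (f i).
Proof. by case=> H _ _ _; apply: H. Qed.

Lemma middle0 m : middle f m -> ~~ e m (f 0).
Proof. by move=> Mm; rewrite -(base_l B) middle_arc //; arith. Qed.

Lemma middle4 m : middle f m -> ~~ e m (f 4).
Proof. by move=> Mm; rewrite middle_arc //; arith. Qed.

Lemma middle_nbr m n : middle f m -> e m n -> e n (f 0) || e n (f 4).
Proof. by case=> _ H _ _; apply: H. Qed.

Lemma middle_indep m m' : middle f m -> middle f m' -> ~~ e m m'.
Proof.
move=> Mm Mm'; apply/negP=> /(middle_nbr Mm).
by rewrite (negbTE (middle0 Mm')) (negbTE (middle4 Mm')).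
Qed.

(** An edge would close the walk [x, m, r, f 4, x'] to length 5. *)
Lemma middle_PR m x x' : middle f m -> e m x -> e x (f 0) -> e x' (f 4) ->
  ~~ e x x'.
Proof.
move=> Mm mx x0 x'4; have [_ _ _ [r mr r4]] := Mm; rewrite e_sym.
by apply: (pentagon (b := m) (c := r) (d := f 4)) => //; rewrite e_sym.
Qed.

Lemma walkP m x : middle f m -> e m x -> e x (f 0) -> walk e 3 x (f 4).
Proof.
move=> Mm mx x0; have [_ _ _ [r mr r4]] := Mm.
by exists m; rewrite 1?e_sym //; exists r => //; exists (f 4).
Qed.

Lemma walk_l u k : walk e k u (f 0) -> walk e k u (f l).
Proof. by rewrite (base_l B). Qed.

Lemma middle_Pfar m x i : middle f m -> e m x -> e x (f 0) -> 4 <= i < l ->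
  ~~ e x (f i).
Proof.
move=> Mm mx x0 ir; apply/negP=> xi.
have xl : e x (f l) by rewrite (base_l B).
have Ei : i = l - 2 by case: (nbr2 B xi xl); arith.
by have := base_pos B (walkP Mm mx x0) (walk1 xi); arith.
Qed.

Lemma middle_Rfar m x i : middle f m -> e m x -> e x (f 4) -> 4 < i <= l ->
  ~~ e x (f i).
Proof.
move=> Mm mx x0 ir; apply/negP=> xi.
have Ei : i = 6 by case: (nbr2 B x0 xi); arith.
have [_ _ [p mp p0] _] := Mm.
have W : walk e 3 x (f l).
  by apply: walk_l; exists m; rewrite 1?e_sym //; exists p => //; exists (f 0).
by have := base_pos B (walk1 xi) W; arith.
Qed.

Lemma middle_Vfar m x v : 9 <= l -> middle f m -> e m x -> e x (f 0) ->
  e x v -> ~~ e v (f l.-1) -> ~~ e v (f 0) /\ forall i, 4 <= i < l -> ~~ e v (f i).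
Proof.
move=> l9 Mm mx x0 xv vl.
have nv0 : ~~ e v (f 0) by rewrite e_sym in xv; apply: triangle xv x0.
split=> // i ir; apply/negP=> vi.
have xv' : e v x by rewrite e_sym.
have W2 : walk e 2 v (f l) by apply: walk_l; apply: walk2 x0.
have W4 : walk e 4 v (f 4) by exists x => //; apply: walkP Mm mx x0.
have := base_pos B W4 (walk1 vi).
have := base_pos B (walk1 vi) W2.
have : i <> l.-1 by move=> E; rewrite -E vi in vl.
case: (i =P 4) => [E4|_]; last by arith.
by have := middle_PR Mm mx x0; rewrite -E4 => /(_ _ vi); rewrite xv.
Qed.

Lemma base_last : e (f l.-1) (f 0).
Proof.
have lE : l.-1.+1 = l by rewrite prednK //; arith.
by rewrite -(base_l B) -[in X in e _ X]lE; apply: (base_edge _ B).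
Qed.

Lemma window_base m p r : middle f m -> e m p -> e p (f 0) -> e m r -> e r (f 4) ->
  base (sub4 f (f 0) p m r).
Proof.
move=> Mm mp p0 mr r4; by apply: sub4_base => //; [apply: base_last|rewrite e_sym|rewrite e_sym].
Qed.

(** This is the condition under which one middle vertex is far from the cycle rerouted through the
    other, see [clean_far]. *)
Definition clean u v := forall n, e u n -> ~~ e v n.

Lemma cleanC u v : clean u v -> clean v u.
Proof. by move=> c n vn; apply/negP=> /c; rewrite vn. Qed.

Lemma clean_far m m' p r : middle f m -> e m p -> e p (f 0) -> e m r ->
  e r (f 4) -> middle f m' -> clean m m' -> far (sub4 f (f 0) p m r) m'.
Proof.
move=> Mm mp p0 mr r4 Mm' c; apply: sub4_far => //.
- exact: window_base.
- exact: middle0.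
- exact: c.
- exact: middle_indep.
- exact: c.
- by move=> i ir; apply: middle_arc => //; arith.
Qed.

Lemma P_at m m' p r x : middle f m -> e m p -> e p (f 0) -> e m r ->
  e r (f 4) -> middle f m' -> e m' x -> e x (f 0) -> ~~ e m x ->
  at_ (sub4 f (f 0) p m r) 0 x.
Proof.
move=> Mm mp p0 mr r4 Mm' m'x x0 nmx; split; first by rewrite sub4_0.
have [E1 E2 E3] := sub4_123 f (f 0) p m r.
have x0' : e (f 0) x by rewrite e_sym.
have := middle_PR Mm' m'x x0 r4; have := triangle p0 x0'.
move=> nxp nxr; case=> [|[|[|[|i]]]] ir; rewrite ?E1 ?E2 ?E3 //.
- by rewrite e_sym.
- by rewrite e_sym.
- by rewrite sub4_ge; [apply: (middle_Pfar Mm' m'x x0)|]; arith.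
Qed.

(** Reroute the cycle through [y']. If [v] missed [p] and [r], it would be far from the new cycle,
    and all its neighbours would see [f 0] or [f 4]: the only other candidate, a neighbour attached
    just at [f (l - 2)], is adjacent to [y''] by [far_at_swap]. So [v] would be middle or dominated
    by [f 0]. *)
Lemma near_middle m x v y' y'' p r : 9 <= l ->
  middle f m -> e m x -> e x (f 0) -> e x v -> ~ middle f v -> ~~ e v (f l.-1) ->
  middle f y' -> middle f y'' -> clean y' y'' -> ~~ e y' x ->
  e y' p -> e p (f 0) -> e y' r -> e r (f 4) -> e v p || e v r.
Proof.
move=> l9 Mm mx x0 xv nMv nvl My My' cl nyx yp p0 yr r4.
apply/negPn/negP; rewrite negb_or => /andP[nvp nvr].
have [nv0 Vfar] := middle_Vfar l9 Mm mx x0 xv nvl.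
have nvy : ~~ e v y'.
  rewrite e_sym; apply/negP=> yv; have := middle_nbr My yv; rewrite (negbTE nv0) /=.
  by apply/negP; apply: Vfar; arith.
pose g := sub4 f (f 0) p y' r.
have Bg : base g by apply: window_base.
have fv : far g v by apply: sub4_far.
have atx : at_ g 0 x by apply: (P_at My yp p0 yr r4 Mm).
have [E1 E2 E3] := sub4_123 f (f 0) p y' r.
have vx : e v x by rewrite e_sym.
have W2 : walk e 2 v (g 0) by apply: walk2 vx _; rewrite /g sub4_0.
have W4 : walk e 4 v (f 4) by exists x => //; apply: walkP Mm mx x0.
have n4 n : e v n -> ~~ e n (f (l - 4)).
  move=> vn; apply/negP=> ni.
  by have := base_pos B W4 (walk2 vn ni); arith.
have N n : e v n -> e n (f 0) || e n (f 4).
  move=> vn; case: (farP n Bg) => [fn|[i il ni]].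
    by have := far_edge_free Bg fv fn; rewrite vn.
  have C : i = 0 \/ i = 2 \/ i = 4 \/ i = l - 4 \/ i = l - 2.
    by have := pos22 Bg W2 (walk2 vn ni); arith.
  case: C => [Ei|[Ei|[Ei|[Ei|Ei]]]]; rewrite Ei in ni.
  - by rewrite /g sub4_0 in ni; rewrite ni.
  - by rewrite /g E2 e_sym in ni; apply: middle_nbr ni.
  - by rewrite /g sub4_ge in ni; [rewrite ni orbT|arith].
  - by rewrite /g sub4_ge in ni; [have := n4 _ vn; rewrite ni|arith].
  apply/negPn/negP; rewrite negb_or => /andP[nn0 nn4].
  have gl k : g (k + l) = g k by case: Bg.
  have atn : at_ g (l - 2) n.
    apply: atP => //.
      by rewrite subnK; [rewrite -(add0n l) gl /g sub4_0|arith].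
    have -> : l - 2 + l - 2 = l - 4 + l by arith.
    by rewrite gl /g sub4_ge; [apply: n4|arith].
  have [_ _ [p'' yp'' p''0] _] := My'.
  have nyp'' : ~~ e y' p'' by apply: (cleanC cl).
  have atp : at_ g (0 + 1 * l) p''.
    by apply: at_add => //; apply: (P_at My yp p0 yr r4 My').
  have Bs := base_shift (l - 2) Bg.
  have fy'' : far (shift (l - 2) g) y'' by move=> i'; apply: (clean_far My).
  have : e y'' n.
    rewrite (far_at_swap (b := p'') Bs _ _ fy'') //.
      by apply: at_shift.
    apply: at_shift => //; have -> : 2 + (l - 2) = 0 + 1 * l by arith.
    exact: atp.
  move=> /(middle_nbr My'); rewrite (negbTE nn0) /= => n4'; by rewrite n4' in nn4.
apply: nMv; split=> //.
- move=> i ir; case: (ltnP i l) => il; first by apply: Vfar; arith.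
  have -> : i = l by arith.
  by rewrite (base_l B).
- by exists x.
apply: NNPP => no; have E : v = f 0.
  apply: (dominated vx) => n vn; rewrite e_sym.
  by case/orP: (N n vn) => // n4'; case: no; exists n.
by rewrite E e_sym p0 in nvp.
Qed.

(** By [near_middle] with [m] as [y''], only the case remains that [v] sees [p] but not [r]. Then
    [m, x, v] hang on the cycle through [y'] in the way that [far_at_no_link] forbids. *)
Lemma near_middle2 m x v y' p r : 9 <= l ->
  middle f m -> e m x -> e x (f 0) -> e x v -> ~ middle f v -> ~~ e v (f l.-1) ->
  middle f y' -> clean m y' -> e y' p -> e p (f 0) -> e y' r -> e r (f 4) -> e v r.
Proof.
move=> l9 Mm mx x0 xv nMv nvl My cl yp p0 yr r4.
apply/negPn/negP => nvr.
have nyx := cl _ mx.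
have := near_middle l9 Mm mx x0 xv nMv nvl My Mm (cleanC cl) nyx yp p0 yr r4.
rewrite (negbTE nvr) orbF => vp.
have [nv0 Vfar] := middle_Vfar l9 Mm mx x0 xv nvl.
have [E1 E2 E3] := sub4_123 f (f 0) p y' r.
have Bg : base (sub4 f (f 0) p y' r) by apply: window_base.
apply: (far_at_no_link (f := sub4 f (f 0) p y' r) (m := m) (x := x) (v := v)) => //.
- exact: (P_at My yp p0 yr r4 Mm).
- exact: clean_far (cleanC cl).
split; first by rewrite E1.
move=> i ir; case: (i =P l) => [->|il].
  by rewrite -(add0n l); case: (Bg) => -> _; rewrite sub4_0.
case: i ir il => [|[|[|[|i]]]] // ir il; rewrite ?E2 ?E3 //.
  rewrite e_sym; apply/negP=> yv; have := middle_nbr My yv; rewrite (negbTE nv0) /=.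
  by apply/negP; apply: Vfar; arith.
by rewrite sub4_ge; [apply: Vfar|]; arith.
Qed.

(** Putting [v, x, m, r] in place of [f 0, ..., f 3] gives a closed walk of the same length. If [p]
    missed both [v] and [m], the edge [y' p] would be far from it, against [far_edge_free]. *)
Lemma weird_base m x v r y' p : 9 <= l ->
  middle f m -> e m x -> e x (f 0) -> e x v -> e v (f l.-1) ->
  e m r -> e r (f 4) -> middle f y' -> ~~ e y' x -> ~~ e y' r ->
  e y' p -> e p (f 0) -> e p v || e p m.
Proof.
move=> l9 Mm mx x0 xv vl mr r4 My nyx nyr yp p0.
apply/negPn/negP; rewrite negb_or => /andP[npv npm].
have l0 := base_last.
have nv0 : ~~ e v (f 0) by apply: triangle vl l0.
have nv4 : ~~ e v (f 4).
  apply/negP=> v4; case: (nbr2 B v4 vl); arith.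
have nyv : ~~ e y' v.
  by apply/negP=> /(middle_nbr My); rewrite (negbTE nv0) (negbTE nv4).
have Bg : base (sub4 f v x m r).
  by apply: sub4_base => //; rewrite e_sym.
suff [fy fp] : far (sub4 f v x m r) y' /\ far (sub4 f v x m r) p.
  by have := far_edge_free Bg fy fp; rewrite yp.
split.
  apply: sub4_far => //; first exact: middle_indep.
  by move=> i ir; apply: middle_arc => //; arith.
have x0' : e (f 0) x by rewrite e_sym.
apply: sub4_far => //.
- exact: triangle p0 x0'.
- exact: (middle_PR My yp p0 r4).
- by move=> i ir; apply: (middle_Pfar My yp p0).
Qed.

(** For [l = 7], the one length below 9, the listed path has exactly the forbidden [l + 2]
    vertices. *)
Lemma three_middle y1 y2 y3 : l = 7 -> middle f y1 -> middle f y2 -> middle f y3 ->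
  clean y1 y2 -> clean y1 y3 -> clean y2 y3 -> False.
Proof.
move=> l7 M1 M2 M3 c12 c13 c23.
have [_ _ [x1 yx1 x10] _] := M1.
have [_ _ [x2 yx2 x20] [r2 yr2 r24]] := M2.
have [_ _ _ [r3 yr3 r34]] := M3.
have c21 := cleanC c12; have c31 := cleanC c13; have c32 := cleanC c23.
apply: (no_path nop (s := [:: y1; x1; f 0; x2; y2; r2; f 4; r3; y3])).
  by rewrite l7.
have x20' : e (f 0) x2 by rewrite e_sym.
have r24' : e (f 4) r2 by rewrite e_sym.
have r34' : e (f 4) r3 by rewrite e_sym.
have nf04 : ~~ e (f 0) (f 4).
  by apply/negP=> a; case: (base_adj (G := G) B a); arith.
have nf0r m r : middle f m -> e m r -> e r (f 4) -> ~~ e (f 0) r.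
  by move=> Mm mr r4; rewrite e_sym -(base_l B) (middle_Rfar Mm mr r4) //; arith.
have Pf4 m x : middle f m -> e m x -> e x (f 0) -> ~~ e x (f 4).
  by move=> Mm mx x0; apply: (middle_Pfar Mm mx x0); arith.
rewrite /= yx1 x10 x20' (e_sym x2) yx2 yr2 r24 r34' (e_sym r3) yr3 /=.
rewrite (middle0 M1) (c21 _ yx2) (middle_indep M1 M2) (c21 _ yr2) (middle4 M1).
rewrite (c31 _ yr3) (middle_indep M1 M3).
rewrite (triangle x10 x20') (e_sym x1 y2) (c12 _ yx1) (middle_PR M1 yx1 x10 r24).
rewrite (Pf4 _ _ M1 yx1 x10) (middle_PR M1 yx1 x10 r34) (e_sym x1 y3) (c13 _ yx1).
rewrite (e_sym (f 0) y2) (middle0 M2) (nf0r _ _ M2 yr2 r24) nf04.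
rewrite (nf0r _ _ M3 yr3 r34) (e_sym (f 0) y3) (middle0 M3).
rewrite (middle_PR M2 yx2 x20 r24) (Pf4 _ _ M2 yx2 x20) (middle_PR M2 yx2 x20 r34).
rewrite (e_sym x2 y3) (c23 _ yx2) (middle4 M2) (c32 _ yr3) (middle_indep M2 M3).
by rewrite (triangle r24 r34') (e_sym r2 y3) (c23 _ yr2) (e_sym (f 4) y3) (middle4 M3).
Qed.

(** What prevents the fold at [x]: it would be sent to [z], while its neighbour [v], which need not
    move, is not adjacent to [z]. *)
Definition obstacle w z x m v := [/\ e x (f 0), ~~ e x w, middle f m & e m x] /\
  [/\ e x v, ~ middle f v & ~~ e v z].

Definition obstacle' w z' x m v := [/\ e x (f 4), ~~ e x w, middle f m & e m x] /\
  [/\ e x v, ~ middle f v & ~~ e v z'].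

(* Without obstacles, the middle vertices and their neighbourhoods would fold
   onto the path z, w, z'. *)
Lemma fold_obstacle w z z' y : 9 <= l -> middle f w -> middle f y -> clean w y ->
  e w z -> e z (f 0) -> e w z' -> e z' (f 4) ->
  (exists x m v, obstacle w z x m v) \/ (exists x m v, obstacle' w z' x m v).
Proof.
move=> l9 Mw My cl wz z0 wz' z'4; apply: NNPP => no.
pose X1 := [set m | middleb f m && (m != w)].
pose XP := [set x | [&& e x (f 0), ~~ e x w & [exists m, middleb f m && e m x]]].
pose XR := [set x | [&& e x (f 4), ~~ e x w & [exists m, middleb f m && e m x]]].
pose X := X1 :|: XP :|: XR.
have PRn x : e x (f 0) -> e x (f 4) -> False.
  by move=> x0 x4; case: (nbr2 B x0 x4); arith.
have phi1 m : middle f m -> fold_map e (f 0) z w z' (f 4) m = w.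
  by move=> Mm; rewrite /fold_map (negbTE (middle0 Mm)) (negbTE (middle4 Mm)).
have phiP x : e x (f 0) -> fold_map e (f 0) z w z' (f 4) x = z.
  by move=> x0; rewrite /fold_map x0.
have phiR x : e x (f 4) -> fold_map e (f 0) z w z' (f 4) x = z'.
  move=> x4; rewrite /fold_map x4; case: ifP => // x0; by case: (PRn x).
have nP x m : e m x -> middle f m -> ~ middle f x.
  by move=> mx Mm Mx; have := middle_indep Mm Mx; rewrite mx.
have yX : y \in X.
  rewrite !inE (introT (middleP _ _) My) /=; case: eqP => [yw|] //.
  by have := cl _ wz; rewrite yw wz.
have [u yu _] : exists2 n, e y n & e n (f 0) by case: My.
suff F : foldable e (f 0) z w z' (f 4) X by have := red F yX u; rewrite yu.
have zX : z \notin X.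
  rewrite !inE (e_sym z w) wz /= !andbF !orbF.
  by case: middleP => // /(nP _ _ wz); case.
have z'X : z' \notin X.
  rewrite !inE (e_sym z' w) wz' /= !andbF !orbF.
  by case: middleP => // /(nP _ _ wz'); case.
have wX : w \notin X.
  by rewrite !inE eqxx andbF /= (negbTE (middle0 Mw)) (negbTE (middle4 Mw)).
rewrite /foldable e_sym wz wz' zX wX z'X /=.
apply/forall_inP=> x; rewrite !inE => xX.
apply/forallP=> n; apply/implyP=> xn.
case/orP: xX => [/orP[/andP[/middleP Mx xw]|]|].
- rewrite (phi1 _ Mx).
  case: (boolP (e n w)) => [nw|nnw].
    have nM : ~ middle f n by apply: nP xn Mx.
    by rewrite !inE nw !andbF !orbF /=; case: middleP => //; rewrite e_sym.
  have Ex : [exists m, middleb f m && e m n].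
    by apply/existsP; exists x; rewrite xn andbT; apply/middleP.
  case/orP: (middle_nbr Mx xn) => nn.
    by rewrite !inE nn nnw Ex /= orbT (phiP _ nn).
  by rewrite !inE nn nnw Ex /= !orbT (phiR _ nn).
- case/and3P=> x0 nxw /existsP[m /andP[/middleP Mm mx]]; rewrite (phiP _ x0).
  case: (boolP (middleb f n)) => [/middleP Mn|/middleP nMn].
    rewrite !inE (introT (middleP _ _) Mn) /= (phi1 _ Mn).
    have -> : n != w by apply: contraNneq nxw => <-.
    by rewrite e_sym.
  have nz : e n z.
    apply/negPn/negP=> nnz; apply: no; left; exists x, m, n.
    by split; split.
  have x0' : e (f 0) x by rewrite e_sym.
  have nx : e n x by rewrite e_sym.
  have nn0 : ~~ e n (f 0) by apply: (triangle nx x0).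
  have nn4 : ~~ e n (f 4).
    by apply/negP=> n4; have := middle_PR Mm mx x0 n4; rewrite xn.
  rewrite !inE (negbTE nn0) (negbTE nn4) /= !orbF.
  by case: middleP => //; rewrite e_sym.
case/and3P=> x4 nxw /existsP[m /andP[/middleP Mm mx]]; rewrite (phiR _ x4).
case: (boolP (middleb f n)) => [/middleP Mn|/middleP nMn].
  rewrite !inE (introT (middleP _ _) Mn) /= (phi1 _ Mn).
  have -> : n != w by apply: contraNneq nxw => <-.
  by rewrite e_sym.
have nz : e n z'.
  apply/negPn/negP=> nnz; apply: no; right; exists x, m, n.
  by split; split.
have nx : e n x by rewrite e_sym.
have nn4 : ~~ e n (f 4) by apply: (triangle nx x4).
have nn0 : ~~ e n (f 0).
  have [_ _ [p mp p0] _] := Mm.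
  have p0' : e (f 0) p by rewrite e_sym.
  have mp' : e p m by rewrite e_sym.
  exact: (pentagon (G := G) p0' mp' mx xn).
rewrite !inE (negbTE nn0) (negbTE nn4) /= !orbF.
by case: middleP => //; rewrite e_sym.
Qed.

End Facts.
End Middle.

(** * The pebble game *)

(* [F] is a winning strategy for the duplicator in the existential [k]-pebble
   game of the list colouring instance [(e, Lst)]. *)
Record strategy (T : finType) (e : rel T) (Lst : T -> nat -> Prop) (k : nat)
    (F : seq (T * nat) -> Prop) : Prop := Strategy {
  st_sub s s' : F s -> {subset s' <= s} -> F s';
  st_ext s v : size s < k -> F s -> exists a, F ((v, a) :: s);
  st_loc s v (a : nat) w (b : nat) : F s -> (v, a) \in s -> (w, b) \in s ->
    [/\ a < 3, Lst v a, v = w -> a = b & e v w -> a <> b]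
}.

Section Strategy.
Variables (T : finType) (e : rel T) (Lst : T -> nat -> Prop) (k : nat).
Variable F : seq (T * nat) -> Prop.
Hypothesis Fst : strategy e Lst k F.

(** Bad vertices keep three colours and so escape the majority argument behind [two_consistent]. *)
Definition bad s v := forall b, b < 3 -> F ((v, b) :: s).

Lemma bad_mono s s' v : {subset s <= s'} -> bad s' v -> bad s v.
Proof.
move=> ss b c c3; apply: (st_sub Fst (b c c3)) => x.
by rewrite !inE => /orP[->|/ss->] //; rewrite orbT.
Qed.

Lemma not_bad s v : ~ bad s v -> exists2 b, b < 3 & ~ F ((v, b) :: s).
Proof.
move=> nb; apply: NNPP => no; apply: nb => b b3; apply: NNPP => nF.
by apply: no; exists b.
Qed.

Lemma play s v : size s < k -> F s -> exists2 a, F ((v, a) :: s) &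
  a < 3 /\ forall u (b : nat), (u, b) \in s -> e v u -> a <> b.
Proof.
move=> sk Fs; have [a Fa] := st_ext Fst v sk Fs; exists a => //.
split=> [|u b ub vu]; first by case: (st_loc Fst Fa (mem_head _ _) (mem_head _ _)).
have ub' : (u, b) \in (v, a) :: s by rewrite inE ub orbT.
by case: (st_loc Fst Fa (mem_head _ _) ub') => _ _ _; apply.
Qed.

(** Two different colours around [n] would force the third one on it, but the bad vertex [y] can
    take that very colour. The two pebbles beyond [s] go to [y] and [n]. *)
Lemma two_colours s y n u1 (a1 : nat) u2 (a2 : nat) : size s + 2 <= k -> bad s y ->
  e y n -> e n y -> e n u1 -> e n u2 -> (u1, a1) \in s -> (u2, a2) \in s -> a1 = a2.
Proof.
move=> sk by_ yn ny nu1 nu2 in1 in2; apply: NNPP => ne.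
have [Fs a13 a23] : [/\ F s, a1 < 3 & a2 < 3].
  have Fs : F s by apply: (st_sub Fst (by_ 0 isT)) => x; rewrite inE => ->; rewrite orbT.
  by case: (st_loc Fst Fs in1 in1) => ? _ _ _; case: (st_loc Fst Fs in2 in2) => ? _ _ _.
have [b b3 [b1 b2]] : exists2 b, b < 3 & b <> a1 /\ b <> a2.
  by exists (3 - (a1 + a2)); arith.
have sk' : size ((y, b) :: s) < k by rewrite /=; arith.
have [c Fc [c3 cn]] := play n sk' (by_ b b3).
have cb := cn _ _ (mem_head _ _) ny.
have sub x : x \in s -> x \in (y, b) :: s by rewrite inE orbC => ->.
have := cn _ _ (sub _ in1) nu1; have := cn _ _ (sub _ in2) nu2; arith.
Qed.
End Strategy.

(** * At most six pebbles settle a window *)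

Section Resolve.
Variables (T : finType) (e : rel T) (l : nat).
Context {G : odd_girth e l}.
Let l_odd : odd l. Proof. exact: girth_odd. Qed.
Let l_ge7 : 7 <= l. Proof. exact: girth_ge7. Qed.
Let e_sym : symmetric e. Proof. exact: girth_sym. Qed.
Let e_irr : irreflexive e. Proof. exact: girth_irr. Qed.
Local Notation base_pos := (base_pos (G := G)).
Local Notation nbr2 := (nbr2 (G := G)).
Local Notation triangle := (triangle (G := G)).
Notation base := (base e l).
Notation middle := (middle e l).
Notation clean := (clean e).
Hypothesis red : reduced e.
Hypothesis conn : connected e.
Hypothesis nop : no_ipath e (l + 2).
Implicit Types (u v w x y z : T).
Local Notation no_detour := (no_detour (G := G) nop).
Local Notation near_middle := (near_middle (G := G) red conn nop).
Local Notation near_middle2 := (near_middle2 (G := G) red conn nop).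
Local Notation weird_base := (weird_base (G := G) red conn nop).
Local Notation fold_obstacle := (fold_obstacle (G := G) red).
Local Notation three_middle := (three_middle (G := G) nop).

Variables (Lst : T -> nat -> Prop) (k : nat) (F : seq (T * nat) -> Prop).
Hypothesis Fst : strategy e Lst k F.
Notation bad := (bad F).

Definition resolved f n (s : seq (T * nat)) := exists s' : seq (T * nat), [/\ F s', {subset s <= s'},
  size s' <= size s + n & forall v, middle f v -> ~ bad s' v].

Lemma resolved_trans f n n' (s s' : seq (T * nat)) : {subset s <= s'} -> size s' <= size s + n ->
  resolved f n' s' -> resolved f (n + n') s.
Proof.
move=> ss ns [t [Ft st nt H]]; exists t; split=> //; last by arith.
by move=> x /ss /st.
Qed.

Section Window.
Variables (f : nat -> T) (al be ga : nat).
Hypothesis B : base f.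
Hypothesis abc : [/\ al < 3, be < 3, ga < 3 & [/\ al <> be, ga <> al & ga <> be]].

(** A common neighbour would see [w], coloured [ga], and an end of the window, coloured [al] or
    [be], against [two_colours]. *)
Lemma bad_clean s w y : size s + 2 <= k -> (f 0, al) \in s -> (f 4, be) \in s ->
  (w, ga) \in s -> middle f w -> middle f y -> bad s y -> clean w y.
Proof.
move=> sk s0 s4 sw Mw My by_ n wn; apply/negP=> yn.
have [_ _ _ [_ ga_al ga_be]] := abc.
have [ny nw] : e n y /\ e n w by rewrite ![e n _]e_sym.
case/orP: (middle_nbr Mw wn) => nf.
  by apply: ga_al; apply: (two_colours Fst sk by_ yn ny nw nf sw s0).
by apply: ga_be; apply: (two_colours Fst sk by_ yn ny nw nf sw s4).
Qed.

(** If [v] misses [f l.-1], it suffices to pebble [v] and a common neighbour of [v] and [y]. If not,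
    [weird_base] shows that [m] shares a neighbour with every middle vertex that shares none with
    [w]; four pebbles force [ga] on [m], and then no middle vertex can be bad by [bad_clean]. *)
Lemma resolve_left s w z x m v y y2 : 9 <= l -> size s + 6 <= k -> F s ->
  (f 0, al) \in s -> (f 4, be) \in s -> (w, ga) \in s -> (y, ga) \in s ->
  middle f w -> middle f y -> middle f y2 -> clean w y -> bad s y2 ->
  e w z -> e z (f 0) -> obstacle e l f w z x m v -> resolved f 4 s.
Proof.
move=> l9 sk Fs s0 s4 sw sy Mw My My2 wy by2 wz z0.
case=> [[x0 nxw Mm mx] [xv nMv nvz]].
have [a3 b3 g3 [ab ga_ gb]] := abc.
have sk2 : size s + 2 <= k by arith.
have wy2 := bad_clean sk2 s0 s4 sw Mw My2 by2.
have yy2 := bad_clean sk2 s0 s4 sy My My2 by2.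
have nwx : ~~ e w x by rewrite e_sym.
have [_ _ [py ypy py0] [ry yry ry4]] := My.
have [_ _ _ [r mr r4]] := Mm.
have [_ _ _ [z' wz' z'4]] := Mw.
have xm : e x m by rewrite e_sym.
have vx : e v x by rewrite e_sym.
case: (boolP (e v (f l.-1))) => [vl|nvl]; last first.
  have [nv0 Vfar] := middle_Vfar B l9 Mm mx x0 xv nvl.
  have [n yn vn] : exists2 n, e y n & e v n.
    case: (boolP (e y x)) => [yx|nyx]; first by exists x.
    have := near_middle B l9 Mm mx x0 xv nMv nvl My Mw (cleanC wy) nyx ypy py0 yry ry4.
    by case/orP=> H; [exists py|exists ry].
  have [nv ny] : e n v /\ e n y by rewrite ![e n _]e_sym.
  have sk3 : size s < k by arith.
  have [c Fc [c3 cn]] := play Fst n sk3 Fs.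
  have sk4 : size ((n, c) :: s) < k by rewrite /=; arith.
  have [d Fd [d3 dn]] := play Fst v sk4 Fc.
  have sub q : q \in s -> q \in [:: (v, d), (n, c) & s].
    by rewrite !inE => ->; rewrite !orbT.
  exists [:: (v, d), (n, c) & s]; split=> //; first by rewrite /=; arith.
  have dc := dn _ _ (mem_head _ _) vn.
  have cg := cn _ _ sy ny.
  have sk5 : size [:: (v, d), (n, c) & s] + 2 <= k by rewrite /=; arith.
  move=> y3 My3 by3.
  have yy3 := bad_clean sk5 (sub _ s0) (sub _ s4) (sub _ sy) My My3 by3.
  have [_ _ [p3 yp3 p30] [r3 yr3 r34]] := My3.
  case/orP: (middle_nbr My yn) => nf.
    have vr3 := near_middle2 B l9 My yn nf nv nMv nvl My3 yy3 yp3 p30 yr3 r34.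
    (* The colours [ga] of [y] and [al] of [f 0] leave [be] for [n], so [v] is not coloured [be];
       but [two_colours] at [r3], which sees [v] and [f 4], demands it. *)
    have E := cn _ _ s0 nf.
    have [r3y r3v] : e r3 y3 /\ e r3 v by rewrite ![e r3 _]e_sym.
    have := two_colours Fst sk5 by3 yr3 r3y r3v r34 (mem_head _ _) (sub _ s4).
    by arith.
  have vp3 : e v p3.
    have Br : base (refl l 4 f) by apply: base_refl.
    have R := middle_refl4 _ B.
    have [R0 R4] := (refl40 (G := G) B, refl44 (G := G) B).
    apply: (near_middle2 Br (m := y) (x := n) (y' := y3) (p := r3) (r := p3) l9) => //.
    - exact/R.
    - by move/R.
    - rewrite refl4E //; last by arith.
      have -> : 4 + l - l.-1 = 5 by arith.
      by apply: Vfar; arith.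
    - exact/R.
    - by rewrite R4.
  have E := cn _ _ s4 nf.
  have [p3y p3v] : e p3 y3 /\ e p3 v by rewrite ![e p3 _]e_sym.
  have := two_colours Fst sk5 by3 yp3 p3y p3v p30 (mem_head _ _) (sub _ s0).
  by arith.
have nzv : ~~ e z v by rewrite e_sym.
(* no neighbour of [f 0] in the neighbourhood of [y'] sees [v] *)
have nPv y' p' : middle f y' -> clean w y' -> e y' p' -> e p' (f 0) -> ~~ e p' v.
  move=> My' wy' yp' p'0; apply/negP=> p'v.
  have [_ _ _ [r' yr' r'4]] := My'.
  have nwp : ~~ e w p' by apply: (cleanC wy').
  have nwr : ~~ e w r' by apply: (cleanC wy').
  have := weird_base B l9 My' yp' p'0 p'v vl yr' r'4 Mw nwp nwr wz z0.
  by rewrite (negbTE nzv) e_sym (negbTE (wy' _ wz)).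
have nclean y' : middle f y' -> clean w y' -> ~ clean m y'.
  move=> My' wy' my'; have [_ _ [p' yp' p'0] _] := My'.
  have := weird_base B l9 Mm mx x0 xv vl mr r4 My' (my' _ mx) (my' _ mr) yp' p'0.
  rewrite (negbTE (nPv _ _ My' wy' yp' p'0)) /= => p'm.
  by have := cleanC my' yp'; rewrite e_sym p'm.
(* [y] and [y2] have no common neighbour, so one of them misses [r]; for that one, [weird_base]
   makes a neighbour seeing [f 0] adjacent to [m]. *)
have [ys [ps [[Mys wys Fys ysp psm] ps0]]] : exists ys ps, [/\ middle f ys,
    clean w ys, F ((ys, ga) :: s), e ys ps & e ps m] /\ e ps (f 0).
  have K ys : middle f ys -> clean w ys -> ~~ e ys r ->
      exists ps, [/\ e ys ps, e ps m & e ps (f 0)].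
    move=> Mys wys nysr; have [_ _ [p yp p0] _] := Mys; exists p; split=> //.
    have nysx : ~~ e ys x.
      by apply/negP=> ysx; have := nPv _ _ Mys wys ysx x0; rewrite xv.
    have := weird_base B l9 Mm mx x0 xv vl mr r4 Mys nysx nysr yp p0.
    by rewrite (negbTE (nPv _ _ Mys wys yp p0)).
  case: (boolP (e y r)) => yr.
    have [p [yp pm p0]] := K _ My2 wy2 (yy2 _ yr).
    by exists y2, p; split=> //; split=> //; apply: by2.
  have [p [yp pm p0]] := K _ My wy yr.
  exists y, p; split=> //; split=> //; apply: (st_sub Fst Fs) => u.
  by rewrite inE => /predU1P[->|].
(* Otherwise [v, x, m, ps] would be a forbidden detour at the cycle rerouted through [w]. *)
have mz' : e m z'.
  apply/negPn/negP=> nmz'.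
  have [E1 E2 E3] := sub4_123 (G := G) f (f 0) z w z'.
  have Bg := window_base (G := G) B Mw wz z0 wz' z'4.
  set g := sub4 l f (f 0) z w z' in E1 E2 E3 Bg.
  have gE i : 4 <= i < l -> g i = f i by apply: sub4_ge.
  have gl : g l.-1 = f l.-1 by apply: gE; arith.
  have [_ Hx] := P_at (G := G) B Mw wz z0 wz' z'4 Mm mx x0 nwx.
  have nwp : ~~ e w ps by apply: (cleanC wys).
  have [_ Hp] := P_at (G := G) B Mw wz z0 wz' z'4 Mys ysp ps0 nwp.
  have vl' : e (f l.-1) v by rewrite e_sym.
  have x0' : e (f 0) x by rewrite e_sym.
  have mps : e m ps by rewrite e_sym.
  apply: (no_detour (f := g) (v := v) (x := x) (m := m) (p := ps) Bg) => //.
  - by rewrite gl.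
  - exact: triangle vx xm.
  - by rewrite e_sym; apply: (nPv _ _ Mys wys ysp ps0).
  - by rewrite e_sym; apply: triangle ps0 x0'.
  - move=> i ir; apply/negP=> vi.
    have vgl : e v (g l.-1) by rewrite gl.
    have Ei : i = l - 3 by case: (nbr2 Bg vi vgl); arith.
    have W4 : walk e 4 v (f 4) by exists x => //; apply: walkP Mm mx x0.
    rewrite gE in vi; last by arith.
    by have := base_pos B W4 (walk1 vi); arith.
  - by move=> i ir; apply: Hx; arith.
  - case=> [|[|[|[|i]]]] // ir; rewrite ?E2 ?E3 //; first exact: middle_indep Mm Mw.
    by rewrite gE; [apply: (middle_arc Mm)|]; arith.
  - by move=> i ir; apply: Hp; arith.
have psys : e ps ys by rewrite e_sym.
have z'w : e z' w by rewrite e_sym.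
have mps : e m ps by rewrite e_sym.
(* The chain of forced colours: [ps] sees [ys] and [f 0], so it is [be]; [z'] sees [w] and [f 4], so
   it is [al]; [m] sees both, so it is [ga]. *)
have sk1 : size ((ys, ga) :: s) < k by rewrite /=; arith.
have [c Fc [c3 cn]] := play Fst ps sk1 Fys.
have in1 q : q \in s -> q \in (ys, ga) :: s by rewrite inE orbC => ->.
have cg := cn _ _ (mem_head _ _) psys.
have ca := cn _ _ (in1 _ s0) ps0.
have sk3 : size [:: (ps, c), (ys, ga) & s] < k by rewrite /=; arith.
have [d Fd [d3 dn]] := play Fst z' sk3 Fc.
have in2 q : q \in s -> q \in [:: (ps, c), (ys, ga) & s].
  by rewrite inE orbC => /in1->.
have dg := dn _ _ (in2 _ sw) z'w.
have db := dn _ _ (in2 _ s4) z'4.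
have sk4 : size [:: (z', d), (ps, c), (ys, ga) & s] < k by rewrite /=; arith.
have [h Fh [h3 hn]] := play Fst m sk4 Fd.
have hd := hn _ _ (mem_head _ _) mz'.
have hc : h <> c by apply: (hn ps) => //; rewrite !inE eqxx orbT.
have hg : h = ga by arith.
rewrite hg in Fh.
pose t := [:: (m, ga), (z', d), (ps, c), (ys, ga) & s].
have in3 q : q \in s -> q \in t by rewrite /t !inE => ->; rewrite !orbT.
exists t; split=> //; first by rewrite /=; arith.
move=> y3 My3 by3.
have skt : size t + 2 <= k by rewrite /=; arith.
apply: (nclean y3 My3).
  exact: (bad_clean skt (in3 _ s0) (in3 _ s4) (in3 _ sw) Mw My3 by3).
exact: (bad_clean skt (in3 _ s0) (in3 _ s4) (mem_head _ _) Mm My3 by3).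
Qed.

End Window.

(** Two bad middle vertices [w] and [y] receive the third colour, and an obstacle on one side of the
    window, after a reflection if needed, costs at most four further pebbles. The last two of the 8
    are for the test in [two_colours]. *)
Lemma resolve f (al be : nat) s : base f -> size s + 8 <= k -> F s ->
  (f 0, al) \in s -> (f 4, be) \in s -> al <> be -> resolved f 6 s.
Proof.
move=> B sk Fs s0 s4 ab.
have [a3 _ _ _] := st_loc Fst Fs s0 s0; have [b3 _ _ _] := st_loc Fst Fs s4 s4.
have [ga g3 [ga_ gb]] : exists2 b, b < 3 & b <> al /\ b <> be.
  by exists (3 - (al + be)); arith.
have abc : [/\ al < 3, be < 3, ga < 3 & [/\ al <> be, ga <> al & ga <> be]] by [].
have bca : [/\ be < 3, al < 3, ga < 3 & [/\ be <> al, ga <> be & ga <> al]].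
  by split=> //; split=> //; arith.
have stop (t : seq (T * nat)) : F t -> {subset s <= t} -> size t <= size s + 2 ->
    ~ (exists2 v, middle f v & bad t v) -> resolved f 6 s.
  move=> Ft st nt no; exists t; split=> //; first by arith.
  by move=> v Mv bv; apply: no; exists v.
case: (classic (exists2 v, middle f v & bad s v)) => [[w Mw bw]|]; last first.
  by apply: stop => //; arith.
pose s1 := (w, ga) :: s.
have F1 : F s1 := bw _ g3.
have sub1 q : q \in s -> q \in s1 by rewrite inE orbC => ->.
case: (classic (exists2 v, middle f v & bad s1 v)) => [[y My by_]|]; last first.
  by apply: stop => //=; arith.
have sk1 : size s1 + 2 <= k by rewrite /=; arith.
have wy := bad_clean abc sk1 (sub1 _ s0) (sub1 _ s4) (mem_head _ _) Mw My by_.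
pose s2 := (y, ga) :: s1.
have far_nbr_at0 : F s2 := by_ _ g3.
have sub2 q : q \in s -> q \in s2 by rewrite inE orbC => /sub1->.
case: (classic (exists2 v, middle f v & bad s2 v)) => [[y2 My2 by2]|]; last first.
  by apply: stop => //=; arith.
have sk2 : size s2 + 2 <= k by rewrite /=; arith.
have s2y : (y, ga) \in s2 by apply: mem_head.
have s2w : (w, ga) \in s2 by rewrite inE mem_head orbT.
have yy2 := bad_clean abc sk2 (sub2 _ s0) (sub2 _ s4) s2y My My2 by2.
have wy2 := bad_clean abc sk2 (sub2 _ s0) (sub2 _ s4) s2w Mw My2 by2.
case: (ltnP l 9) => l9.
  by case: (three_middle B _ Mw My My2 wy wy2 yy2); arith.
have sk6 : size s2 + 6 <= k by rewrite /=; arith.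
have sz2 : size s2 <= size s + 2 by rewrite /=; arith.
apply: (resolved_trans (n := 2) (n' := 4) sub2 sz2).
have [_ _ [z wz z0] [z' wz' z'4]] := Mw.
case: (fold_obstacle B l9 Mw My wy wz z0 wz' z'4) => [[x [m [v O]]]|[x [m [v O]]]].
  exact: (resolve_left B abc l9 sk6 far_nbr_at0 (sub2 _ s0) (sub2 _ s4) s2w s2y Mw My My2 wy by2 wz z0 O).
have Br : base (refl l 4 f) by apply: base_refl.
have R u := middle_refl4 (G := G) u B.
have [R0 R4] := (refl40 (G := G) B, refl44 (G := G) B).
have s4' : (refl l 4 f 4, al) \in s2 by rewrite R4 sub2.
have O' : obstacle e l (refl l 4 f) w z' x m v.
  case: O => [[o1 o2 /R o3 o4] [o5 o6 o7]]; split; split=> //.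
  by move/R.
have [t [Ft st nt H]] := resolve_left Br bca l9 sk6 far_nbr_at0 (sub2 _ s4) s4' s2w s2y
  (proj2 (R w) Mw) (proj2 (R y) My) (proj2 (R y2) My2) wy by2 wz' z'4 O'.
by exists t; split=> // u /R; apply: H.
Qed.

End Resolve.

(** * From a strategy with two colours per vertex to a colouring *)

Section TwoLists.
Variables (T : finType) (e : rel T).

(* The binary part of a strategy in which every vertex of [W] keeps at most two
   colours: the majority of three extensions to [z] extends all three pairs. *)
Record two_consistent (W : pred T) (R : T * nat -> T * nat -> Prop) : Prop := {
  tc_sym x y : R x y -> R y x;
  tc_refl x y : R x y -> R x x;
  tc_ext x y z : R x y -> z \in W -> exists2 c, R x (z, c) & R y (z, c);
  tc_ne z : z \in W -> exists c, R (z, c) (z, c);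
  tc_two z : z \in W -> exists2 b, b < 3 & forall c, R (z, c) (z, c) -> c < 3 /\ c <> b;
  tc_loc v a w b : R (v, a) (w, b) -> (v = w -> a = b) /\ (e v w -> a <> b)
}.

Lemma two_consistent_pin W R z0 a0 : two_consistent W R -> R (z0, a0) (z0, a0) ->
  two_consistent W (fun x y => [/\ R x y, R (z0, a0) x & R (z0, a0) y]).
Proof.
move=> C R0; set x0 := (z0, a0) in R0 *.
have alive x y : R x y -> R y y by move=> /(tc_sym C)/(tc_refl C).
have E x y z : R x y -> R x0 x -> R x0 y -> z \in W ->
    exists c, [/\ R x (z, c), R y (z, c) & R x0 (z, c)].
  move=> xy x0x x0y zW.
  have [c1 x1 y1] := tc_ext C xy zW.
  have [c2 o2 x2] := tc_ext C x0x zW.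
  have [c3 o3 y3] := tc_ext C x0y zW.
  have [b b3 Hb] := tc_two C zW.
  have [h1 n1] := Hb _ (alive _ _ x1).
  have [h2 n2] := Hb _ (alive _ _ x2).
  have [h3 n3] := Hb _ (alive _ _ y3).
  have [E|[E|E]] : c1 = c2 \/ c1 = c3 \/ c2 = c3 by lia.
  - by exists c1; split=> //; rewrite E.
  - by exists c1; split=> //; rewrite E.
  - by exists c2; split=> //; rewrite E.
split.
- by move=> x y [? ? ?]; split=> //; apply: (tc_sym C).
- by move=> x y [xy ? ?]; split=> //; apply: (tc_refl C xy).
- move=> x y z [xy x0x x0y] zW; have [c [? ? ?]] := E _ _ _ xy x0x x0y zW.
  by exists c.
- move=> z zW; have [c [? ? oc]] := E _ _ _ R0 R0 R0 zW.
  by exists c; split=> //; apply: alive oc.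
- move=> z zW; have [b b3 Hb] := tc_two C zW.
  by exists b => // c [? _ _]; apply: Hb.
- by move=> v a w b [ab _ _]; apply: (tc_loc C).
Qed.

Lemma two_consistent_solve W R : two_consistent W R ->
  exists c : T -> nat, (forall v, v \in W -> R (v, c v) (v, c v)) /\
    (forall v w, v \in W -> w \in W -> e v w -> c v <> c w).
Proof.
move=> C.
have [R' [sR C' D]] : exists R' : T * nat -> T * nat -> Prop,
    [/\ forall x y, R' x y -> R x y, two_consistent W R' &
     forall v, v \in W -> forall a b, R' (v, a) (v, a) -> R' (v, b) (v, b) -> a = b].
  suff [R' [sR C' D]] : exists R' : T * nat -> T * nat -> Prop,
      [/\ forall x y, R' x y -> R x y, two_consistent W R' &
       {in enum W, forall v a b, R' (v, a) (v, a) -> R' (v, b) (v, b) -> a = b}].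
    by exists R'; split=> // v vW; apply: D; rewrite mem_enum.
  have : {subset enum W <= W} by move=> v; rewrite mem_enum.
  elim: (enum W) => [|v vs IH] sub; first by exists R.
  have [|R' [sR C' D]] := IH; first by move=> u us; apply: sub; rewrite inE us orbT.
  have [a Ra] := tc_ne C' (sub v (mem_head _ _)).
  exists (fun x y => [/\ R' x y, R' (v, a) x & R' (v, a) y]); split.
  - by move=> x y [/sR].
  - exact: two_consistent_pin.
  move=> u; rewrite inE => /predU1P[->|us] b b' [Rb ab _] [Rb' ab' _].
    have [/(_ erefl) <- _] := tc_loc C' ab.
    by have [/(_ erefl) <- _] := tc_loc C' ab'.
  exact: (D u us).
have ex v : exists a, v \in W -> R' (v, a) (v, a).
  by case: (boolP (v \in W)) => [/(tc_ne C')[a]|]; [exists a|exists 0].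
pose c v := proj1_sig (constructive_indefinite_description _ (ex v)).
have cR v : v \in W -> R' (v, c v) (v, c v).
  exact: (proj2_sig (constructive_indefinite_description _ (ex v))).
exists c; split=> [v vW|v w vW wW vw]; first exact/sR/cR.
have [b vb _] := tc_ext C' (cR v vW) wW.
have [_ /(_ vw)] := tc_loc C' vb.
suff -> : b = c w by [].
by apply: (D w wW) (cR w wW); apply: (tc_refl C' (tc_sym C' vb)).
Qed.

Variables (Lst : T -> nat -> Prop) (k : nat) (F : seq (T * nat) -> Prop).
Hypothesis Fst : strategy e Lst k F.
Notation bad := (bad F).

Lemma strategy_two_consistent s W : F s -> size s + 3 <= k ->
  (forall v, v \in W -> ~ bad s v) ->
  two_consistent W (fun x y => F [:: x, y & s]).
Proof.
move=> Fs sk nb.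
have sub x y z : F [:: x, y, z & s] -> F [:: x, y & s] /\ F [:: x, z & s].
  by move=> Fx; split; apply: (st_sub Fst Fx) => u; rewrite !inE;
    do ?[case/orP=> [->|]]; rewrite ?orbT // => ->; rewrite !orbT.
split.
- by move=> x y Fx; apply: (st_sub Fst Fx) => u; rewrite !inE orbCA.
- by move=> x y Fx; apply: (st_sub Fst Fx) => u; rewrite !inE => /or3P[]->; rewrite ?orbT.
- move=> x y z Fx zW.
  have [|c Fc] := st_ext Fst z _ Fx; first by rewrite /=; lia.
  exists c; [move: (sub _ _ _ Fc) => [H _]|move: (sub _ _ _ Fc) => [_ H]];
    by apply: (st_sub Fst H) => u; rewrite !inE orbCA.
- move=> z zW; have [|c Fc] := st_ext Fst z _ Fs; first by lia.
  by exists c; apply: (st_sub Fst Fc) => u; rewrite !inE orbA orbb.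
- move=> z zW; have [b b3 nF] := not_bad (nb z zW).
  exists b => // c Fc; have [c3 _ _ _] := st_loc Fst Fc (mem_head _ _) (mem_head _ _).
  split=> // E; apply: nF; rewrite -E; apply: (st_sub Fst Fc) => u.
  by rewrite !inE => /orP[]->; rewrite ?orbT.
- move=> v a w b Fc.
  have wb : (w, b) \in [:: (v, a), (w, b) & s] by rewrite !inE eqxx orbT.
  by have [_ _] := st_loc Fst Fc (mem_head _ _) wb.
Qed.

(** Vertices that are not bad are coloured by [two_consistent_solve]. A bad vertex then takes its
    colour [a], which no neighbour can have; by hypothesis bad vertices are pairwise non-adjacent,
    so these choices do not interfere. *)
Lemma strategy_colouring s : F s -> size s + 3 <= k ->
  (forall v, bad s v -> exists2 a, F ((v, a) :: s) &
     forall n, e v n -> ~ bad s n /\ ~ F ((n, a) :: s)) ->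
  symmetric e ->
  exists c : T -> nat, forall v, [/\ c v < 3, Lst v (c v) &
    forall w, e v w -> c v <> c w].
Proof.
move=> Fs sk Hbad e_sym.
pose W : pred T := fun v => ~~ excluded_middle_informative (bad s v).
have WP v : reflect (~ bad s v) (v \in W).
  by rewrite /W unfold_in; case: excluded_middle_informative => H; constructor.
have [c [cW cE]] := two_consistent_solve
  (strategy_two_consistent Fs sk (fun v => elimT (WP v))).
have ex v : exists a, if v \in W then a = c v else
    F ((v, a) :: s) /\ forall n, e v n -> ~ bad s n /\ ~ F ((n, a) :: s).
  case: WP => [_|nb]; first by exists (c v).
  by have [a Fa Ha] := Hbad v (NNPP _ nb); exists a.
pose d v := proj1_sig (constructive_indefinite_description _ (ex v)).
have dP v : if v \in W then d v = c v else
    F ((v, d v) :: s) /\ forall n, e v n -> ~ bad s n /\ ~ F ((n, d v) :: s).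
  exact: (proj2_sig (constructive_indefinite_description _ (ex v))).
have Fd v : F ((v, d v) :: s).
  have := dP v; case: ifP => [vW ->|_ []] //.
  by apply: (st_sub Fst (cW v vW)) => u; rewrite !inE orbA orbb.
exists d => v; have [d3 dL _ _] := st_loc Fst (Fd v) (mem_head _ _) (mem_head _ _).
split=> // w vw; have := dP v; have := dP w.
case: ifP => [wW dw|/WP nw [Fw Hw]]; case: ifP => [vW dv|/WP nv [Fv Hv]].
- by rewrite dv dw; apply: cE.
- by move=> E; have [_ []] := Hv w vw; rewrite E; apply: Fd.
- by move=> E; have [_ []] := Hw v (etrans (e_sym w v) vw); rewrite -E; apply: Fd.
- by have [] := Hv w vw.
Qed.

Lemma nbr_not_bad s v u a : (u, a) \in s -> e v u -> ~ F ((v, a) :: s).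
Proof.
move=> ua vu Fa; have ua' : (u, a) \in (v, a) :: s by rewrite inE ua orbT.
by have [_ _ _ /(_ vu)] := st_loc Fst Fa (mem_head _ _) ua'.
Qed.

Lemma pinned_nbr_not_bad s v u (a : nat) : F s -> (u, a) \in s -> e v u -> ~ bad s v.
Proof.
move=> Fs ua vu /(_ a) H; apply: (nbr_not_bad ua vu); apply: H.
by have [] := st_loc Fst Fs ua ua.
Qed.

Lemma play_list s (vs : seq T) : F s -> size s + size vs <= k ->
  exists s' : seq (T * nat), [/\ F s', {subset s <= s'}, size s' = size s + size vs &
    {in vs, forall v, exists a, (v, a) \in s'}].
Proof.
elim: vs s => [|v vs IH] s Fs /= sk; first by exists s; split; rewrite ?addn0.
have [|a Fa] := st_ext Fst v _ Fs; first by lia.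
have [|s' [Fs' sub sz H]] := IH _ Fa; first by rewrite /=; lia.
exists s'; split=> //; [|by rewrite sz /=; lia|].
  by move=> q qs; apply: sub; rewrite inE qs orbT.
move=> u; rewrite inE => /predU1P[->|/H //]; exists a.
by apply: sub; apply: mem_head.
Qed.

End TwoLists.

(** * Components with a shortest odd cycle of length t or t - 2 *)

Section Component.
Variables (T : finType) (e : rel T) (l : nat).
Context {G : odd_girth e l}.
Let l_odd : odd l. Proof. exact: girth_odd. Qed.
Let l_ge7 : 7 <= l. Proof. exact: girth_ge7. Qed.
Let e_sym : symmetric e. Proof. exact: girth_sym. Qed.
Let e_irr : irreflexive e. Proof. exact: girth_irr. Qed.
Local Notation nbr2 := (nbr2 (G := G)).
Local Notation triangle := (triangle (G := G)).
Notation base := (base e l).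
Notation middle := (middle e l).
Variables (Lst : T -> nat -> Prop) (k : nat) (F : seq (T * nat) -> Prop).
Hypothesis Fst : strategy e Lst k F.
Hypothesis F0 : F [::].
Notation bad := (bad F).
Variable f : nat -> T.
Hypothesis B : base f.

Lemma mem_arc0 i : f i \in arc f 0 l.
Proof.
rewrite -(base_mod i B); apply/mapP; exists (i %% l) => //.
by rewrite mem_iota ltn_mod /=; arith.
Qed.

(* Cycle of length t: a pendant vertex would end an induced path of length t. *)
Lemma colouring_dominating : connected e -> no_ipath e l -> l + 3 <= k ->
  exists c : T -> nat, forall v, [/\ c v < 3, Lst v (c v) &
    forall w, e v w -> c v <> c w].
Proof.
move=> conn nop lk.
have nat_ i x : e x (f i) -> ~ at_ e l f i x.
  move=> xi [_ H]; have Bi := base_shift i B.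
  have := nop (rcons [::] x ++ arc (shift i f) 0 (l - 1)).
  rewrite size_cat size_arc /= => /(_ _)/negP; apply; first by arith.
  apply: (ipath_pre (s1 := [::]) Bi) => //; first by arith.
  by move=> j jr; apply: H; arith.
have nfar u x i : e x (f i) -> e u x -> ~ far e f u.
  move=> xi ux fu; case: (at_or (G := G) B xi) => [/(nat_ _ _ xi)//|[j xj xj2]].
  have Bj := base_shift j B.
  have := nop (arc (shift j f) 3 (l - 3).+1 ++ [:: x; u]).
  rewrite size_cat size_arc /= => /(_ _)/negP; apply; first by arith.
  apply: (ipath_post (G := G) Bj); first by arith.
  - by rewrite /= e_sym ux.
  - rewrite subnKC; last by arith.
    by rewrite (base_l Bj) e_sym.
  - move=> i' ir; apply/negP=> xi'.
    have x0 : e x (shift j f 0) by [].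
    have x2 : e x (shift j f 2) by rewrite /shift addnC.
    have : i' = 2 \/ i' = 4 \/ i' = l \/ i' = l + 2.
      by case: (nbr2 Bj x2 xi'); arith.
    have : i' = 0 \/ i' = 2 \/ i' = l - 2 \/ i' = l.
      by case: (nbr2 Bj x0 xi'); arith.
    by arith.
  - by move=> v; rewrite inE => /eqP-> i' _; apply: fu.
have [s [Fs _ sz Hs]] := play_list Fst F0 (vs := arc f 0 l) ltac:(rewrite size_arc /=; arith).
apply: (strategy_colouring Fst Fs) => //; first by rewrite sz size_arc /=; arith.
move=> v bv; case: (classic (exists u, e v u)) => [[u vu]|no]; last first.
  by exists 0; [apply: bv|move=> n vn; case: no; exists n].
have [k' W] := conn _ _ _ _ vu (base_edge 0 B).
suff [i vi] : exists i, e v (f i).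
  have [a fa] := Hs _ (mem_arc0 i).
  by case: (pinned_nbr_not_bad Fst Fs fa vi).
elim: k' v {bv u vu} W => [|k' IH] v /=; first by move=> ->; exists 1; apply: (base_edge _ B).
case=> w vw /IH[i wi]; case: (farP (G := G) v B) => [fv|[j _ vj]]; last by exists j.
by case: (nfar _ _ _ wi vw).
Qed.

Lemma representatives n : exists vs : seq T, size vs = n /\
  forall i, i < n -> forall a, pendant e f (f i) a -> exists2 a, a \in vs & pendant e f (f i) a.
Proof.
elim: n => [|n [vs [sz H]]]; first by exists [::].
case: (classic (exists a, pendant e f (f n) a)) => [[a pa]|no].
  exists (a :: vs); split; first by rewrite /= sz.
  move=> i; rewrite ltnS leq_eqVlt => /predU1P[->|/H{}H] b pb.
    by exists a => //; apply: mem_head.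
  by have [c cv pc] := H _ pb; exists c; rewrite // inE cv orbT.
exists (f 0 :: vs); split; first by rewrite /= sz.
move=> i; rewrite ltnS leq_eqVlt => /predU1P[->|/H{}H] b pb.
  by case: no; exists b.
by have [c cv pc] := H _ pb; exists c; rewrite // inE cv orbT.
Qed.

(** Pebbles: [l] for the cycle, [l] for representatives of the pendant vertices, at most six for
    each of the [l] windows. The constant 11 covers the 8 that [resolve] wants free and the 3 of
    [strategy_colouring]. *)
Lemma colouring_window : reduced e -> connected e -> no_ipath e (l + 2) ->
  8 * l + 11 <= k ->
  exists c : T -> nat, forall v, [/\ c v < 3, Lst v (c v) &
    forall w, e v w -> c v <> c w].
Proof.
move=> red conn nop lk.
have [reps [szr Hr]] := representatives l.
have [s [Fs _ sz Hs]] := play_list Fst F0 (vs := arc f 0 l ++ reps)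
  ltac:(rewrite size_cat size_arc szr /=; arith).
have {}sz : size s = 2 * l by rewrite sz size_cat size_arc szr /=; arith.
have Hf i : exists a, (f i, a) \in s by apply: Hs; rewrite mem_cat mem_arc0.
have gen n : n <= l -> exists s2 : seq (T * nat), [/\ F s2, {subset s <= s2},
    size s2 <= size s + 6 * n & forall i, i < n -> forall v, middle (shift i f) v ->
    bad s2 v -> exists2 a, (f i, a) \in s & (f (i + 4), a) \in s].
  elim: n => [|n IH] nl; first by exists s; split=> //; rewrite muln0 addn0.
  have [t [Ft st nt H]] := IH (ltnW nl).
  have [a fa] := Hf n; have [b fb] := Hf (n + 4).
  (* A window with equally coloured ends is left alone: a bad middle vertex can take that colour,
     since each of its neighbours sees an end. *)
  case: (a =P b) => [ab|ab].
    exists t; split=> //; first by arith.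
    move=> i; rewrite ltnS leq_eqVlt => /predU1P[->|/H//] v _ _.
    by exists a; rewrite // ab.
  have [|||t2 [Ft2 st2 nt2 H2]] := resolve (G := G) red conn nop Fst (f := shift n f)
      (al := a) (be := b) (s := t) (base_shift n B) _ Ft _ _ ab.
  - by arith.
  - exact: st.
  - by apply: st; rewrite /shift addnC.
  exists t2; split=> //.
  - by move=> q /st/st2.
  - by arith.
  move=> i; rewrite ltnS leq_eqVlt => /predU1P[->|il] v Mv bv.
    by case: (H2 v Mv).
  by apply: (H i il v Mv); apply: (bad_mono Fst st2 bv).
have [s2 [far_nbr_at0 sub2 sz2 H2]] := gen l (leqnn l).
apply: (strategy_colouring Fst far_nbr_at0) => //; first by arith.
move=> v bv; case: (classic (exists u, e v u)) => [[u vu]|no]; last first.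
  by exists 0; [apply: bv|move=> n vn; case: no; exists n].
case: (farP (G := G) v B) => [fv|[j _ vj]]; last first.
  by have [a fa] := Hf j; case: (pinned_nbr_not_bad Fst far_nbr_at0 (sub2 _ fa) vj).
case: (far_cases (G := G) red conn nop B fv vu) => [[w [[i Ew] [b pb] sat]]|[i il Mv]].
  rewrite Ew -(base_mod i B) in pb sat.
  have il : i %% l < l by rewrite ltn_mod; arith.
  have [a ar pa] := Hr _ il _ pb.
  have [c ac] : exists c, (a, c) \in s by apply: Hs; rewrite mem_cat ar orbT.
  by case: (pinned_nbr_not_bad Fst far_nbr_at0 (sub2 _ ac) (sat _ pa)).
have [a fa fa4] := H2 i il v Mv bv.
have [a3 _ _ _] := st_loc Fst Fs fa fa.
exists a; first exact: bv.
move=> n vn; have [_ Nv _ _] := Mv.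
have [w [wa nw]] : exists w, (w, a) \in s /\ e n w.
  case/orP: (Nv n vn) => nf; [exists (f i)|exists (f (i + 4))]; split=> //.
  by rewrite addnC.
split; first exact: (pinned_nbr_not_bad Fst far_nbr_at0 (sub2 _ wa) nw).
exact: (nbr_not_bad Fst (sub2 _ wa) nw).
Qed.

End Component.

Section Walk.
Variables (T : finType) (e : rel T).

Lemma walk_fun k u v : walk e k u v -> exists g : nat -> T,
  [/\ g 0 = u, g k = v & forall i, i < k -> e (g i) (g i.+1)].
Proof.
elim: k u => [|k IH] u /=; first by move=> ->; exists (fun=> v).
case=> w uw /IH[g [g0 gk gs]].
exists (fun i => if i is i'.+1 then g i' else u); split=> //.
by case=> [|i] ik; [rewrite g0|apply: gs].
Qed.

Lemma closed_walk_base l u : 0 < l -> walk e l u u -> exists f, base e l f.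
Proof.
move=> l0 /walk_fun[g [g0 gl gs]]; exists (fun i => g (i %% l)); split=> i.
  by rewrite modnDr.
have il : i %% l < l by rewrite ltn_mod.
rewrite -addn1 -modnDml addn1.
case: (ltngtP (i %% l).+1 l) => [lt|gt|E]; [|by lia|].
  by rewrite (modn_small lt); apply: gs.
rewrite E modnn g0 -gl -{2}E; exact: gs.
Qed.

End Walk.

(** * Consistency decides list colouring of reduced graphs *)

Section Colouring.
Variables (T : finType) (e : rel T) (t : nat).
Hypothesis e_sym : symmetric e.
Hypothesis e_irr : irreflexive e.
Hypothesis t_odd : odd t.
Hypothesis t_ge9 : 9 <= t.
Hypothesis oddg : forall k u, odd k -> k < t - 2 -> ~ walk e k u u.
Hypothesis nop : no_ipath e t.
Hypothesis red : reduced e.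
Variables (Lst : T -> nat -> Prop) (k : nat) (F : seq (T * nat) -> Prop).
Hypothesis Fst : strategy e Lst k F.
Hypothesis F0 : F [::].
Hypothesis k_big : 8 * t + 11 <= k.

Definition bipartite_at v := forall j, odd j -> ~ walk e j v v.

(** A bipartite component has no odd cycle to pebble. It is coloured with 0 and 1 in the first case,
    and by the two-colour argument in the second. *)
Hypothesis lists : (forall v, Lst v 0 /\ Lst v 1) \/
  (forall v, bipartite_at v -> exists2 b, b < 3 & ~ Lst v b).

Section OneComponent.
Variable v0 : T.

(** Restricting the edges instead of the vertices keeps the type [T] and the strategy [F]; vertices
    outside the component become isolated. *)
Definition comp u v := e u v && connect e v0 u.

Lemma compl u v : comp u v -> connect e v0 v.
Proof. by case/andP=> uv H; apply: connect_trans H (connect1 uv). Qed.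

Lemma comp_sym : symmetric comp.
Proof.
suff H u v : comp u v -> comp v u by move=> u v; apply/idP/idP; apply: H.
by move=> uv; rewrite /comp (compl uv) andbT e_sym; case/andP: uv.
Qed.

Lemma comp_irr : irreflexive comp.
Proof. by move=> u; rewrite /comp e_irr. Qed.

Lemma comp_walk j u v : walk comp j u v -> walk e j u v.
Proof.
by elim: j u => //= j IH u [w /andP[uw _] /IH]; exists w.
Qed.

Lemma walk_comp j u v : connect e v0 u -> walk e j u v -> walk comp j u v.
Proof.
elim: j u => //= j IH u cu [w uw ww]; have uw' : comp u w by rewrite /comp uw.
by exists w => //; apply: IH ww; apply: compl uw'.
Qed.

Lemma connect_walk u : connect e v0 u -> exists j, walk e j v0 u.
Proof.
case/connectP=> p + ->; elim: p (v0) => [|w p IH] z /=; first by exists 0.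
by case/andP=> zw /IH[j Wj]; exists j.+1, w.
Qed.

Lemma comp_conn : connected comp.
Proof.
move=> u u' v v' /andP[_ cu] /andP[_ cv].
have [i Wi] := connect_walk cu; have [j Wj] := connect_walk cv.
exists (i + j); apply: walk_comp => //.
exact: walk_cat (walk_sym e_sym Wi) Wj.
Qed.

(** A fold of the component becomes a fold of the whole graph once [X] is cut down to the
    component. *)
Lemma comp_red : reduced comp.
Proof.
move=> a p q r b X /and5P[/andP[pq cp] /andP[qr cq] pX qX /andP[rX H]] y yX u.
apply/negP=> /andP[yu cy].
have c_e x : connect e v0 x -> comp x =1 e x by move=> cx z; rewrite /comp cx andbT.
have phiE x : connect e v0 x -> fold_map comp a p q r b x = fold_map e a p q r b x.
  by move=> cx; rewrite /fold_map !c_e.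
pose X' := [set x in X | connect e v0 x].
suff FX : foldable e a p q r b X'.
  have yX' : y \in X' by rewrite inE yX.
  by have := red FX yX' u; rewrite yu.
rewrite /foldable pq qr !inE (negbTE pX) (negbTE qX) (negbTE rX) /=.
apply/forall_inP=> x; rewrite inE => /andP[xX cx].
apply/forallP=> z; apply/implyP=> xz.
have cxz : comp x z by rewrite /comp xz.
have cz := compl cxz; rewrite inE cz andbT -!phiE //.
by have /forall_inP/(_ x xX)/forallP/(_ z)/implyP/(_ cxz)/andP[] := H.
Qed.

Lemma comp_ipath s : 1 < size s -> ipath comp s -> ipath e s.
Proof.
move=> s1 ps.
have all_c : {in s, forall x, connect e v0 x}.
  case: s s1 ps => // x [|y s] // _ /= /andP[/andP[xy _] ps].
  have cx : connect e v0 x by case/andP: xy.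
  move=> z; rewrite inE => /predU1P[->//|]; have := compl xy.
  elim: s y {xy} ps z => [|w s IH] y ps z cy; first by rewrite inE => /eqP->.
  move: ps => /= /andP[/andP[yw _] ps]; rewrite inE => /predU1P[->//|].
  by apply: IH ps _ _; apply: compl yw.
elim: s {s1} ps all_c => // x s IH /= /andP[Hx ps] all_c; apply/andP; split; last first.
  by apply: IH => // z zs; apply: all_c; rewrite inE zs orbT.
have cx := all_c x (mem_head _ _).
case: s Hx {IH ps all_c} => // y s; rewrite /comp cx andbT => /andP[-> /allP H] /=.
by apply/allP=> z /H; rewrite andbT.
Qed.

Lemma comp_strategy : strategy comp Lst k F.
Proof.
case: Fst => H1 H2 H3; split=> // s v a w b Fs va wb.
by have [? ? ? H] := H3 _ _ _ _ _ Fs va wb; split=> // /andP[/H].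
Qed.

Lemma bipartite_comp u : bipartite_at v0 -> connect e v0 u -> bipartite_at u.
Proof.
move=> bip /connect_walk[i Wi] j oj Wj; apply: (bip (i + j + i)).
  by rewrite !oddD addbC addbA addbb.
exact: walk_cat (walk_cat Wi Wj) (walk_sym e_sym Wi).
Qed.

Lemma bipartite_two_colouring : bipartite_at v0 -> exists c : T -> nat,
  forall v, connect e v0 v -> c v < 2 /\ forall w, e v w -> c v <> c w.
Proof.
move=> bip; pose ev u := excluded_middle_informative (exists2 j, odd j & walk e j v0 u).
exists (fun u => nat_of_bool (ev u)) => v cv; split; first by case: (ev v).
move=> w vw; have wv : e w v by rewrite e_sym.
have flip x y j : e x y -> walk e j v0 x -> walk e j.+1 v0 y.
  by move=> xy Wj; rewrite -addn1; apply: walk_cat Wj (walk1 xy).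
have [j Wj] := connect_walk cv.
case: (ev v) => [[i oi Wi]|nv]; case: (ev w) => [[i' oi' Wi']|nw] //= _.
  apply: (bip (i.+1 + i')); first by rewrite /= oddD oi oi'.
  exact: walk_cat (flip _ _ _ vw Wi) (walk_sym e_sym Wi').
case: (boolP (odd j)) => oj; first by apply: nv; exists j.
by apply: nw; exists j.+1; [rewrite /= oj|apply: flip vw Wj].
Qed.

Lemma comp_colouring : exists c : T -> nat, forall v, connect e v0 v ->
  [/\ c v < 3, Lst v (c v) & forall w, e v w -> c v <> c w].
Proof.
suff [c H] : exists c : T -> nat, forall v, connect e v0 v ->
    [/\ c v < 3, Lst v (c v) & forall w, comp v w -> c v <> c w].
  exists c => v cv; have [? ? E] := H v cv; split=> // w vw; apply: E.
  by rewrite /comp vw.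
case: (classic (bipartite_at v0)) => [bip|nbip].
  case: lists => [L01|L2].
    have [c H] := bipartite_two_colouring bip; exists c => v cv.
    have [c2 pr] := H v cv; have [L0 L1] := L01 v; split; first by lia.
      by case: (c v) c2 => [|[]].
    by move=> w /andP[vw _]; apply: pr.
  have [|||c H] := strategy_colouring comp_strategy F0.
  - by rewrite /=; lia.
  - move=> v bv; case: (boolP (connect e v0 v)) => [cv|ncv].
      have [b b3 nL] := L2 v (bipartite_comp bip cv).
      have [_ /nL] := st_loc Fst (bv b b3) (mem_head _ _) (mem_head _ _).
      by [].
    by exists 0; [apply: bv|move=> n /andP[_]; rewrite (negbTE ncv)].
  - exact: comp_sym.
  by exists c => v _; apply: H.
have [j [oj Wj]] : exists j, odd j /\ walk e j v0 v0.
  by apply: NNPP => no; apply: nbip => j oj Wj; apply: no; exists j.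
pose Pb j := odd j /\ exists u, walk comp j u u.
have exP : exists j, Pb j.
  by exists j; split=> //; exists v0; apply: walk_comp Wj.
have [l [[ol [u Wl]] minl]] : exists l, Pb l /\ forall m, m < l -> ~ Pb m.
  case: exP => n; elim/ltn_ind: n => n IH Pn.
  case: (classic (exists2 m, m < n & Pb m)) => [[m mn /(IH m mn)]//|no].
  by exists n; split=> // m mn Pm; apply: no; exists m.
have l_ge : t - 2 <= l.
  by rewrite leqNgt; apply/negP=> lt; apply: (oddg ol lt (comp_walk Wl)).
have G : odd_girth comp l.
  split=> //; [exact: comp_sym|exact: comp_irr|by lia|].
  by move=> i w oi il Wi; apply: (minl i il); split=> //; exists w.
have [f B] : exists f, base comp l f by apply: closed_walk_base Wl; lia.
have nopc : no_ipath comp t.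
  move=> s sz; apply/negP=> ps; have := nop sz; rewrite comp_ipath //.
  by rewrite sz; lia.
have l_le : l <= t.
  rewrite leqNgt; apply/negP=> lt.
  by have := nopc _ (size_arc f 0 t); rewrite (ipath_arc (G := G)).
have [c H] : exists c : T -> nat, forall v, [/\ c v < 3, Lst v (c v) &
    forall w, comp v w -> c v <> c w].
  have [E|E] : l = t \/ l + 2 = t by lia.
    apply: (colouring_dominating (G := G) comp_strategy F0 B comp_conn); last by lia.
    by rewrite E.
  apply: (colouring_window (G := G) comp_strategy F0 B comp_red comp_conn); last by lia.
  by rewrite E.
by exists c => v _; apply: H.
Qed.

End OneComponent.

Theorem consistent_colouring : exists c : T -> nat, forall v,
  [/\ c v < 3, Lst v (c v) & forall w, e v w -> c v <> c w].
Proof.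
pose C v0 := proj1_sig (constructive_indefinite_description _ (comp_colouring v0)).
have CP v0 v : connect e v0 v ->
    [/\ C v0 v < 3, Lst v (C v0 v) & forall w, e v w -> C v0 v <> C v0 w].
  exact: (proj2_sig (constructive_indefinite_description _ (comp_colouring v0))).
have sy := sym_connect_sym e_sym.
exists (fun v => C (root e v) v) => v.
have cv : connect e (root e v) v by rewrite sy connect_root.
have [? ? H] := CP _ _ cv; split=> // w vw.
have -> : root e w = root e v.
  by apply/esym/(rootP sy); apply: connect1.
exact: H.
Qed.

End Colouring.

(** * A loop language for the machine *)

(** The bounded sum is the only binder; bounded quantifiers are derived from it. *)
Inductive expr :=
  | EVar of nat
  | ECst of nat
  | EAdd of expr & expr
  | ESub of expr & expr
  | EArr of 'I_8 & expr
  | ESum of nat & expr.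

Inductive cmd :=
  | CSet of nat & expr
  | CPut of 'I_8 & expr & expr
  | CSeq of cmd & cmd
  | CIf of expr & cmd
  | CFor of nat & cmd
  | CRead of nat
  | CWrite of expr.

Record state := State {
  vars : nat -> nat;
  arrs : 'I_8 -> nat -> nat;
  inp : seq nat;
  out : seq nat
}.

Definition upd (v : nat -> nat) x a : nat -> nat := fun y => if y == x then a else v y.
Definition setv s x a := State (upd (vars s) x a) (arrs s) (inp s) (out s).
Definition upda (A : 'I_8 -> nat -> nat) j i a : 'I_8 -> nat -> nat :=
  fun j' i' => if (j' == j) && (i' == i) then a else A j' i'.

(* [M] is the number of iterations of every loop. *)
Section Semantics.
Variable M : nat.

Fixpoint eval (v : nat -> nat) (A : 'I_8 -> nat -> nat) (e : expr) : nat :=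
  match e with
  | EVar x => v x
  | ECst a => a
  | EAdd e1 e2 => eval v A e1 + eval v A e2
  | ESub e1 e2 => eval v A e1 - eval v A e2
  | EArr j e => A j (eval v A e)
  | ESum x e => sumn [seq eval (upd v x i) A e | i <- iota 0 M]
  end.

Fixpoint den (c : cmd) (s : state) : state :=
  match c with
  | CSet x e => setv s x (eval (vars s) (arrs s) e)
  | CPut j e1 e2 => State (vars s)
      (upda (arrs s) j (eval (vars s) (arrs s) e1) (eval (vars s) (arrs s) e2))
      (inp s) (out s)
  | CSeq c1 c2 => den c2 (den c1 s)
  | CIf e c => if 0 < eval (vars s) (arrs s) e then den c s else s
  | CFor x c => foldl (fun s i => den c (setv s x i)) s (iota 0 M)
  | CRead x => State (upd (vars s) x (head 0 (inp s))) (arrs s) (behead (inp s)) (out s)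
  | CWrite e => State (vars s) (arrs s) (inp s)
      (rcons (out s) (eval (vars s) (arrs s) e))
  end.

Fixpoint time_e (e : expr) : nat :=
  match e with
  | EVar _ => 2
  | ECst _ => 1
  | EAdd e1 e2 => time_e e1 + time_e e2 + 1
  | ESub e1 e2 => time_e e1 + time_e e2 + 1
  | EArr _ e => time_e e + 7
  | ESum _ e => M * (time_e e + 7) + 7
  end.

Fixpoint time (c : cmd) : nat :=
  match c with
  | CSet _ e => time_e e + 2
  | CPut _ e1 e2 => time_e e1 + time_e e2 + 7
  | CSeq c1 c2 => time c1 + time c2
  | CIf e c => time_e e + 3 + time c
  | CFor _ c => M * (time c + 6) + 1
  | CRead _ => 1
  | CWrite e => time_e e + 1
  end.
End Semantics.

Lemma time_e_poly e : exists C D, forall M, 0 < M -> time_e M e <= C * M ^ D.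
Proof.
have pos M D : 0 < M -> 0 < M ^ D by move=> M0; rewrite expn_gt0 M0.
have mono M a b : 0 < M -> M ^ a <= M ^ (a + b) /\ M ^ b <= M ^ (a + b).
  by move=> M0; rewrite !leq_pexp2l ?leq_addr ?leq_addl.
elim: e => /=.
- by move=> _; exists 2, 0.
- by move=> _; exists 1, 0.
- move=> e1 [C1 [D1 H1]] e2 [C2 [D2 H2]]; exists (C1 + C2 + 1), (D1 + D2) => M M0.
  have := H1 M M0; have := H2 M M0; have [] := mono M D1 D2 M0.
  have := pos M (D1 + D2) M0; nia.
- move=> e1 [C1 [D1 H1]] e2 [C2 [D2 H2]]; exists (C1 + C2 + 1), (D1 + D2) => M M0.
  have := H1 M M0; have := H2 M M0; have [] := mono M D1 D2 M0.
  have := pos M (D1 + D2) M0; nia.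
- move=> _ e1 [C1 [D1 H1]]; exists (C1 + 7), D1 => M M0.
  have := H1 M M0; have := pos M D1 M0; nia.
- move=> _ e1 [C1 [D1 H1]]; exists (C1 + 14), D1.+1 => M M0.
  have := H1 M M0; have := pos M D1 M0; rewrite expnS; nia.
Qed.

Lemma time_poly c : exists C D, forall M, 0 < M -> time M c <= C * M ^ D.
Proof.
have pos M D : 0 < M -> 0 < M ^ D by move=> M0; rewrite expn_gt0 M0.
have mono M a b : 0 < M -> M ^ a <= M ^ (a + b) /\ M ^ b <= M ^ (a + b).
  by move=> M0; rewrite !leq_pexp2l ?leq_addr ?leq_addl.
elim: c => /=.
- move=> _ e1; have [C1 [D1 H1]] := time_e_poly e1; exists (C1 + 2), D1 => M M0.
  have := H1 M M0; have := pos M D1 M0; nia.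
- move=> _ e1 e2; have [C1 [D1 H1]] := time_e_poly e1.
  have [C2 [D2 H2]] := time_e_poly e2; exists (C1 + C2 + 7), (D1 + D2) => M M0.
  have := H1 M M0; have := H2 M M0; have [] := mono M D1 D2 M0.
  have := pos M (D1 + D2) M0; nia.
- move=> e1 [C1 [D1 H1]] e2 [C2 [D2 H2]]; exists (C1 + C2), (D1 + D2) => M M0.
  have := H1 M M0; have := H2 M M0; have [] := mono M D1 D2 M0.
  have := pos M (D1 + D2) M0; nia.
- move=> e1 c [C2 [D2 H2]]; have [C1 [D1 H1]] := time_e_poly e1.
  exists (C1 + C2 + 3), (D1 + D2) => M M0.
  have := H1 M M0; have := H2 M M0; have [] := mono M D1 D2 M0.
  have := pos M (D1 + D2) M0; nia.
- move=> _ c [C1 [D1 H1]]; exists (C1 + 7), D1.+1 => M M0.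
  have := H1 M M0; have := pos M D1 M0; rewrite expnS; nia.
- by move=> _; exists 1, 0.
- move=> e1; have [C1 [D1 H1]] := time_e_poly e1; exists (C1 + 1), D1 => M M0.
  have := H1 M M0; have := pos M D1 M0; nia.
Qed.

(* Arrays live in the even registers, the variables and the temporaries are
   interleaved in the odd ones; the first temporary holds [M]. *)
Definition rv x := 4 * x + 1.
Definition rh d := 4 * d + 3.
Definition ra (j : 'I_8) i := 16 * i + 2 * j.
Arguments rv : simpl never.
Arguments rh : simpl never.
Arguments ra : simpl never.

(** Four doublings multiply the index by 16, and adding [2 * j] selects the array, as in [ra]. *)
Definition addr_code d d' (j : 'I_8) :=
  [:: Sum (rh d) (rh d) (rh d); Sum (rh d) (rh d) (rh d); Sum (rh d) (rh d) (rh d);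
      Sum (rh d) (rh d) (rh d); Const (rh d') (2 * j); Sum (rh d) (rh d) (rh d')].

(** The value ends up in temporary [d], and the temporaries below [d] are preserved. Jumps are
    absolute, so the code depends on its own address [off]. *)
Fixpoint comp_e (e : expr) (d off : nat) : seq instr :=
  match e with
  | EVar x => [:: Const (rh d.+1) 0; Sum (rh d) (rv x) (rh d.+1)]
  | ECst a => [:: Const (rh d) a]
  | EAdd e1 e2 => let c1 := comp_e e1 d off in
      c1 ++ comp_e e2 d.+1 (off + size c1) ++ [:: Sum (rh d) (rh d) (rh d.+1)]
  | ESub e1 e2 => let c1 := comp_e e1 d off in
      c1 ++ comp_e e2 d.+1 (off + size c1) ++ [:: Diff (rh d) (rh d) (rh d.+1)]
  | EArr j e => comp_e e d off ++ addr_code d d.+1 j ++ [:: Fetch (rh d) (rh d)]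
  | ESum x e =>
      [:: Const (rh d.+1) 0; Sum (rh d) (rv x) (rh d.+1); Const (rh d.+2) 0] ++
      [:: Const (rh d.+3) 0; Sum (rv x) (rh d.+1) (rh d.+3)] ++
      comp_e e d.+3 (off + 5) ++
      [:: Sum (rh d.+2) (rh d.+2) (rh d.+3); Const (rh d.+3) 1;
          Sum (rh d.+1) (rh d.+1) (rh d.+3); Diff (rh d.+3) (rh 0) (rh d.+1)] ++
      [:: JumpPos (rh d.+3) (off + 3)] ++
      [:: Const (rh d.+3) 0; Sum (rv x) (rh d) (rh d.+3);
          Sum (rh d) (rh d.+2) (rh d.+3)]
  end.

Fixpoint comp_c (c : cmd) (d off : nat) : seq instr :=
  match c with
  | CSet x e => comp_e e d off ++ [:: Const (rh d.+1) 0; Sum (rv x) (rh d) (rh d.+1)]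
  | CPut j e1 e2 => let c1 := comp_e e1 d off in
      c1 ++ comp_e e2 d.+1 (off + size c1) ++
      (addr_code d d.+2 j ++ [:: Store (rh d) (rh d.+1)])
  | CSeq c1 c2 => let k1 := comp_c c1 d off in k1 ++ comp_c c2 d (off + size k1)
  | CIf e c => let k1 := comp_e e d off in
      let k2 := comp_c c d (off + size k1 + 3) in
      k1 ++ [:: Const (rh d.+1) 1; Diff (rh d) (rh d.+1) (rh d)] ++
      [:: JumpPos (rh d) (off + size k1 + 3 + size k2)] ++ k2
  | CFor x c =>
      [:: Const (rh d) 0] ++ [:: Const (rh d.+1) 0; Sum (rv x) (rh d) (rh d.+1)] ++
      comp_c c d.+1 (off + 3) ++
      [:: Const (rh d.+1) 1; Sum (rh d) (rh d) (rh d.+1); Diff (rh d.+1) (rh 0) (rh d)] ++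
      [:: JumpPos (rh d.+1) (off + 1)]
  | CRead x => [:: Read (rv x)]
  | CWrite e => comp_e e d off ++ [:: Write (rh d)]
  end.

(** * Correctness of the compiler *)

Section Machine.
Variable P : program.

Fixpoint nsteps m s s' : Prop :=
  if m is m'.+1 then exists2 s1, step P s = Some s1 & nsteps m' s1 s' else s = s'.

Lemma nsteps_cat m1 m2 s1 s2 s3 : nsteps m1 s1 s2 -> nsteps m2 s2 s3 ->
  nsteps (m1 + m2) s1 s3.
Proof.
elim: m1 s1 => [|m1 IH] s1 /=; first by move->.
by case=> s E N N2; exists s => //; apply: IH.
Qed.

Definition within b s s' := exists2 m, m <= b & nsteps m s s'.

Lemma within_trans b1 b2 s1 s2 s3 : within b1 s1 s2 -> within b2 s2 s3 ->
  within (b1 + b2) s1 s3.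
Proof.
case=> m1 l1 N1 [m2 l2 N2]; exists (m1 + m2); first by rewrite leq_add.
exact: nsteps_cat N1 N2.
Qed.

Lemma within_le b b' s s' : b <= b' -> within b s s' -> within b' s s'.
Proof. by move=> bb [m mb N]; exists m => //; apply: leq_trans bb. Qed.

Definition code_at off code := exists pre post, P = pre ++ code ++ post /\ size pre = off.

Lemma code_at_cat off c1 c2 : code_at off (c1 ++ c2) ->
  code_at off c1 /\ code_at (off + size c1) c2.
Proof.
case=> pre [post [E sz]]; split.
  by exists pre, (c2 ++ post); rewrite E -catA.
by exists (pre ++ c1), post; rewrite E !catA size_cat sz.
Qed.

Lemma code_at_head off i c : code_at off (i :: c) -> onth P off = Some i.
Proof.
by case=> pre [post [-> <-]]; elim: pre.
Qed.

Definition straight i := if i is JumpPos _ _ then false else true.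

Definition execs l s := foldl (fun s i => exec i s) s l.

Lemma code_straight l off X ip op : code_at off l -> all straight l ->
  within (size l) (Config off X ip op) (execs l (Config off X ip op)) /\
  pc (execs l (Config off X ip op)) = off + size l.
Proof.
elim: l off X ip op => [|i l IH] off X ip op.
  by move=> _ _; rewrite addn0; split=> //; exists 0.
move=> H /andP[si sl].
have E : step P (Config off X ip op) = Some (exec i (Config off X ip op)).
  by rewrite /step /= (code_at_head H).
have [_ H'] := code_at_cat (c1 := [:: i]) H; rewrite addn1 in H'.
have [Y [ip' [op' EY]]] : exists Y ip' op', exec i (Config off X ip op) = Config off.+1 Y ip' op'.
  by destruct i; try discriminate si; do 3 eexists; reflexivity.
have ES s : execs (i :: l) s = execs l (exec i s) by [].
rewrite ES EY.
rewrite EY in E; have [[m ml N] pcE] := IH _ Y ip' op' H' sl.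
split; last by rewrite pcE addSnnS.
by exists m.+1 => //; exists (Config off.+1 Y ip' op').
Qed.

End Machine.

Lemma rv_rh x d : (rv x == rh d) = false. Proof. rewrite /rv /rh; lia. Qed.
Lemma rh_rv x d : (rh d == rv x) = false. Proof. rewrite /rv /rh; lia. Qed.
Lemma ra_rh j i d : (ra j i == rh d) = false. Proof. rewrite /ra /rh; lia. Qed.
Lemma ra_rv j i x : (ra j i == rv x) = false. Proof. rewrite /ra /rv; lia. Qed.
Lemma rh_ra j i d : (rh d == ra j i) = false. Proof. rewrite /ra /rh; lia. Qed.
Lemma rv_ra j i x : (rv x == ra j i) = false. Proof. rewrite /ra /rv; lia. Qed.
Lemma rh_rh i d : (rh i == rh d) = (i == d). Proof. rewrite /rh; lia. Qed.
Lemma rv_rv i d : (rv i == rv d) = (i == d). Proof. rewrite /rv; lia. Qed.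
Lemma ra_ra j i j' i' : (ra j i == ra j' i') = (j == j') && (i == i').
Proof.
have h := ltn_ord j; have h' := ltn_ord j'.
rewrite /ra -[j == j']val_eqE /=; apply/idP/idP; lia.
Qed.

Definition rE := (rv_rh, rh_rv, ra_rh, ra_rv, rh_ra, rv_ra, rh_rh, rv_rv, ra_ra).

Section Correct.
Variables (P : program) (M : nat).
Hypothesis M_gt0 : 0 < M.

Definition rep (X : nat -> nat) (v : nat -> nat) (A : 'I_8 -> nat -> nat) :=
  [/\ X (rh 0) = M, forall x, X (rv x) = v x & forall j i, X (ra j i) = A j i].

Definition frame d (X X' : nat -> nat) := forall i, i < d -> X' (rh i) = X (rh i).

Definition pure i := match i with
  | JumpPos _ _ | Read _ | Write _ => false | _ => true end.

Definition rexec (X : nat -> nat) i := match i with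
  | Const i a => upd X i a
  | Sum i j k => upd X i (X j + X k)
  | Diff i j k => upd X i (X j - X k)
  | Fetch i j => upd X i (X (X j))
  | Store i j => upd X (X i) (X j)
  | _ => X
  end.

Lemma block off l X ip op : code_at P off l -> all pure l ->
  within P (size l) (Config off X ip op) (Config (off + size l) (foldl rexec X l) ip op).
Proof.
move=> C pl; have sl : all straight l by apply: sub_all pl => -[].
have [W _] := code_straight X ip op C sl.
suff <- : execs l (Config off X ip op) = Config (off + size l) (foldl rexec X l) ip op by [].
elim: l off X pl {C sl W} => [|i l IH] off X /=; first by rewrite addn0.
by case/andP; case: i => //= *; rewrite /execs /= -/(execs _ _) IH // addSnnS.
Qed.

Lemma jump off i a X ip op : code_at P off [:: JumpPos i a] ->
  within P 1 (Config off X ip op) (Config (if 0 < X i then a else off.+1) X ip op).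
Proof.
by move=> /code_at_head E; exists 1 => //; eexists; rewrite /step /= ?E.
Qed.

Ltac regs := rewrite /= /upd ?rE /=; repeat (case: eqP => ?; try lia); try lia.

Lemma frame_trans d d' X1 X2 X3 : d <= d' -> frame d X1 X2 -> frame d' X2 X3 ->
  frame d X1 X3.
Proof.
by move=> dd F1 F2 i id; rewrite F2 ?F1 //; apply: leq_trans dd.
Qed.

Lemma rep_rh X v A d a : 0 < d -> rep X v A -> rep (upd X (rh d) a) v A.
Proof.
move=> d0 [R1 R2 R3]; split=> [|x|j i]; rewrite /upd ?rE //.
by rewrite (ltn_eqF d0).
Qed.

Lemma rep_rv X v A x a : rep X v A -> rep (upd X (rv x) a) (upd v x a) A.
Proof.
move=> [R1 R2 R3]; split=> [|y|j i]; rewrite /upd ?rE //.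
by case: eqP.
Qed.

Lemma rep_ra X v A j i a : rep X v A -> rep (upd X (ra j i) a) v (upda A j i a).
Proof.
move=> [R1 R2 R3]; split=> [|y|j' i']; rewrite /upd ?rE //.
by rewrite /upda; case: ifP.
Qed.

Lemma frame_rh X d d' a : d <= d' -> frame d X (upd X (rh d') a).
Proof. by move=> dd i id; rewrite /upd rE ltn_eqF //; apply: leq_trans dd. Qed.

Lemma frame_rv X d x a : frame d X (upd X (rv x) a).
Proof. by move=> i id; rewrite /upd rE. Qed.

Lemma addr_correct d d' j off X v A ip op : 0 < d < d' ->
  code_at P off (addr_code d d' j) -> rep X v A ->
  exists X', [/\ within P 6 (Config off X ip op) (Config (off + 6) X' ip op),
    rep X' v A, X' (rh d) = ra j (X (rh d)) &
    forall i, i != d -> i != d' -> X' (rh i) = X (rh i)].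
Proof.
move=> dd C R; have W := block X ip op C isT.
exists (foldl rexec X (addr_code d d' j)); split=> //.
- by rewrite /=; do ![apply: rep_rh => //; try lia].
- have E1 : (d == d') = false by lia.
  have E2 : (d' == d) = false by lia.
  by rewrite /= /upd ?rE ?E1 ?E2 ?eqxx /ra; lia.
- move=> i id id'; have E1 : (i == d) = false by apply/negbTE.
  have E2 : (i == d') = false by apply/negbTE.
  by rewrite /= /upd ?rE ?E1 ?E2.
Qed.

(** Compiled loops test at the end and so execute their body at least once, which is why [M] has to
    be positive. *)
Lemma loop_correct (I : nat -> (nat -> nat) -> seq nat -> seq nat -> Prop) b hd tl :
  (forall j Y ip op, j < M -> I j Y ip op -> exists Y' ip' op',
     within P b (Config hd Y ip op) (Config (if j.+1 < M then hd else tl) Y' ip' op') /\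
     I j.+1 Y' ip' op') ->
  forall Y ip op, I 0 Y ip op -> exists Y' ip' op',
     within P (M * b) (Config hd Y ip op) (Config tl Y' ip' op') /\ I M Y' ip' op'.
Proof.
move=> H; suff gen r j Y ip op : j + r.+1 = M -> I j Y ip op -> exists Y' ip' op',
     within P (r.+1 * b) (Config hd Y ip op) (Config tl Y' ip' op') /\ I M Y' ip' op'.
  by move=> Y ip op; have := @gen M.-1 0 Y ip op; rewrite prednK // add0n; apply.
elim: r j Y ip op => [|r IH] j Y ip op E Ij.
  have jM : j < M by lia.
  have [Y' [ip' [op' [W I']]]] := H j Y ip op jM Ij.
  have E' : j.+1 = M by lia.
  exists Y', ip', op'; rewrite mul1n; move: W I'; rewrite E' ltnn; by split.
have jM : j < M by lia.
have [Y' [ip' [op' [W I']]]] := H j Y ip op jM Ij.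
have jM' : j.+1 < M by lia.
rewrite jM' in W.
have [|Y2 [ip2 [op2 [W2 I2]]]] := IH _ _ _ _ _ I'; first by lia.
by exists Y2, ip2, op2; split=> //; rewrite mulSn; apply: within_trans W W2.
Qed.

Lemma wtrans b1 b2 s1 s3 q q' X ip op : within P b1 s1 (Config q X ip op) ->
  q = q' -> within P b2 (Config q' X ip op) s3 -> within P (b1 + b2) s1 s3.
Proof. by move=> W1 <-; apply: within_trans W1. Qed.

Lemma wend b b' s1 q q' X ip op : within P b s1 (Config q X ip op) -> b <= b' ->
  q = q' -> within P b' s1 (Config q' X ip op).
Proof. by move=> W bb <-; apply: within_le W. Qed.

Lemma code_at_eq c o o' : o = o' -> code_at P o c -> code_at P o' c.
Proof. by move=> ->. Qed.

Lemma rep_ext X v v' A : v =1 v' -> rep X v A -> rep X v' A.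
Proof. by move=> E [R1 R2 R3]; split=> // x; rewrite -E. Qed.

Lemma comp_e_correct e d off X ip op v A : code_at P off (comp_e e d off) ->
  0 < d -> rep X v A -> exists X', [/\
    within P (time_e M e) (Config off X ip op)
      (Config (off + size (comp_e e d off)) X' ip op),
    rep X' v A, frame d X X' & X' (rh d) = eval M v A e].
Proof.
elim: e d off X v => [x|a|e1 IH1 e2 IH2|e1 IH1 e2 IH2|j e IH|x e IH] d off X v /=.
- move=> C d0 R; have W := block X ip op C isT.
  exists (foldl rexec X [:: Const (rh d.+1) 0; Sum (rh d) (rv x) (rh d.+1)]).
  split=> //=.
  + by do 2 apply: rep_rh => //.
  + by move=> i id; regs.
  + by case: R => _ R _; regs; rewrite R addn0.
- move=> C d0 R; have W := block X ip op C isT.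
  exists (foldl rexec X [:: Const (rh d) a]); split=> //=.
  + exact: rep_rh.
  + exact: frame_rh.
  + by regs.
- move=> C d0 R; have [C1 C2] := code_at_cat C; have [C3 C4] := code_at_cat C2.
  have [X1 [W1 R1 F1 E1]] := IH1 _ _ _ _ C1 d0 R.
  have [X2 [W2 R2 F2 E2]] := IH2 _ _ _ _ C3 (ltn0Sn d) R1.
  have W3 := block X2 ip op C4 isT.
  eexists; split.
  + rewrite !size_cat !addnA.
    exact: within_trans (within_trans W1 W2) W3.
  + exact: rep_rh.
  + move=> i id; rewrite /= /upd rE ltn_eqF // F2 ?F1 //; lia.
  + by rewrite /= /upd !rE !eqxx F2 // E1 E2.
- move=> C d0 R; have [C1 C2] := code_at_cat C; have [C3 C4] := code_at_cat C2.
  have [X1 [W1 R1 F1 E1]] := IH1 _ _ _ _ C1 d0 R.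
  have [X2 [W2 R2 F2 E2]] := IH2 _ _ _ _ C3 (ltn0Sn d) R1.
  have W3 := block X2 ip op C4 isT.
  eexists; split.
  + rewrite !size_cat !addnA.
    exact: within_trans (within_trans W1 W2) W3.
  + exact: rep_rh.
  + move=> i id; rewrite /= /upd rE ltn_eqF // F2 ?F1 //; lia.
  + by rewrite /= /upd !rE !eqxx F2 // E1 E2.
- move=> C d0 R; have [C1 C2] := code_at_cat C.
  have [X1 [W1 R1 F1 E1]] := IH _ _ _ _ C1 d0 R.
  rewrite -[_ :: _]/(addr_code d d.+1 j ++ [:: Fetch (rh d) (rh d)]) in C2 *.
  have [C3 C4] := code_at_cat C2.
  have dd : 0 < d < d.+1 by lia.
  have [X2 [W2 R2 E2 F2]] := addr_correct ip op dd C3 R1.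
  have W3 := block X2 ip op C4 isT.
  eexists; split.
  + rewrite !size_cat !addnA.
    apply: within_le (within_trans (within_trans W1 W2) W3) => /=; lia.
  + exact: rep_rh.
  + move=> i id; rewrite /= /upd rE ltn_eqF // F2 ?F1 //; lia.
  + by rewrite /= /upd !rE !eqxx E2 E1; case: R2 => _ _ ->.
move=> C d0 R.
pose c1 := [:: Const (rh d.+1) 0; Sum (rh d) (rv x) (rh d.+1); Const (rh d.+2) 0].
pose c2 := [:: Const (rh d.+3) 0; Sum (rv x) (rh d.+1) (rh d.+3)].
pose c4 := [:: Sum (rh d.+2) (rh d.+2) (rh d.+3); Const (rh d.+3) 1;
   Sum (rh d.+1) (rh d.+1) (rh d.+3); Diff (rh d.+3) (rh 0) (rh d.+1)].
pose c6 := [:: Const (rh d.+3) 0; Sum (rv x) (rh d) (rh d.+3);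
   Sum (rh d) (rh d.+2) (rh d.+3)].
have {}C : code_at P off (c1 ++ c2 ++ comp_e e d.+3 (off + 5) ++ c4 ++
   [:: JumpPos (rh d.+3) (off + 3)] ++ c6) by [].
have [C1 C'] := code_at_cat C; have [C2 C''] := code_at_cat C'.
have [C3 C3'] := code_at_cat C''; have [C4 C4'] := code_at_cat C3'.
have [C5 C6] := code_at_cat C4'.
set n := size (comp_e e d.+3 (off + 5)) in C4 C5 C6 *.
have K : code_at P (off + 3) c2 /\
    code_at P (off + 5) (comp_e e d.+3 (off + 5)) /\ code_at P (off + 5 + n) c4 /\
    code_at P (off + 9 + n) [:: JumpPos (rh d.+3) (off + 3)] /\
    code_at P (off + 10 + n) c6.
  by do !split; [apply: code_at_eq C2|apply: code_at_eq C3|apply: code_at_eq C4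
    |apply: code_at_eq C5|apply: code_at_eq C6]; rewrite /=; lia.
move: K => {C C' C'' C3' C4' C2 C3 C4 C5 C6} [C2 [C3 [C4 [C5 C6]]]].
rewrite [X in off + X](_ : _ = 13 + size (comp_e e d.+3 (off + 5))); last first.
  by rewrite /= !size_cat /=; lia.
have W1 := block X ip op C1 isT.
set X1 := foldl _ _ _ in W1.
(* During the loop the register of [x] is overwritten by the index; its old value waits in temporary
   [d], while [d.+1] counts and [d.+2] accumulates the sum. *)
pose I j (Y : nat -> nat) (ip' op' : seq nat) := [/\ [/\ ip' = ip, op' = op & frame d X Y],
  exists a, rep Y (upd v x a) A, Y (rh d) = v x, Y (rh d.+1) = j &
  Y (rh d.+2) = sumn [seq eval M (upd v x i) A e | i <- iota 0 j]].
have vE a : upd (upd v x a) x (v x) =1 v by move=> y; rewrite /upd; case: eqP => [->|].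
have [||Z [ip' [op' [W2 [[Ei Eo FZ] [a RZ] Z0 Z1 Z2]]]]] :=
    @loop_correct I (time_e M e + 7) (off + 3) (off + 10 + n) _ X1 ip op.
- move=> j Y ? ? jM [[-> -> FY] [a RY] Y0 Y1 Y2].
  have W2 := block Y ip op C2 isT.
  set Y' := foldl _ _ _ in W2.
  have RY' : rep Y' (upd v x j) A.
    apply: (@rep_ext _ (upd (upd v x a) x j)); first by move=> y; rewrite /upd; case: eqP.
    rewrite /Y' /= [X in upd _ _ X](_ : _ = j).
      by apply: rep_rv; apply: rep_rh.
    by regs; rewrite addn0.
  have [Y3 [W3 R3 F3 E3]] := IH _ _ _ _ C3 (ltn0Sn _) RY'.
  have W4 := block Y3 ip op C4 isT.
  set Y4 := foldl _ _ _ in W4.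
  have W5 := jump Y4 ip op C5.
  have Y3d : Y3 (rh d) = v x by rewrite F3; [rewrite /Y' /=; regs|lia].
  have Y3d1 : Y3 (rh d.+1) = j by rewrite F3; [rewrite /Y' /=; regs|lia].
  have Y3d2 : Y3 (rh d.+2) = Y (rh d.+2) by rewrite F3; [rewrite /Y' /=; regs|lia].
  have M3 : Y3 (rh 0) = M by case: R3.
  exists Y4, ip, op; split.
    have E4 : Y4 (rh d.+3) = M - j.+1.
      by rewrite /Y4 /=; regs; rewrite Y3d1 M3 addn1.
    rewrite E4 subn_gt0 in W5.
    apply: within_le (wtrans W2 _ (wtrans W3 _ (wtrans W4 _ _))); last 1 first.
    - by move: W5; rewrite (_ : (off + 9 + n).+1 = off + 10 + n); [exact|lia].
    1-4: rewrite /=; lia.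
  split; first split=> //.
  + move=> i id; rewrite /Y4 /=; regs; rewrite F3; last by lia.
    by rewrite /Y' /=; regs; apply: FY.
  + exists j; rewrite /Y4 /=; do ![apply: rep_rh => //].
  + by rewrite /Y4 /=; regs.
  + by rewrite /Y4 /=; regs; rewrite Y3d1 addn1.
  + rewrite -[in RHS]addn1 iotaD map_cat sumn_cat /= addn0 add0n -Y2 -Y3d2 -E3.
    by rewrite /Y4 /=; regs.
- split; [by split=> // i id; rewrite /X1 /=; regs|exists (v x)| | |];
    try by rewrite /X1 /=; regs.
  + rewrite /X1 /=; do ![apply: rep_rh => //]; apply: rep_ext R => y.
    by rewrite /upd; case: eqP => // ->.
  + by rewrite /X1 /=; regs; case: R => _ ->; rewrite addn0.
rewrite {ip'}Ei {op'}Eo in W2.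
have W3 := block Z ip op C6 isT.
exists (foldl rexec Z c6); split.
- apply: within_le (wtrans W1 _ (wtrans W2 _ (within_trans W3 _))); last 1 first.
  + by exists 0 => //=; congr Config; rewrite /=; lia.
  + by rewrite /=; lia.
  + by rewrite /=; lia.
  + by [].
- apply: rep_ext (vE a) _; rewrite /=; apply: rep_rh => //.
  rewrite [X in upd _ _ X](_ : _ = v x); last by regs; rewrite Z0 addn0.
  by apply: rep_rv; apply: rep_rh.
- by move=> i id; rewrite /=; regs; apply: FZ.
- by rewrite /=; regs; rewrite Z2 addn0.
Qed.

Lemma read_step off x X ip op : code_at P off [:: Read x] ->
  within P 1 (Config off X ip op) (Config off.+1 (upd X x (head 0 ip)) (behead ip) op).
Proof.
by move=> /code_at_head E; exists 1 => //; eexists; rewrite /step /= ?E.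
Qed.

Lemma write_step off x X ip op : code_at P off [:: Write x] ->
  within P 1 (Config off X ip op) (Config off.+1 X ip (rcons op (X x))).
Proof.
by move=> /code_at_head E; exists 1 => //; eexists; rewrite /step /= ?E.
Qed.

Lemma comp_correct c d off X s : code_at P off (comp_c c d off) ->
  0 < d -> rep X (vars s) (arrs s) -> exists X', [/\
    within P (time M c) (Config off X (inp s) (out s))
      (Config (off + size (comp_c c d off)) X' (inp (den M c s)) (out (den M c s))),
    rep X' (vars (den M c s)) (arrs (den M c s)) & frame d X X'].
Proof.
elim: c d off X s => [x e|j e1 e2|c1 IH1 c2 IH2|e c IH|x c IH|x|e] d off X s C d0 R.
- have [C1 C2] := code_at_cat C.
  have [X1 [W1 R1 F1 E1]] := comp_e_correct (inp s) (out s) C1 d0 R.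
  have W2 := block X1 (inp s) (out s) C2 isT.
  eexists; split.
  + rewrite /= size_cat addnA; exact: within_trans W1 W2.
  + rewrite /= -E1; rewrite [X in upd _ _ X](_ : _ = X1 (rh d)); last by regs; rewrite addn0.
    by apply: rep_rv; apply: rep_rh.
  + by move=> i id; rewrite /=; regs; apply: F1.
- have [C1 C'] := code_at_cat C; have [C2 C3] := code_at_cat C'.
  have [X1 [W1 R1 F1 E1]] := comp_e_correct (inp s) (out s) C1 d0 R.
  have [X2 [W2 R2 F2 E2]] := comp_e_correct (inp s) (out s) C2 (ltn0Sn _) R1.
  have [C4 C5] := code_at_cat C3.
  have dd : 0 < d < d.+2 by lia.
  have [X3 [W3 R3 E3 F3]] := addr_correct (inp s) (out s) dd C4 R2.
  have W4 := block X3 (inp s) (out s) C5 isT.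
  eexists; split.
  + apply: wend (wtrans W1 _ (wtrans W2 _ (wtrans W3 _ W4))) _ _ => //=.
      by lia.
    by rewrite !size_cat /=; lia.
  + rewrite /= E3 (F2 d (leqnn _)) E1 F3; [|lia|lia].
    by rewrite E2; apply: rep_ra.
  + move=> i id; rewrite /= E3 /upd rE F3; [|lia|lia].
    by rewrite F2 ?F1 //; lia.
- have [C1 C2] := code_at_cat C.
  have [X1 [W1 R1 F1]] := IH1 _ _ _ _ C1 d0 R.
  have [X2 [W2 R2 F2]] := IH2 _ _ _ _ C2 d0 R1.
  exists X2; split=> //; last exact: frame_trans F1 F2.
  by rewrite /= size_cat addnA; apply: within_trans W1 W2.
- set k1 := comp_e e d off; set k2 := comp_c c d (off + size k1 + 3).
  have {}C : code_at P off (k1 ++ [:: Const (rh d.+1) 1; Diff (rh d) (rh d.+1) (rh d)] ++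
    [:: JumpPos (rh d) (off + size k1 + 3 + size k2)] ++ k2) by [].
  have [C1 C'] := code_at_cat C; have [C2 C''] := code_at_cat C'.
  have [C3 C4] := code_at_cat C''.
  have [X1 [W1 R1 F1 E1]] := comp_e_correct (inp s) (out s) C1 d0 R.
  have W2 := block X1 (inp s) (out s) C2 isT.
  set X2 := foldl _ _ _ in W2.
  have W3 := jump X2 (inp s) (out s) C3.
  have E2 : X2 (rh d) = 1 - eval M (vars s) (arrs s) e by rewrite /X2 /=; regs; rewrite E1.
  have R2 : rep X2 (vars s) (arrs s) by rewrite /X2 /=; do ![apply: rep_rh => //].
  have F2 : frame d X X2 by move=> i id; rewrite /X2 /=; regs; apply: F1.
  rewrite E2 subn_gt0 in W3.
  rewrite -/k1 in W1.
  have sz : size (comp_c (CIf e c) d off) = size k1 + 3 + size k2.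
    by rewrite /= !size_cat /= -/k1 -/k2; lia.
  rewrite sz /=; case: ifP => [pos|npos]; last first.
    have {}npos : eval M (vars s) (arrs s) e < 1 by lia.
    exists X2; split=> //; rewrite npos in W3.
    by apply: wend (wtrans W1 _ (wtrans W2 _ W3)) _ _; rewrite /=; lia.
  have npos : (eval M (vars s) (arrs s) e < 1) = false by lia.
  rewrite npos in W3.
  have C4' : code_at P (off + size k1 + 3) k2 by apply: code_at_eq C4; rewrite /=; lia.
  have [X4 [W4 R4 F4]] := IH _ _ _ _ C4' d0 R2.
  rewrite -/k2 in W4.
  exists X4; split=> //; last exact: frame_trans F2 F4.
  by apply: wend (wtrans W1 _ (wtrans W2 _ (wtrans W3 _ W4))) _ _; rewrite /=; lia.
- pose c1 := [:: Const (rh d) 0].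
  pose c2 := [:: Const (rh d.+1) 0; Sum (rv x) (rh d) (rh d.+1)].
  pose c4 := [:: Const (rh d.+1) 1; Sum (rh d) (rh d) (rh d.+1);
     Diff (rh d.+1) (rh 0) (rh d)].
  have {}C : code_at P off (c1 ++ c2 ++ comp_c c d.+1 (off + 3) ++ c4 ++
    [:: JumpPos (rh d.+1) (off + 1)]) by [].
  have [C1 C'] := code_at_cat C; have [C2 C''] := code_at_cat C'.
  have [C3 C3'] := code_at_cat C''; have [C4 C5] := code_at_cat C3'.
  have sz : size (comp_c (CFor x c) d off) = 7 + size (comp_c c d.+1 (off + 3)).
    by rewrite /= !size_cat /=; lia.
  rewrite sz; set n := size (comp_c c d.+1 (off + 3)) in C4 C5 *.
  have K : code_at P (off + 1) c2 /\
      code_at P (off + 3) (comp_c c d.+1 (off + 3)) /\ code_at P (off + 3 + n) c4 /\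
      code_at P (off + 6 + n) [:: JumpPos (rh d.+1) (off + 1)].
    by do !split; [apply: code_at_eq C2|apply: code_at_eq C3|apply: code_at_eq C4
      |apply: code_at_eq C5]; rewrite /=; lia.
  move: K => {C C' C'' C3' C2 C3 C4 C5} [C2 [C3 [C4 C5]]].
  have W1 := block X (inp s) (out s) C1 isT.
  set X1 := foldl _ _ _ in W1.
  pose st j := foldl (fun s i => den M c (setv s x i)) s (iota 0 j).
  pose I j (Y : nat -> nat) (ip' op' : seq nat) := [/\ ip' = inp (st j),
    op' = out (st j), rep Y (vars (st j)) (arrs (st j)), frame d X Y & Y (rh d) = j].
  have [||Z [ip' [op' [W2 [Ei Eo RZ FZ Zd]]]]] :=
    @loop_correct I (time M c + 6) (off + 1) (off + 7 + n) _ X1 (inp s) (out s).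
  + move=> j Y ip op jM [-> -> RY FY Yd].
    have W2 := block Y (inp (st j)) (out (st j)) C2 isT.
    set Y' := foldl _ _ _ in W2.
    have RY' : rep Y' (vars (setv (st j) x j)) (arrs (setv (st j) x j)).
      rewrite /Y' /= [X in upd _ _ X](_ : _ = j).
        by apply: rep_rv; apply: rep_rh.
      by regs; rewrite addn0.
    have [Y3 [W3 R3 F3]] := IH _ _ _ _ C3 (ltn0Sn _) RY'.
    have stS : st j.+1 = den M c (setv (st j) x j).
      by rewrite /st -addn1 iotaD foldl_cat.
    have W4 := block Y3 (inp (st j.+1)) (out (st j.+1)) C4 isT.
    set Y4 := foldl _ _ _ in W4.
    have W5 := jump Y4 (inp (st j.+1)) (out (st j.+1)) C5.
    have Y3d : Y3 (rh d) = j by rewrite F3; [rewrite /Y' /=; regs|lia].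
    have M3 : Y3 (rh 0) = M by case: R3.
    exists Y4, (inp (st j.+1)), (out (st j.+1)); split.
      have E4 : Y4 (rh d.+1) = M - j.+1.
        by rewrite /Y4 /=; regs; rewrite Y3d M3 addn1.
      rewrite E4 subn_gt0 in W5; rewrite -stS in W3.
      apply: within_le (wtrans W2 _ (wtrans W3 _ (wtrans W4 _ _))); last 1 first.
      - by move: W5; rewrite (_ : (off + 6 + n).+1 = off + 7 + n); [exact|lia].
      1-4: rewrite /=; lia.
    split=> //; rewrite ?stS.
    * by rewrite /Y4 /=; do ![apply: rep_rh => //].
    * move=> i id; rewrite /Y4 /=; regs; rewrite F3; last by lia.
      by rewrite /Y' /=; regs; apply: FY.
    * by rewrite /Y4 /=; regs; rewrite Y3d addn1.
  + split=> //; [by rewrite /X1 /=; apply: rep_rh| |by rewrite /X1 /=; regs].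
    by move=> i id; rewrite /X1 /=; regs.
  rewrite {ip'}Ei {op'}Eo in W2.
  exists Z; split=> //.
  by apply: wend (wtrans W1 _ W2) _ _; rewrite /=; lia.
- have W := read_step X (inp s) (out s) C.
  eexists; split; [rewrite /= addn1; exact: W|exact: rep_rv|exact: frame_rv].
- have [C1 C2] := code_at_cat C.
  have [X1 [W1 R1 F1 E1]] := comp_e_correct (inp s) (out s) C1 d0 R.
  have W2 := write_step X1 (inp s) (out s) C2.
  exists X1; split=> //=; rewrite -E1.
  by apply: wend (wtrans W1 _ W2) _ _; rewrite // size_cat /=; lia.
Qed.

End Correct.

(* Loops run [n + 3] times, so that the three colours are loop indices even when
   the graph is very small; the three additional vertices are isolated. *)
Definition compile c : program :=
  [:: Read (rv 0)] ++ [:: Const (rh 1) 3; Sum (rh 0) (rv 0) (rh 1)] ++ comp_c c 1 3.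

Definition start n rest : state := State (upd (fun=> 0) 0 n) (fun _ _ => 0) rest [::].

Lemma nsteps_run P m b s s' : nsteps P m s s' -> m <= b -> step P s' = None ->
  run P b s = Some (output s').
Proof.
elim: m b s => [|m IH] b s /=.
  by move=> -> _ H; case: b => [|b]; rewrite /= H.
case=> s1 E N; case: b => // b mb H; rewrite /= E; exact: IH.
Qed.

(** The three extra steps are the header, which reads [n] and stores [n + 3] as the number of
    iterations. *)
Lemma compile_correct c n rest b : time (n + 3) c + 3 <= b ->
  run (compile c) b (init (n :: rest)) = Some (out (den (n + 3) c (start n rest))).
Proof.
move=> tb; have M0 : 0 < n + 3 by rewrite addn_gt0 orbT.
have C : code_at (compile c) 0 (compile c) by exists [::], [::]; rewrite cats0.
have [C1 C'] := code_at_cat C; have [C2 C3] := code_at_cat C'.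
have W1 := read_step (fun=> 0) (n :: rest) [::] C1.
have W2 := block (upd (fun=> 0) (rv 0) n) rest [::] C2 isT.
set X2 := foldl _ _ _ in W2.
have R2 : rep (n + 3) X2 (vars (start n rest)) (arrs (start n rest)).
  split=> [|x|j i]; rewrite /X2 /= /upd.
  - by rewrite !rE.
  - by rewrite !rv_rh rv_rv.
  - by rewrite !ra_rh ra_rv.
have [X3 [W3 _ _]] := comp_correct M0 C3 isT R2.
have [m mb N] := wtrans W1 erefl (wtrans W2 erefl W3).
apply: (nsteps_run N); first by apply: leq_trans mb _; rewrite /=; lia.
by rewrite /step [onth _ _]onth_default //= /compile !size_cat /=; lia.
Qed.

(* Nonzero numbers stand for true. *)
Definition ENot e := ESub (ECst 1) e.
Definition EAnd e1 e2 := ENot (EAdd (ENot e1) (ENot e2)).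
Definition EOr e1 e2 := EAdd e1 e2.
Definition EImp e1 e2 := EOr (ENot e1) e2.
Definition ELt e1 e2 := ESub e2 e1.
Definition EEq e1 e2 := ENot (EAdd (ESub e1 e2) (ESub e2 e1)).
Definition EAll x e := ENot (ESum x (ENot e)).
Definition EConj es := foldr EAnd (ECst 1) es.

(* There is no multiplication: variable [1] is a dummy index, so that summing
   over it multiplies by the number of iterations. *)
Definition EIdx e1 e2 := EAdd (ESum 1 e1) e2.
Definition EIdxs xs := foldl (fun e x => EIdx e (EVar x)) (ECst 0) xs.

Definition nest xs c := foldr CFor c xs.

(** * Truth values and numbers in base M *)

Section Holds.
Variable M : nat.
Definition holds v A e := 0 < eval M v A e.

Implicit Types (v : nat -> nat) (A : 'I_8 -> nat -> nat).

Lemma holds_not v A e : holds v A (ENot e) = ~~ holds v A e.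
Proof. by rewrite /holds /=; case: (eval M v A e). Qed.

Lemma holds_or v A e1 e2 : holds v A (EOr e1 e2) = holds v A e1 || holds v A e2.
Proof. by rewrite /holds /= addn_gt0. Qed.

Lemma holds_and v A e1 e2 : holds v A (EAnd e1 e2) = holds v A e1 && holds v A e2.
Proof. by rewrite holds_not (holds_or v A (ENot e1)) !holds_not negb_or !negbK. Qed.

Lemma holds_imp v A e1 e2 : holds v A (EImp e1 e2) = (holds v A e1 ==> holds v A e2).
Proof. by rewrite holds_or holds_not implybE. Qed.

Lemma holds_lt v A e1 e2 : holds v A (ELt e1 e2) = (eval M v A e1 < eval M v A e2).
Proof. by rewrite /holds /= subn_gt0. Qed.

Lemma holds_eq v A e1 e2 : holds v A (EEq e1 e2) = (eval M v A e1 == eval M v A e2).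
Proof.
by rewrite holds_not /holds /= addn_gt0 !subn_gt0 -neq_ltn eq_sym negbK.
Qed.

Lemma holds_sum v A x e : holds v A (ESum x e) = [exists i : 'I_M, holds (upd v x i) A e].
Proof.
rewrite /holds /= lt0n sumnE big_map -[M in iota 0 M]subn0 -/(index_iota 0 M).
rewrite big_mkord sum_nat_eq0 negb_forall.
by apply: eq_existsb => i; rewrite lt0n.
Qed.

Lemma holds_all v A x e : holds v A (EAll x e) = [forall i : 'I_M, holds (upd v x i) A e].
Proof.
rewrite holds_not holds_sum negb_exists; apply: eq_forallb => i.
by rewrite holds_not negbK.
Qed.

Lemma holds_conj v A es : holds v A (EConj es) = all (holds v A) es.
Proof. by elim: es => //= e es IH; rewrite holds_and IH. Qed.

Definition indep e := forall v A i, eval M (upd v 1 i) A e = eval M v A e.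

Lemma eval_idx v A e1 e2 : indep e1 ->
  eval M v A (EIdx e1 e2) = M * eval M v A e1 + eval M v A e2.
Proof.
move=> I; rewrite /=; congr (_ + _).
rewrite (eq_map (g := fun=> eval M v A e1)); last by move=> i; apply: I.
by rewrite sumnE big_map big_const_seq count_predT size_iota iter_addn addn0 mulnC.
Qed.

(** The number with base-[M] digits [ds], the most significant one first. *)
Definition horner ds := foldl (fun a d => M * a + d) 0 ds.

Lemma horner_rcons ds d : horner (rcons ds d) = M * horner ds + d.
Proof. by rewrite /horner foldl_rcons. Qed.

Lemma eval_idxs v A xs : 1 \notin xs -> eval M v A (EIdxs xs) = horner (map v xs).
Proof.
elim/last_ind: xs v A => // xs x IH v A; rewrite mem_rcons inE negb_or => /andP[x1 xs1].
rewrite /EIdxs foldl_rcons -/(EIdxs xs) map_rcons horner_rcons -(IH _ A) // eval_idx //.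
move=> {}v B i; rewrite !IH //; congr horner; apply/eq_in_map => y yx.
by rewrite /upd; case: eqP => // E; rewrite -E yx in xs1.
Qed.

Lemma horner_inj ds ds' : size ds = size ds' -> all (gtn M) ds -> all (gtn M) ds' ->
  horner ds = horner ds' -> ds = ds'.
Proof.
elim/last_ind: ds ds' => [|ds d IH] ds'; first by case: ds'.
case/lastP: ds' => [|ds' d']; first by rewrite size_rcons.
rewrite !size_rcons !all_rcons !horner_rcons => -[sz] /= /andP[dM a] /andP[dM' a'] E.
have E1 : horner ds = horner ds'.
  have := congr1 (divn^~ M) E; rewrite !(mulnC M) !divnMDl ?divn_small ?addn0 //; lia.
rewrite (IH _ sz a a' E1); congr rcons.
by move: E; rewrite E1 => /addnI.
Qed.

End Holds.

Section Frame.
Variable M : nat.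

Fixpoint wvars c : seq nat :=
  match c with
  | CSet x _ => [:: x]
  | CSeq c1 c2 => wvars c1 ++ wvars c2
  | CIf _ c => wvars c
  | CFor x c => x :: wvars c
  | CRead x => [:: x]
  | _ => [::]
  end.

Fixpoint warrs c : seq 'I_8 :=
  match c with
  | CPut j _ _ => [:: j]
  | CSeq c1 c2 => warrs c1 ++ warrs c2
  | CIf _ c | CFor _ c => warrs c
  | _ => [::]
  end.

Fixpoint noio c : bool :=
  match c with
  | CSeq c1 c2 => noio c1 && noio c2
  | CIf _ c | CFor _ c => noio c
  | CRead _ | CWrite _ => false
  | _ => true
  end.

Record same (xs : pred nat) (js : pred 'I_8) s s' : Prop := Same {
  same_v x : ~~ xs x -> vars s' x = vars s x;
  same_a j i : ~~ js j -> arrs s' j i = arrs s j i;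
  same_i : inp s' = inp s;
  same_o : out s' = out s
}.

Lemma same_refl xs js s : same xs js s s.
Proof. by split. Qed.

Lemma same_trans xs js s1 s2 s3 : same xs js s1 s2 -> same xs js s2 s3 ->
  same xs js s1 s3.
Proof.
move=> [a1 b1 c1 d1] [a2 b2 c2 d2]; split; rewrite ?c2 ?d2 //.
  by move=> x nx; rewrite a2 ?a1.
by move=> j i nj; rewrite b2 ?b1.
Qed.

Lemma same_sub (xs xs' : pred nat) (js js' : pred 'I_8) s s' :
  (forall x, xs x -> xs' x) -> (forall j, js j -> js' j) ->
  same xs js s s' -> same xs' js' s s'.
Proof.
move=> X J [a b c d]; split=> // [x nx|j i nj].
  by apply: a; apply: contra nx; apply: X.
by apply: b; apply: contra nj; apply: J.
Qed.

Lemma same_setv (xs : pred nat) js s x a : xs x -> same xs js s (setv s x a).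
Proof.
by move=> xx; split=> //= y ny; rewrite /upd; case: eqP => // E; rewrite E xx in ny.
Qed.

Lemma den_same c s : noio c -> same (mem (wvars c)) (mem (warrs c)) s (den M c s).
Proof.
elim: c s => [x e|j e1 e2|c1 IH1 c2 IH2|e c IH|x c IH|x|e] s //=.
- by move=> _; split=> //= y; rewrite inE /upd => /negbTE->.
- move=> _; split=> //= j' i'; rewrite inE /upda => /negbTE->.
  by [].
- case/andP=> n1 n2; apply: same_trans (same_sub _ _ (IH1 s n1)) (same_sub _ _ (IH2 _ n2));
    by move=> x /= xx; rewrite mem_cat xx ?orbT.
- by move=> n; case: ifP => _; [apply: IH|apply: same_refl].
- move=> n; elim: (iota 0 M) s => [|i l IHl] s /=; first exact: same_refl.
  apply: same_trans (IHl _); apply: (@same_trans _ _ _ (setv s x i)).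
    by apply: same_setv; rewrite /= mem_head.
  by apply: same_sub (IH _ n) => // y /= yy; rewrite inE yy orbT.
Qed.

Lemma den_for (I : nat -> state -> Prop) x c s : I 0 s ->
  (forall i s, i < M -> I i s -> I i.+1 (den M c (setv s x i))) ->
  I M (den M (CFor x c) s).
Proof.
move=> I0 IS /=; suff gen m : m <= M ->
    I m (foldl (fun s i => den M c (setv s x i)) s (iota 0 m)) by apply: gen.
elim: m => // m IH mM; rewrite -addn1 iotaD foldl_cat /= addn1.
by apply: IS => //; apply: IH; apply: ltnW.
Qed.

End Frame.

(** * Fixed points by repeated sweeps *)

Section Sweep.
Variables (M : nat) (c : cmd) (xs : seq nat).
(** [eqv] compares the part of the state on which [mu] and [good] depend, so that the loop variables
    may change freely. *)
Variables (Inv : state -> Prop) (eqv : state -> state -> Prop).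
Variables (mu : state -> nat) (good : seq nat -> state -> Prop).

Hypothesis eqv_refl : forall s, eqv s s.
Hypothesis eqv_trans : forall s1 s2 s3, eqv s1 s2 -> eqv s2 s3 -> eqv s1 s3.
Hypothesis eqv_mu : forall s1 s2, eqv s1 s2 -> mu s2 = mu s1.
Hypothesis eqv_good : forall ds s1 s2, eqv s1 s2 -> good ds s1 <-> good ds s2.
Hypothesis c_vars : forall s x, x \in xs -> vars (den M c s) x = vars s x.
Definition digits s xs := all (gtn M) (map (vars s) xs).

Hypothesis c_inv : forall s, digits s xs -> Inv s -> Inv (den M c s).
Hypothesis c_step : forall s, digits s xs -> Inv s ->
  (eqv s (den M c s) /\ good (map (vars s) xs) s) \/ mu (den M c s) < mu s.
Hypothesis c_good : forall s, digits s xs -> Inv s -> good (map (vars s) xs) s -> eqv s (den M c s).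

Definition all_good s := forall ds, size ds = size xs -> all (gtn M) ds -> good ds s.

(** A sweep that does not lower [mu] has seen the same relevant state at every tuple and thus
    certified all of them. The last conclusion makes a state in which all is good stable under the
    sweeps that follow. *)
Lemma nest_sweep ps zs : ps ++ zs = xs -> uniq xs ->
  (forall x a s, x \in zs -> (Inv s -> Inv (setv s x a)) /\ eqv s (setv s x a)) ->
  forall s, Inv s -> digits s ps -> let s' := den M (nest zs c) s in
  let G := forall ds, size ds = size zs -> all (gtn M) ds -> good (map (vars s) ps ++ ds) s in
  [/\ Inv s', forall x, x \in ps -> vars s' x = vars s x,
   (eqv s s' /\ G) \/ mu s' < mu s & G -> eqv s s'].
Proof.
elim: zs ps => [|z zs IH] ps E U Hz s Is Ds.
  rewrite cats0 in E; rewrite /= E; rewrite E in Ds; split; first exact: c_inv.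
  - by move=> x xp; apply: c_vars.
  - case: (c_step Ds Is) => [[? g]|]; [left|by right].
    by split=> // -[|d ds] // _ _; rewrite cats0.
  - by move=> /(_ [::] erefl isT); rewrite cats0; apply: c_good.
have E' : rcons ps z ++ zs = xs by rewrite cat_rcons.
have Hz' x a s0 : x \in zs -> (Inv s0 -> Inv (setv s0 x a)) /\ eqv s0 (setv s0 x a).
  by move=> xz; apply: Hz; rewrite inE xz orbT.
have nzp : z \notin ps.
  by move: U; rewrite -E' cat_uniq rcons_uniq -andbA => /andP[].
move=> s' G.
pose G1 i s1 := forall ds, size ds = size zs -> all (gtn M) ds ->
  good (map (vars s) ps ++ i :: ds) s1.
pose I m s1 := [/\ Inv s1, forall x, x \in ps -> vars s1 x = vars s x,
   (eqv s s1 /\ forall i, i < m -> G1 i s) \/ mu s1 < mu s &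
   (forall i, i < m -> G1 i s) -> eqv s s1].
have [H1 H2 H3 H4] : I M s'.
  apply: den_for; first by split=> //; left; split.
  move=> i s1 iM [I1 V1 D1 K1].
  have [zI zE] := Hz z i s1 (mem_head _ _).
  have Eps : map (vars (setv s1 z i)) (rcons ps z) = rcons (map (vars s) ps) i.
    rewrite map_rcons /= {2}/upd eqxx; congr rcons; apply/eq_in_map => x xp.
    rewrite /= /upd; case: eqP => [xz|_]; last exact: V1.
    by rewrite -xz xp in nzp.
  have D1' : digits (setv s1 z i) (rcons ps z).
    by rewrite /digits Eps all_rcons /= iM.
  have [I2 V2 D2 K2] := IH _ E' U Hz' _ (zI I1) D1'.
  set s2 := den M _ (setv s1 z i) in I2 V2 D2 K2 *.
  have V3 x : x \in ps -> vars s2 x = vars s x.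
    move=> xp; rewrite V2; last by rewrite mem_rcons inE xp orbT.
    rewrite /= /upd; case: eqP => [xz|_]; last exact: V1.
    by rewrite -xz xp in nzp.
  rewrite Eps in D2 K2.
  have GE : (forall ds, size ds = size zs -> all (gtn M) ds ->
      good (rcons (map (vars s) ps) i ++ ds) (setv s1 z i)) <-> G1 i s1.
    split=> H ds sz ad; [have := H ds sz ad|]; rewrite cat_rcons.
      by apply: (proj2 (eqv_good _ zE)).
    by apply: (proj1 (eqv_good _ zE)); apply: H.
  have m1 : mu (setv s1 z i) = mu s1 by apply: eqv_mu.
  split=> //.
  - case: D1 => [[e1 g1]|lt].
      case: D2 => [[e2 g2]|lt2]; last by right; rewrite -(eqv_mu e1) -m1.
      left; split; first exact: eqv_trans e1 (eqv_trans zE e2).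
      move=> i'; rewrite ltnS leq_eqVlt => /predU1P[->|/g1 //] ds sz ad.
      by apply: (proj2 (eqv_good _ e1)); move/GE: g2; apply.
    right; case: D2 => [[e2 _]|lt2]; first by rewrite (eqv_mu e2) m1.
    by apply: ltn_trans lt2 _; rewrite m1.
  - move=> H; have e1 : eqv s s1 by apply: K1 => i' lt; apply: H; apply: ltnW.
    apply: (eqv_trans e1 (eqv_trans zE _)); apply: K2; apply/GE => ds sz ad.
    by apply: (proj1 (eqv_good _ e1)); apply: H.
have GG : G <-> forall i, i < M -> G1 i s.
  split=> [H i iM ds sz ad|H [|d ds] //= [sz] /andP[dM ad]].
    by apply: H; rewrite /= ?sz ?iM.
  exact: H.
split=> //; last by move/GG.
by case: H3 => [[? /GG]|]; [left|right].
Qed.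

(* A sweep that changes nothing shows that everything is good, so that as many
   sweeps suffice as the measure [mu] can decrease. *)
Lemma sweeps ys : uniq xs ->
  (forall x a s, x \in xs ++ ys -> (Inv s -> Inv (setv s x a)) /\ eqv s (setv s x a)) ->
  forall s, Inv s -> mu s <= M ^ size ys ->
  let s' := den M (nest ys (nest xs c)) s in Inv s' /\ all_good s'.
Proof.
move=> U Hx s Is mus s'.
have Hxs x a s0 : x \in xs -> (Inv s0 -> Inv (setv s0 x a)) /\ eqv s0 (setv s0 x a).
  by move=> xx; apply: Hx; rewrite mem_cat xx.
have sw s0 : Inv s0 -> let s1 := den M (nest xs c) s0 in
    [/\ Inv s1, (eqv s0 s1 /\ all_good s0) \/ mu s1 < mu s0 & all_good s0 -> eqv s0 s1].
  by move=> I0; have [? _ ? ?] := nest_sweep (ps := [::]) erefl U Hxs I0 isT.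
have agE s1 s2 : eqv s1 s2 -> all_good s1 -> all_good s2.
  by move=> e12 a ds sz ad; apply: (proj1 (eqv_good _ e12)); apply: a.
suff [I' [g|lt]] : Inv s' /\ (all_good s' \/ mu s' + M ^ size ys <= mu s).
- by [].
- split=> //; have [_ [[_ //]|lt'] _] := sw _ I'; lia.
rewrite /s' {s' mus}.
have Hys : forall x, x \in ys -> x \in xs ++ ys by move=> x xy; rewrite mem_cat xy orbT.
suff [H1 H2 _] : let s' := den M (nest ys (nest xs c)) s in [/\ Inv s',
    all_good s' \/ mu s' + M ^ size ys <= mu s & all_good s -> all_good s'] by [].
elim: ys Hx Hys s Is => [|y ys IH] Hx Hys s Is.
  have [I1 D K] := sw s Is; split=> //; last by move=> a; apply: agE (K a) a.
  case: D => [[e1 a]|]; first by left; apply: agE a.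
  by right; rewrite expn0 addn1.
pose I m s1 := [/\ Inv s1, all_good s1 \/ mu s1 + m * M ^ size ys <= mu s &
  all_good s -> all_good s1].
have [H1 H2 H3] : I M (den M (CFor y (nest ys (nest xs c))) s).
  apply: den_for; first by split=> //; right; rewrite mul0n addn0.
  move=> i s1 iM [I1 D1 K1].
  have [yI yE] := Hx y i s1 (Hys _ (mem_head _ _)).
  have [|x xy|I2 D2 K2] := IH _ _ _ (yI I1).
  - move=> x a s0; rewrite mem_cat => xx; apply: Hx; rewrite mem_cat inE.
    by case/orP: xx => ->; rewrite ?orbT.
  - by rewrite mem_cat xy orbT.
  split=> //; last by move=> a; apply: K2; apply: agE yE (K1 a).
  case: D1 => [a|le]; first by left; apply: K2; apply: agE yE a.
  case: D2 => [a|le2]; [by left|right].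
  by move: le2; rewrite (eqv_mu yE) mulSn; lia.
by split=> //; rewrite expnS.
Qed.

End Sweep.

Lemma eval_ext M v v' A A' e : v =1 v' -> A =2 A' -> eval M v A e = eval M v' A' e.
Proof.
move=> + EA; elim: e v v' => [x|a|e1 IH1 e2 IH2|e1 IH1 e2 IH2|j e IH|x e IH] v v' Ev //=.
- by rewrite (IH1 _ _ Ev) (IH2 _ _ Ev).
- by rewrite (IH1 _ _ Ev) (IH2 _ _ Ev).
- by rewrite (IH _ _ Ev).
- congr sumn; apply: eq_map => i; apply: IH => y; by rewrite /upd; case: eqP.
Qed.

Lemma wvars_nest xs c : wvars (nest xs c) = xs ++ wvars c.
Proof. by elim: xs => //= x xs ->. Qed.

Lemma warrs_nest xs c : warrs (nest xs c) = warrs c.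
Proof. by elim: xs => //= x xs ->. Qed.

Lemma noio_nest xs c : noio (nest xs c) = noio c.
Proof. by elim: xs => //= x xs ->. Qed.

Section Flags.
Variables (M : nat) (xs ys : seq nat) (cond idx : expr) (j : 'I_8) (b : bool).
Variables (C : seq nat -> ('I_8 -> nat -> nat) -> bool) (I : seq nat -> nat).
Variable J : ('I_8 -> nat -> nat) -> Prop.

Let c := CIf cond (CPut j idx (ECst b)).

(** The measure counts the entries below [N] whose truth value is not yet [b]. Each effective step
    corrects one of them, and none is ever changed back, so [N] sweeps suffice; [J] is an invariant
    supplied by the application. *)
Lemma flag_sweeps N s : uniq xs -> N <= M ^ size ys ->
  (forall v A, (forall x, x \notin xs ++ ys -> v x = vars s x) ->
     holds M v A cond = C (map v xs) A) ->
  (forall v A, eval M v A idx = I (map v xs)) ->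
  (forall ds, size ds = size xs -> all (gtn M) ds -> I ds < N) ->
  (forall ds A A', A =2 A' -> C ds A = C ds A') ->
  (forall ds A, C ds A -> (0 < A j (I ds)) = ~~ b) ->
  (forall ds A, size ds = size xs -> all (gtn M) ds -> C ds A -> J A ->
     J (upda A j (I ds) b)) ->
  J (arrs s) -> let A' := arrs (den M (nest ys (nest xs c)) s) in
  J A' /\ forall ds, size ds = size xs -> all (gtn M) ds -> ~~ C ds A'.
Proof.
move=> U NM HC HI IN Cext Cf JC Js.
pose mu s := count (fun i => (0 < arrs s j i) != b) (iota 0 N).
pose eqv s s' := arrs s =2 arrs s'.
pose fr s0 := forall x, x \notin xs ++ ys -> vars s0 x = vars s x.
have dE s0 : fr s0 -> den M c s0 = if C (map (vars s0) xs) (arrs s0)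
    then State (vars s0) (upda (arrs s0) j (I (map (vars s0) xs)) b) (inp s0) (out s0)
    else s0.
  by move=> f0; rewrite /= -/(holds M _ _ cond) HC // HI.
suff [[J' _] g] : let s' := den M (nest ys (nest xs c)) s in
    (J (arrs s') /\ fr s') /\ forall ds, size ds = size xs -> all (gtn M) ds -> ~~ C ds (arrs s').
  by split.
apply: (@sweeps M c xs (fun s0 => J (arrs s0) /\ fr s0) eqv mu (fun ds s => ~~ C ds (arrs s))).
- by [].
- by move=> s1 s2 s3 e1 e2 j' i'; rewrite e1.
- by move=> s1 s2 e1; apply: eq_count => i; rewrite e1.
- by move=> ds s1 s2 e1; rewrite (Cext _ _ _ e1).
- by move=> s0 x _ /=; case: ifP.
- move=> s0 D0 [J0 f0]; rewrite dE //; case: ifP => CC; last by split.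
  by split=> //; apply: JC => //; rewrite size_map.
- move=> s0 D0 [J0 f0]; rewrite dE //; case: ifP => CC; [right|by left; split].
  have IN' : I (map (vars s0) xs) < N by apply: IN; rewrite ?size_map.
  have i0 : I (map (vars s0) xs) \in iota 0 N by rewrite mem_iota.
  have := perm_to_rem i0; rewrite /mu => /permP p; rewrite !p /= /upda !eqxx /=.
  rewrite (Cf _ _ CC); have -> : ((0 < b) != b) = false by case: (b).
  have -> : ~~ b != b by case: (b).
  rewrite add0n ltnS leq_eqVlt; apply/orP; left; apply/eqP/eq_in_count => i ir.
  have ne : (i == I (map (vars s0) xs)) = false.
    by apply/negP => /eqP E; move: ir; rewrite E mem_rem_uniqF // iota_uniq.
  by rewrite ne.
- by move=> s0 D0 [J0 f0] nC; rewrite dE // (negbTE nC).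
- by [].
- move=> x a s0 xx; split=> // -[J0 f0]; split=> // y yn; rewrite /= /upd.
  by case: eqP => [E|_]; [rewrite E xx in yn|apply: f0].
- by split.
- rewrite /mu; apply: leq_trans (count_size _ _) _; by rewrite size_iota.
Qed.

End Flags.

Section Fill.
Variable M : nat.

Lemma den_fill (j : 'I_8) x ex (F : nat -> nat) s :
  (forall i A, i < M -> (forall j' i', j' != j -> A j' i' = arrs s j' i') ->
     eval M (upd (vars s) x i) A ex = F i) ->
  let s' := den M (CFor x (CPut j (EVar x) ex)) s in
  [/\ forall i, i < M -> arrs s' j i = F i,
    forall j' i', j' != j -> arrs s' j' i' = arrs s j' i',
    forall y, y != x -> vars s' y = vars s y & inp s' = inp s /\ out s' = out s].
Proof.
move=> H; apply: (@den_for M (fun m s' => [/\ forall i, i < m -> arrs s' j i = F i,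
    forall j' i', j' != j -> arrs s' j' i' = arrs s j' i',
    forall y, y != x -> vars s' y = vars s y & inp s' = inp s /\ out s' = out s])).
  by split.
move=> i s0 iM [H1 H2 H3 [H4 H5]]; split.
- move=> i' i'i; rewrite /= /upda eqxx /= /upd eqxx; case: eqP => [->|ne].
    rewrite -(H i (arrs s0)) //; apply: eval_ext => // y; rewrite /upd.
    by case: eqP => // /eqP /H3.
  by apply: H1; lia.
- by move=> j' i' jj; rewrite /= /upda (negbTE jj) /= H2.
- by move=> y yx; rewrite /= /upd (negbTE yx) H3.
- by [].
Qed.
End Fill.

(** * The algorithm *)

(* [aE] is the adjacency matrix and [aR] the retraction onto the vertices that
   have not been folded away; [aP] and [aX] are scratch space for folding.
   A nonzero entry of [aL] or [aT] says that a colour has been removed from a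
   list, or a position of the pebbles from the strategy. *)
Definition aE : 'I_8 := @Ordinal 8 0 isT.
Definition aR : 'I_8 := @Ordinal 8 1 isT.
Definition aP : 'I_8 := @Ordinal 8 2 isT.
Definition aX : 'I_8 := @Ordinal 8 3 isT.
Definition aL : 'I_8 := @Ordinal 8 4 isT.
Definition aT : 'I_8 := @Ordinal 8 5 isT.

Section Lists.
Variable M : nat.
Implicit Types (A : 'I_8 -> nat -> nat).

(* The fixed points of the retraction stored in [aR] are the vertices that are
   still present. *)
Definition edge A u v := [&& 0 < A aE (M * u + v), A aR u == u & A aR v == v].
Definition allowed A v a := (a < 3) && (A aL (M * v + a) == 0).

Definition EEdge e1 e2 := EAnd (EArr aE (EIdx e1 e2))
  (EAnd (EEq (EArr aR e1) e1) (EEq (EArr aR e2) e2)).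
Definition EAllowed e1 e2 := EAnd (ELt e2 (ECst 3)) (ENot (EArr aL (EIdx e1 e2))).

Lemma holds_arr (v : nat -> nat) A j e : holds M v A (EArr j e) = (0 < A j (eval M v A e)).
Proof. by []. Qed.

Lemma indep_var x : x != 1 -> indep M (EVar x).
Proof. by move=> x1 v A i; rewrite /= /upd (negbTE x1). Qed.

Lemma holds_edge (v : nat -> nat) A e1 e2 : indep M e1 ->
  holds M v A (EEdge e1 e2) = edge A (eval M v A e1) (eval M v A e2).
Proof. by move=> i1; rewrite !holds_and !holds_eq holds_arr eval_idx. Qed.

Lemma holds_allowed (v : nat -> nat) A e1 e2 : indep M e1 ->
  holds M v A (EAllowed e1 e2) = allowed A (eval M v A e1) (eval M v A e2).
Proof.
move=> i1; rewrite holds_and holds_lt holds_not /allowed; congr andb.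
by rewrite holds_arr -eqn0Ngt eval_idx.
Qed.

Lemma eq_edge A A' : (forall j i, j != aT -> A j i = A' j i) -> edge A =2 edge A'.
Proof. by move=> E u v; rewrite /edge !E. Qed.

Lemma eq_allowed A A' : (forall j i, j != aT -> A j i = A' j i) -> allowed A =2 allowed A'.
Proof. by move=> E u v; rewrite /allowed !E. Qed.

Variable k : nat.

(* Pebble [j] is the vertex in variable [20 + 2 j] with the colour in variable
   [21 + 2 j], and a position of the pebbles is a number of [2 k] digits. *)
Definition digs := iota 20 (2 * k).
(** As many counters as digits: they generate [M ^ (2 * k)] sweeps, one for each position that can
    be removed. *)
Definition cnt := iota (20 + 2 * k) (2 * k).

Definition set2 (ds : seq nat) j v a := take (2 * j) ds ++ [:: v; a] ++ drop (2 * j).+2 ds.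
Definition peb (ds : seq nat) j := (nth 0 ds (2 * j), nth 0 ds (2 * j).+1).
Definition pebs ds := [seq peb ds j | j <- iota 0 k].

Definition local A ds := all (fun p => allowed A p.1 p.2 && all (fun q =>
  ((p.1 == q.1) ==> (p.2 == q.2)) && (edge A p.1 q.1 ==> (p.2 != q.2))) (pebs ds)) (pebs ds).
(** A move lifts pebble [j] and puts it on [v]. The board always carries [k] pebbles; game positions
    with fewer pebbles are parts of such boards. *)
Definition supported A ds := all (fun j => [forall v : 'I_M, exists a : 'I_M,
   A aT (horner M (set2 ds j v a)) == 0]) (iota 0 k).

Definition EPeb j := (EVar (20 + 2 * j), EVar (20 + 2 * j).+1).
Definition EPebs := [seq EPeb j | j <- iota 0 k].
Definition ELocal := EConj [seq EAnd (EAllowed p.1 p.2) (EConj [seq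
   EAnd (EImp (EEq p.1 q.1) (EEq p.2 q.2)) (EImp (EEdge p.1 q.1) (ENot (EEq p.2 q.2)))
   | q <- EPebs]) | p <- EPebs].
Definition ESupported := EConj [seq EAll 18 (ESum 19
   (ENot (EArr aT (EIdxs (set2 digs j 18 19))))) | j <- iota 0 k].

Lemma nth_digs (v : nat -> nat) i : i < 2 * k -> nth 0 (map v digs) i = v (20 + i).
Proof. by move=> ik; rewrite (nth_map 0) ?size_iota // nth_iota. Qed.

Lemma holds_local v A : holds M v A ELocal = local A (map v digs).
Proof.
have Ea j : j < k -> nth 0 (map v digs) (2 * j) = v (20 + 2 * j).
  by move=> jk; rewrite nth_digs //; lia.
have Eb j : j < k -> nth 0 (map v digs) (2 * j).+1 = v (20 + 2 * j).+1.
  by move=> jk; rewrite nth_digs ?addnS //; lia.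
have ind j : indep M (EVar (20 + 2 * j)) by apply: indep_var; lia.
rewrite holds_conj all_map /local /pebs all_map /EPebs all_map.
apply: eq_in_all => j; rewrite mem_iota => /= jk.
rewrite holds_and holds_allowed // Ea ?Eb //; congr andb.
rewrite holds_conj !all_map; apply: eq_in_all => i; rewrite mem_iota => /= ik.
by rewrite holds_and !holds_imp holds_edge // !holds_eq holds_not holds_eq Ea ?Eb.
Qed.

Lemma map_set2 (v : nat -> nat) ds j x y : map v (set2 ds j x y) = set2 (map v ds) j (v x) (v y).
Proof. by rewrite /set2 !map_cat map_take map_drop. Qed.

Lemma mem_set2 ds j v a x : x \in set2 ds j v a -> [|| x == v, x == a | x \in ds].
Proof.
rewrite /set2 mem_cat !inE => /or3P[/mem_take->|->|/orP[->|/mem_drop->]] //; by rewrite ?orbT.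
Qed.

Lemma holds_supported v A : holds M v A ESupported = supported A (map v digs).
Proof.
rewrite holds_conj all_map; apply: eq_in_all => j; rewrite mem_iota /= => jk.
rewrite holds_all; apply: eq_forallb => x; rewrite holds_sum; apply: eq_existsb => a.
rewrite holds_not holds_arr -eqn0Ngt eval_idxs; last first.
  by apply/negP => /mem_set2; rewrite mem_iota.
rewrite map_set2; congr (A _ (horner _ (set2 _ _ _ _)) == 0) => //.
by apply/eq_in_map => y; rewrite mem_iota /upd => yy; do 2 (case: eqP => [E|_]; first lia).
Qed.

(** The consistency test runs many times, so the flags left in [aT] by the previous run have to be
    cleared. *)
Definition CReset := nest cnt (nest digs (CIf (EArr aT (EIdxs digs)) (CPut aT (EIdxs digs) (ECst 0)))).
Definition CPrune := nest cnt (nest digs (CIf (EAnd (ENot (EArr aT (EIdxs digs)))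
   (ENot (EAnd ELocal ESupported))) (CPut aT (EIdxs digs) (ECst 1)))).
Definition vok := 2.
Definition CConsist := CSeq CReset (CSeq CPrune
   (CSet vok (foldr ESum (ENot (EArr aT (EIdxs digs))) digs))).

Lemma eq_local A A' ds : (forall j i, j != aT -> A j i = A' j i) -> local A ds = local A' ds.
Proof.
move=> E; apply: eq_all => p; rewrite (eq_allowed E); congr andb.
by apply: eq_all => q; rewrite (eq_edge E).
Qed.

Lemma eq_supported A A' ds : A =2 A' -> supported A ds = supported A' ds.
Proof.
by move=> E; apply: eq_all => j; apply: eq_forallb => v; apply: eq_existsb => a; rewrite E.
Qed.

Lemma eval_digs v A : eval M v A (EIdxs digs) = horner M (map v digs).
Proof. by apply: eval_idxs; rewrite mem_iota. Qed.

Lemma horner_lt ds : all (gtn M) ds -> horner M ds < M ^ size ds.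
Proof.
elim/last_ind: ds => [|ds d IH]; first by rewrite expn0.
rewrite all_rcons horner_rcons size_rcons expnS => /andP[/= dM /IH lt].
by apply: (@leq_trans (M * (horner M ds).+1)); [rewrite mulnS; lia|rewrite leq_mul2l lt orbT].
Qed.

Lemma holds_nest A e ps zs v (P : seq nat -> bool) : uniq (ps ++ zs) ->
  (forall v, holds M v A e = P (map v (ps ++ zs))) ->
  reflect (exists ds, [/\ size ds = size zs, all (gtn M) ds & P (map v ps ++ ds)])
    (holds M v A (foldr ESum e zs)).
Proof.
elim: zs ps v => [|z zs IH] ps v /=.
  rewrite cats0 => _ H; rewrite H; apply: (iffP idP) => [p|[[|d ds] []]] //.
    by exists [::]; rewrite cats0.
  by rewrite cats0.
rewrite -cat_rcons => U H; rewrite holds_sum.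
have Em i : map (upd v z i) (rcons ps z) = rcons (map v ps) i.
  rewrite map_rcons {2}/upd eqxx; congr rcons; apply/eq_in_map => y yx.
  rewrite /upd; case: eqP => // E; move: U; rewrite cat_uniq rcons_uniq -E yx; by [].
apply: (iffP existsP) => [[i /(IH _ _ U H) [ds [sz a p]]]|[[|d ds] [] // [sz] /= /andP[dM a] p]].
  by exists (val i :: ds); rewrite /= sz ltn_ord a -cat_rcons -Em.
exists (Ordinal dM); apply/(IH _ _ U H); exists ds; split=> //.
by rewrite Em cat_rcons.
Qed.

Definition live A ds := [&& size ds == 2 * k, all (gtn M) ds & A aT (horner M ds) == 0].

Definition respects A (c : nat -> nat) := forall v, v < M ->
  allowed A v (c v) /\ forall w, w < M -> edge A v w -> c v <> c w.

Lemma size_set2 ds j v a : size ds = 2 * k -> j < k -> size (set2 ds j v a) = 2 * k.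
Proof. by move=> sz jk; rewrite /set2 !size_cat size_take size_drop sz /=; case: ifP; lia. Qed.

Lemma digits_set2 ds j v a : all (gtn M) ds -> v < M -> a < M ->
  all (gtn M) (set2 ds j v a).
Proof.
move=> ad vM aM; apply/allP => x /mem_set2 /or3P[/eqP->|/eqP->|] //; exact: (allP ad).
Qed.

Lemma peb_set2 ds j v a i : size ds = 2 * k -> j < k -> i < k ->
  peb (set2 ds j v a) i = if i == j then (v, a) else peb ds i.
Proof.
move=> sz jk ik; rewrite /peb /set2 !nth_cat !size_take !sz.
have -> : 2 * j < 2 * k by lia.
case: eqP => [->|ne]; first by rewrite ltnn subnn [_.+1 < _]ltnNge leqnSn /= subSnn.
case: (ltnP (2 * i) (2 * j)) => lt.
  have -> : (2 * i).+1 < 2 * j by lia.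
  by rewrite !nth_take //; lia.
have -> : (2 * i).+1 < 2 * j = false by lia.
have -> : (2 * i - 2 * j < size [:: v; a]) = false by rewrite /=; lia.
have -> : ((2 * i).+1 - 2 * j < size [:: v; a]) = false by rewrite /=; lia.
by rewrite !nth_drop /=; congr (nth _ _ _, nth _ _ _); lia.
Qed.

Lemma pebs_lt ds p : size ds = 2 * k -> all (gtn M) ds -> p \in pebs ds -> p.1 < M.
Proof.
move=> sz ad /mapP[j]; rewrite mem_iota => /= jk ->.
by apply: (allP ad); apply: mem_nth; rewrite sz; lia.
Qed.

Lemma respects_local A c ds : respects A c -> size ds = 2 * k -> all (gtn M) ds ->
  (forall p, p \in pebs ds -> p.2 = c p.1) -> local A ds.
Proof.
move=> rc sz ad pc; apply/allP => p pp; have [al pr] := rc _ (pebs_lt sz ad pp).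
rewrite pc // al; apply/allP => q qp; rewrite pc //.
apply/andP; split; first by apply/implyP => /eqP->.
by apply/implyP => ed; apply/eqP; apply: pr => //; apply: pebs_lt qp.
Qed.

Lemma consist_same s : same (mem (vok :: cnt ++ digs)) (pred1 aT) s (den M CConsist s).
Proof.
have J j : j \in warrs CConsist -> j == aT by rewrite /= !warrs_nest !inE orbb.
have X x : x \in wvars CConsist -> x \in vok :: cnt ++ digs.
  by rewrite /= !wvars_nest /= !cats0 !(inE, mem_cat) => /or3P[|/orP[]|]->; rewrite ?orbT.
by apply: same_sub X J (den_same M s _); rewrite /= !noio_nest.
Qed.

Hypotheses (M3 : 2 < M) (k0 : 0 < k).

(** The invariant [J] of the pruning: a position that agrees with a colouring respecting the lists
    is never removed, as the same colouring answers every move. *)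
Lemma consist_correct s : let s' := den M CConsist s in
  [/\ (0 < vars s' vok -> exists ds, live (arrs s') ds),
    (forall ds, live (arrs s') ds -> local (arrs s') ds && supported (arrs s') ds) &
    (forall c, respects (arrs s) c -> 0 < vars s' vok)].
Proof.
move=> s'; pose s1 := den M CReset s; pose s2 := den M CPrune s1.
have U : uniq digs by apply: iota_uniq.
have sd : size digs = 2 * k by rewrite size_iota.
have NM : M ^ (2 * k) <= M ^ size cnt by rewrite size_iota.
have IN ds : size ds = size digs -> all (gtn M) ds -> horner M ds < M ^ (2 * k).
  by move=> sz; rewrite -sd -sz; apply: horner_lt.
have [_ R1] : True /\ forall ds, size ds = size digs -> all (gtn M) ds ->
    ~~ (0 < arrs s1 aT (horner M ds)).
  apply: (@flag_sweeps M digs cnt _ _ aT false (fun ds A => 0 < A aT (horner M ds)) (horner M)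
     (fun=> True) (M ^ (2 * k)) s) => //.
  - by move=> v A _; rewrite /holds /= eval_digs.
  - by move=> v A; rewrite eval_digs.
  - by move=> ds A A' E; rewrite E.
have sm1 : same (mem (wvars CReset)) (mem (warrs CReset)) s s1.
  by apply: den_same; rewrite /= !noio_nest.
have fr1 j i : j != aT -> arrs s1 j i = arrs s j i.
  by move=> jT; apply: (same_a sm1); rewrite /= !warrs_nest inE.
pose J A := (forall j i, j != aT -> A j i = arrs s j i) /\
  forall c, respects (arrs s) c -> forall ds, size ds = 2 * k -> all (gtn M) ds ->
    (forall p, p \in pebs ds -> p.2 = c p.1) -> A aT (horner M ds) = 0.
have [[J1 J2] R2] : J (arrs s2) /\ forall ds, size ds = size digs -> all (gtn M) ds ->
    ~~ ((arrs s2 aT (horner M ds) == 0) && ~~ (local (arrs s2) ds && supported (arrs s2) ds)).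
  apply: (@flag_sweeps M digs cnt _ _ aT true (fun ds A => (A aT (horner M ds) == 0) &&
     ~~ (local A ds && supported A ds)) (horner M) J (M ^ (2 * k)) s1) => //.
  - move=> v A _; rewrite holds_and holds_not holds_arr eval_digs -eqn0Ngt holds_not.
    by rewrite holds_and holds_local holds_supported.
  - by move=> v A; rewrite eval_digs.
  - by move=> ds A A' E; rewrite E (eq_supported _ E) (@eq_local A A').
  - by move=> ds A /andP[/eqP->].
  - move=> ds A; rewrite sd => sz ad /andP[_ nls] [JA1 JA2]; split.
      by move=> j i jT; rewrite /upda (negbTE jT) /= JA1.
    move=> c rc ds' sz' ad' pc; rewrite /upda eqxx /=; case: eqP => [E|_]; last exact: JA2 pc.
    have {}E : ds' = ds by apply: (horner_inj _ ad' ad E); rewrite sz sz'.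
    subst ds'; case/negP: nls; apply/andP; split.
      by rewrite (eq_local _ JA1); apply: respects_local rc sz ad pc.
    apply/allP => j; rewrite mem_iota => /= jk; apply/forallP => v.
    have [al _] := rc _ (ltn_ord v).
    have cM : c v < M by case/andP: al => c3 _; apply: leq_trans c3 M3.
    apply/existsP; exists (Ordinal cM); apply/eqP; apply: (JA2 c rc).
    + exact: size_set2.
    + exact: digits_set2.
    + move=> p /mapP[i]; rewrite mem_iota => /= ik ->; rewrite peb_set2 //.
      by case: eqP => // _; apply: pc; apply: map_f; rewrite mem_iota.
  - split=> // c rc ds sz ad _; apply/eqP; rewrite eqn0Ngt; apply: R1 => //; by rewrite sd.
have A' : arrs s' = arrs s2 by [].
have vE : (0 < vars s' vok) = holds M (vars s2) (arrs s2)
    (foldr ESum (ENot (EArr aT (EIdxs digs))) digs).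
  by rewrite /s' /= /upd eqxx.
have HN := @holds_nest (arrs s2) (ENot (EArr aT (EIdxs digs))) [::] digs (vars s2)
    (fun ds => arrs s2 aT (horner M ds) == 0) U _.
have {}HN := HN (fun v => etrans (holds_not _ _ _ _) (etrans (congr1 negb (etrans (holds_arr _ _ _ _)
  (congr1 (fun x => 0 < arrs s2 aT x) (eval_digs _ _)))) (esym (eqn0Ngt _)))).
rewrite vE A'; split.
- by case/HN => ds [sz ad t0]; exists ds; rewrite /live sz sd eqxx ad.
- case=> [|d ds]; first by rewrite /live /=; lia.
  move=> /and3P[/eqP sz ad t0]; have := R2 (d :: ds); rewrite sd t0 /= negbK; exact.
(* The surviving position exhibited has all pebbles on vertex 0, with the colour that [c] gives to
   it. *)
- move=> c rc; apply/HN; exists (flatten (nseq k [:: 0; c 0])).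
  have sz : size (flatten (nseq k [:: 0; c 0])) = 2 * k.
    by rewrite size_flatten /shape map_nseq sumn_nseq.
  have [/andP[c3 _] _] := rc 0 (ltnW (ltnW M3)).
  have ad : all (gtn M) (flatten (nseq k [:: 0; c 0])).
    apply/allP => x /flattenP[y]; rewrite mem_nseq => /andP[_ /eqP->].
    by rewrite !inE => /orP[] /eqP-> /=; lia.
  split; rewrite ?sd //=; apply/eqP; apply: (J2 _ rc) => // p /mapP[j].
  rewrite mem_iota => /= jk ->; rewrite /peb /=.
  suff [-> ->] : nth 0 (flatten (nseq k [:: 0; c 0])) (2 * j) = 0 /\
    nth 0 (flatten (nseq k [:: 0; c 0])) (2 * j).+1 = c 0.
    by [].
  elim: (k) j jk => // k' IH [|j] // jk; rewrite (_ : 2 * j.+1 = (2 * j).+2) /=; last lia.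
  exact: IH.
Qed.
End Lists.

(** * Surviving positions form a strategy *)

Section Live.
Variables (M k : nat) (A : 'I_8 -> nat -> nat) (e : rel 'I_M).
Hypothesis edgeE : forall u v : 'I_M, edge M A u v = e u v.
Hypothesis closed : forall ds, live M k A ds -> local M k A ds && supported M k A ds.

Let inpebs ds (s : seq ('I_M * nat)) := forall p, p \in s -> (val p.1, p.2) \in pebs k ds.

(** The strategy consists of all partial positions contained in a surviving board. If fewer than [k]
    pebbles are in use, some pebble of the board is free and can be moved to the new vertex. *)
Lemma live_strategy : (exists ds, live M k A ds) -> exists2 F,
  strategy e (fun v a => allowed M A v a) k F & F [::].
Proof.
move=> [ds0 l0]; exists (fun s => exists2 ds, live M k A ds & inpebs ds s); last first.
  by exists ds0.
split.
- by move=> s s' [ds l i] sub; exists ds => // p /sub; apply: i.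
- move=> s v sk [ds l i].
  pose js := [seq index (val p.1, p.2) (pebs k ds) | p <- s].
  have [j jk jn] : exists2 j, j < k & j \notin js.
    have := @uniq_leq_size _ (iota 0 k) js (iota_uniq _ _).
    rewrite size_map size_iota => H.
    case: (boolP (all (mem js) (iota 0 k))) => [/allP /H ks|/allPn[j]].
      by have := leq_trans sk ks; rewrite ltnn.
    by rewrite mem_iota => jk jn; exists j.
  have [_ /allP S] := andP (closed l).
  have [/eqP sz ad _] := and3P l.
  have /S /forallP /(_ v) /existsP [a a0] : j \in iota 0 k by rewrite mem_iota.
  exists (val a), (set2 ds j v a).
    by rewrite /live (size_set2 _ _ sz jk) eqxx digits_set2.
  move=> p; rewrite inE => /predU1P[->|ps].
    apply/mapP; exists j; first by rewrite mem_iota.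
    by rewrite (peb_set2 _ _ sz) ?eqxx.
  have pk := i _ ps; pose j' := index (val p.1, p.2) (pebs k ds).
  have j'k : j' < k by rewrite -index_mem size_map size_iota in pk.
  have jj : j' == j = false.
    by apply/negP => /eqP E; move: jn; rewrite -E => /mapP; apply; exists p.
  apply/mapP; exists j'; first by rewrite mem_iota.
  rewrite (peb_set2 _ _ sz) ?jj // -{1}(nth_index (0, 0) pk) (nth_map 0) ?size_iota //.
  by rewrite nth_iota.
- move=> s v a w b [ds l i] vs ws; have [/allP L _] := andP (closed l).
  have /andP[al /allP H] := L _ (i _ vs); have /andP[e1 e2] := H _ (i _ ws).
  split=> //=; first by case/andP: al.
    by move=> E; apply/eqP/(implyP e1); rewrite /= E.
  by rewrite -edgeE => E; apply/eqP/(implyP e2).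
Qed.
End Live.

Definition vv := 3.
Definition vans := 4.

(** * Self-reduction *)

Section Try.
Variables (M k : nat).
Hypothesis M3 : 2 < M.
Implicit Types (A : 'I_8 -> nat -> nat).

Definition CTry a := CIf (EAllowed (EVar vv) (ECst a))
  (CSeq (CPut aL (EIdx (EVar vv) (ECst a)) (ECst 1)) (CSeq (CConsist k)
     (CIf (ENot (EVar vok)) (CPut aL (EIdx (EVar vv) (ECst a)) (ECst 0))))).

Lemma den_if e c s : den M (CIf e c) s = if holds M (vars s) (arrs s) e then den M c s else s.
Proof. by []. Qed.

Lemma den_seq c1 c2 s : den M (CSeq c1 c2) s = den M c2 (den M c1 s).
Proof. by []. Qed.

Lemma den_put j e1 e2 s : den M (CPut j e1 e2) s = State (vars s)
  (upda (arrs s) j (eval M (vars s) (arrs s) e1) (eval M (vars s) (arrs s) e2)) (inp s) (out s).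
Proof. by []. Qed.

Definition eqT A A' := forall j i, j != aT -> A j i = A' j i.

Lemma allowed_remove A v a u b : a < 3 ->
  allowed M (upda A aL (M * v + a) 1) u b = allowed M A u b && ((u, b) != (v, a)).
Proof.
move=> a3; rewrite /allowed /upda eqxx /=; case: ltnP => // b3 /=.
case: (M * u + b =P _) => [E|ne]; last first.
  suff -> : (u, b) != (v, a) by rewrite andbT.
  by apply/eqP => -[eu eb]; rewrite eu eb in ne.
have [-> ->] : u = v /\ b = a.
  have := congr1 (divn^~ M) E; have := congr1 (modn^~ M) E.
  rewrite !(mulnC M) !modnMDl !divnMDl ?divn_small ?modn_small ?addn0 //; lia.
by rewrite eqxx andbF.
Qed.

Lemma eqT_respects A A' c : eqT A A' -> respects M A c -> respects M A' c.
Proof.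
move=> E rc v vM; have [al pr] := rc v vM; split; first by rewrite -(eq_allowed _ E).
by move=> w wM; rewrite -(eq_edge _ E); apply: pr.
Qed.

Lemma respects_remove A v a c : a < 3 -> respects M (upda A aL (M * v + a) 1) c <->
  respects M A c /\ (v < M -> c v <> a).
Proof.
move=> a3; split=> [rc|[rc ne] u uM].
  split=> [u uM|vM]; have [] := rc _ ltac:(eassumption); rewrite allowed_remove //.
    by case/andP=> al _; split.
  by case/andP=> _ /eqP ne _ E; apply: ne; rewrite E.
have [al pr] := rc u uM; split=> //; rewrite allowed_remove // al /=.
by apply/eqP => -[E1 E2]; subst u; apply: (ne uM).
Qed.

Variable Good : ('I_8 -> nat -> nat) -> Prop.
Hypothesis Good_ext : forall A A', eqT A A' -> Good A -> Good A'.
Hypothesis Good_dec : forall s, Good (arrs s) ->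
  0 < vars (den M (CConsist k) s) vok <-> exists c, respects M (arrs s) c.

(** Removing further colours preserves this, see [shrinks_settled]; so a single pass over the
    vertices is enough for each colour. *)
Definition settled A a u := allowed M A u a -> forall c, respects M A c -> c u = a.

Definition shrinks A A' := [/\ edge M A' =2 edge M A,
  (forall u b, allowed M A' u b -> allowed M A u b) &
  forall j i, j != aT -> j != aL -> A' j i = A j i].

Lemma shrinks_respects A A' c : shrinks A A' -> respects M A' c -> respects M A c.
Proof.
case=> e l _ rc v vM; have [al pr] := rc v vM; split; first exact: l.
by move=> w wM; rewrite -e; apply: pr.
Qed.

Lemma shrinks_settled A A' a u : shrinks A A' -> settled A a u -> settled A' a u.
Proof. by move=> sh st al c rc; apply: st (shrinks_respects sh rc); case: sh => _ + _; apply. Qed.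

(** If the removal is undone, then no colouring avoids [a] at [v]; if it is kept, [a] is no longer
    allowed there. In both cases [a] is settled at [v], and some colouring survives. *)
Lemma try_correct a v s : a < 3 -> v < M -> vars s vv = v ->
  (forall A, Good A -> Good (upda A aL (M * v + a) 1)) ->
  Good (arrs s) -> (exists c, respects M (arrs s) c) ->
  let s' := den M (CTry a) s in
  [/\ Good (arrs s'), exists c, respects M (arrs s') c, shrinks (arrs s) (arrs s') &
    settled (arrs s') a v].
Proof.
move=> a3 vM sv Gr G0 Z0 s'.
have iv : indep M (EVar vv) by apply: indep_var.
have ix s0 : vars s0 vv = v -> eval M (vars s0) (arrs s0) (EIdx (EVar vv) (ECst a)) = M * v + a.
  by move=> E; rewrite eval_idx //= E.
have Ev : eval M (vars s) (arrs s) (EVar vv) = v by [].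
rewrite /s' {s'} den_if holds_allowed // Ev.
case: ifP => [al|nal]; last by split=> //; rewrite /settled nal.
rewrite !den_seq den_put ix //.
set A1 := upda (arrs s) aL (M * v + a) 1; set s1 := State _ A1 _ _.
have G1 : Good A1 by apply: Gr.
have := Good_dec (s := s1) G1; have sm := consist_same M k s1.
set s2 := den M (CConsist k) s1 in sm *.
have E2 : eqT A1 (arrs s2) by move=> j i jT; rewrite (same_a sm).
rewrite den_if holds_not /holds [eval _ _ _ _]/=; case: posnP => [ok [_ H]|ok [/(_ isT) Z1 _]].
- have v2 : vars s2 vv = v by rewrite (same_v sm) //= inE mem_cat !mem_iota.
  rewrite den_put ix //.
  have E3 : eqT (arrs s) (upda (arrs s2) aL (M * v + a) 0).
    move=> j i jT; rewrite /upda -E2 // /A1 /upda.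
    case: (boolP ((j == aL) && (i == M * v + a))) => [/andP[/eqP-> /eqP->]|_ //].
    by move: al; rewrite /allowed a3 => /eqP.
  have E3' : eqT (upda (arrs s2) aL (M * v + a) 0) (arrs s) by move=> j i jT; rewrite E3.
  split.
  + exact: Good_ext G0.
  + by case: Z0 => c rc; exists c; apply: eqT_respects rc.
  + by split=> [||j i jT jL]; [exact: eq_edge|move=> u b; rewrite (eq_allowed _ E3')|rewrite E3].
  + move=> _ c /(eqT_respects E3') rc; case: (c v =P a) => // ne.
    by have // : false by apply: H; exists c; apply/respects_remove.
- split.
  + exact: Good_ext G1.
  + by case: Z1 => c rc; exists c; apply: eqT_respects rc.
  + split=> [u w|u b|j i jT jL]; first by rewrite -(eq_edge _ E2).
      by rewrite -(eq_allowed _ E2) allowed_remove // => /andP[].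
    by rewrite -E2 // /A1 /upda (negbTE jL).
  + by rewrite /settled -(eq_allowed _ E2) allowed_remove // eqxx andbF.
Qed.

Lemma phase_correct a s : a < 3 ->
  (forall v A, Good A -> Good (upda A aL (M * v + a) 1)) ->
  Good (arrs s) -> (exists c, respects M (arrs s) c) ->
  let s' := den M (CFor vv (CTry a)) s in
  [/\ Good (arrs s'), exists c, respects M (arrs s') c, shrinks (arrs s) (arrs s') &
    forall v, v < M -> settled (arrs s') a v].
Proof.
move=> a3 Gr G0 Z0.
apply: (@den_for M (fun m s' => [/\ Good (arrs s'), exists c, respects M (arrs s') c,
   shrinks (arrs s) (arrs s') & forall v, v < m -> settled (arrs s') a v])).
  by split.
move=> i s1 iM [G1 Z1 Sh1 St1].
have [||||G2 Z2 Sh2 St2] := @try_correct a i (setv s1 vv i) a3 iM => //; first exact: Gr.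
split=> //.
- case: Sh1 => e1 l1 f1; case: Sh2 => e2 l2 f2; split=> [u v|u b|j j' jT jL].
  + by rewrite e2 e1.
  + by move=> al; apply: l1; apply: l2.
  + by rewrite f2 ?f1.
- move=> v; rewrite ltnS leq_eqVlt => /predU1P[->//|lt].
  by apply: shrinks_settled (St1 v lt).
Qed.
End Try.

(* While colour 2 is being removed all lists contain 0 and 1; afterwards 2 is gone
   from every bipartite component, because these can be recoloured with 0 and 1.
   These are the two cases of [consistent_colouring]. *)
Definition CColour k := CSeq (CConsist k) (CSeq (CSet vans (EVar vok)) (CIf (EVar vans)
  (CSeq (CFor vv (CTry k 2)) (CSeq (CFor vv (CTry k 1)) (CFor vv (CTry k 0)))))).

Section Lists.
Variables (M t : nat) (e : rel 'I_M).
Hypothesis M3 : 2 < M.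
Hypothesis e_sym : symmetric e.
Hypothesis e_irr : irreflexive e.
Hypothesis t_odd : odd t.
Hypothesis t_ge9 : 9 <= t.
Hypothesis oddg : forall j u, odd j -> j < t - 2 -> ~ walk e j u u.
Hypothesis nop : no_ipath e t.
Hypothesis red : reduced e.
Implicit Types (A : 'I_8 -> nat -> nat).
Let k := 8 * t + 11.
Local Notation allowed := (allowed M).
Local Notation respects := (respects M).
Local Notation settled := (settled M).

Definition graphE A := forall u v : 'I_M, edge M A u v = e u v.
Definition low A := forall v : 'I_M, allowed A v 0 /\ allowed A v 1.
Definition pair_on_bipartite A := forall v : 'I_M, bipartite_at e v ->
  exists2 b, b < 3 & ~ allowed A v b.

Definition total (c : 'I_M -> nat) v := if insub v is Some i then c i else 0.

Lemma total_ord c (i : 'I_M) : total c i = c i.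
Proof. by rewrite /total valK. Qed.

Lemma respects_total A c : graphE A ->
  (forall v : 'I_M, allowed A v (c v) /\ forall w, e v w -> c v <> c w) ->
  respects A (total c).
Proof.
move=> gE H v vM; rewrite -[v]/(val (Ordinal vM)) total_ord.
have [al pr] := H (Ordinal vM); split=> // w wM.
by rewrite -[w]/(val (Ordinal wM)) total_ord gE; apply: pr.
Qed.

(** Here the combinatorics enters: surviving positions give a strategy, hence a colouring by
    [consistent_colouring]. The other direction holds for every graph, by [consist_correct]. *)
Lemma decision s : graphE (arrs s) -> low (arrs s) \/ pair_on_bipartite (arrs s) ->
  0 < vars (den M (CConsist k) s) vok <-> exists c, respects (arrs s) c.
Proof.
move=> gE P; have k0 : 0 < k by rewrite /k; lia.
have := consist_correct M3 k0 s; have sm := consist_same M k s.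
set s' := den M (CConsist k) s in sm * => -[H1 H2 H3].
have E : eqT (arrs s') (arrs s) by move=> j i jT; rewrite (same_a sm).
split=> [/H1 H|[c]]; last exact: H3.
have gE' (u v : 'I_M) : edge M (arrs s') u v = e u v by rewrite (eq_edge _ E) gE.
have [F Fst F0] := live_strategy gE' H2 H.
have [|c Hc] := consistent_colouring e_sym e_irr t_odd t_ge9 oddg nop red Fst F0 (leqnn _).
  case: P => P; [left|right] => v; first by rewrite !(eq_allowed _ E).
  by move=> /P [b b3 nb]; exists b => //; rewrite (eq_allowed _ E).
exists (total c); apply: respects_total => // v; have [_ al pr] := Hc v.
by split=> //; rewrite -(eq_allowed _ E).
Qed.

(** The two-colouring of the component of [v] replaces [c] there; it uses only 0 and 1, which [low]
    allows everywhere. *)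
Lemma recolour A c (v : 'I_M) : graphE A -> low A -> respects A c ->
  bipartite_at e v -> exists2 c', respects A c' & c' v < 2.
Proof.
move=> gE lw rc /(bipartite_two_colouring e_sym) [d Hd].
exists (total (fun u => if connect e v u then d u else c u)); last first.
  by rewrite total_ord connect0; case: (Hd v (connect0 _ _)).
apply: respects_total => // u; have [al pr] := rc _ (ltn_ord u).
have cE w : e u w -> connect e v u = connect e v w.
  move=> uw; apply/idP/idP => /connect_trans; apply; apply: connect1 => //.
  by rewrite e_sym.
split=> [|w uw]; last first.
  rewrite -(cE w uw); case: ifP => [vu|_]; first by case: (Hd u vu) => _; apply.
  by apply: pr => //; rewrite gE.
case: ifP => // vu; have [d2 _] := Hd u vu; have [] := lw u.
by case: (d u) d2 => [|[]].
Qed.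

Lemma low_remove A v : low A -> low (upda A aL (M * v + 2) 1).
Proof.
move=> lw u; have [l0 l1] := lw u; rewrite !allowed_remove // l0 l1.
by split; apply/eqP => -[].
Qed.

Lemma pair_shrinks A A' : shrinks M A A' -> pair_on_bipartite A -> pair_on_bipartite A'.
Proof.
case=> _ l _ P v /P [b b3 nb]; exists b => // al; apply: nb; exact: l.
Qed.

Lemma pair_remove A v a : a < 3 -> pair_on_bipartite A ->
  pair_on_bipartite (upda A aL (M * v + a) 1).
Proof.
move=> a3; apply: pair_shrinks; split=> // [u b|j i jT jL].
  by rewrite allowed_remove // => /andP[].
by rewrite /upda (negbTE jL).
Qed.

Lemma phases_correct s : graphE (arrs s) -> low (arrs s) -> (exists c, respects (arrs s) c) ->
  let s' := den M (CSeq (CFor vv (CTry k 2)) (CSeq (CFor vv (CTry k 1)) (CFor vv (CTry k 0)))) s in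
  exists2 c, respects (arrs s) c & forall u a, u < M -> allowed (arrs s') u a = (a == c u).
Proof.
move=> gE lw Z s'.
pose Good1 A := graphE A /\ low A; pose Good2 A := graphE A /\ pair_on_bipartite A.
have gext A A' : eqT A A' -> graphE A -> graphE A'.
  by move=> E g u v; rewrite -(eq_edge _ E).
have Good1_ext A A' : eqT A A' -> Good1 A -> Good1 A'.
  move=> E [g l]; split; first exact: gext g.
  by move=> u; rewrite -!(eq_allowed _ E).
have Good2_ext A A' : eqT A A' -> Good2 A -> Good2 A'.
  move=> E [g l]; split; first exact: gext g.
  by move=> u /l[b b3 nb]; exists b => //; rewrite -(eq_allowed _ E).
have dec1 s0 : Good1 (arrs s0) -> 0 < vars (den M (CConsist k) s0) vok <->
    exists c, respects (arrs s0) c by move=> [g l]; apply: decision => //; left.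
have dec2 s0 : Good2 (arrs s0) -> 0 < vars (den M (CConsist k) s0) vok <->
    exists c, respects (arrs s0) c by move=> [g l]; apply: decision => //; right.
have rem2 a v A : a < 3 -> Good2 A -> Good2 (upda A aL (M * v + a) 1).
  by move=> a3 [g l]; split=> //; apply: pair_remove.
rewrite /s' {s'} !den_seq.
have rem1 v A : Good1 A -> Good1 (upda A aL (M * v + 2) 1).
  by move=> [g l]; split=> //; apply: low_remove.
have [G1 Z1 Sh1 St1] := phase_correct M3 Good1_ext dec1 (a := 2) isT rem1 (conj gE lw) Z.
set s1 := den M _ s in G1 Z1 Sh1 St1 *; case: G1 => gE1 lw1.
have G2 : Good2 (arrs s1).
  (* If 2 were still allowed at [v], every colouring would use it there, against [recolour]. *)
  split=> // v bv; exists 2 => // /(St1 _ (ltn_ord v)) H; case: Z1 => c rc.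
  by have [c' /H->] := recolour gE1 lw1 rc bv.
have [G3 Z2 Sh2 St2] := phase_correct M3 Good2_ext dec2 (a := 1) isT
  (fun v A => @rem2 1 v A isT) G2 Z1.
set s2 := den M _ s1 in G3 Z2 Sh2 St2 *.
have [_ [c rc] Sh3 St3] := phase_correct M3 Good2_ext dec2 (a := 0) isT
  (fun v A => @rem2 0 v A isT) G3 Z2.
set s3 := den M _ s2 in rc Sh3 St3 *.
exists c; first exact/(shrinks_respects Sh1)/(shrinks_respects Sh2)/(shrinks_respects Sh3).
move=> u a uM; apply/idP/eqP => [al|->]; last by case: (rc u uM).
have a3 : a < 3 by case/andP: al.
have S1 := shrinks_settled Sh3 (shrinks_settled Sh2 (St1 u uM)).
have S2 := shrinks_settled Sh3 (St2 u uM).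
by case: a a3 al => [|[|[]]] // _ al; [rewrite (St3 u uM al c)|rewrite (S2 al c)|rewrite (S1 al c)].
Qed.

Lemma colour_correct s : graphE (arrs s) -> (forall u a, a < 3 -> allowed (arrs s) u a) ->
  let s' := den M (CColour k) s in
  [/\ 0 < vars s' vans <-> exists c, respects (arrs s) c,
   (0 < vars s' vans -> exists2 c, respects (arrs s) c &
     forall u a, u < M -> allowed (arrs s') u a = (a == c u)) &
   same (mem (wvars (CColour k))) (fun j => (j == aL) || (j == aT)) s s'].
Proof.
move=> gE al s'; have lw : low (arrs s) by move=> v; rewrite !al.
have dec := decision gE (or_introl lw); have sm := consist_same M k s.
pose s1 := den M (CConsist k) s; have E : eqT (arrs s1) (arrs s).
  by move=> j i jT; rewrite (same_a sm).
pose s2 := setv s1 vans (vars s1 vok).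
have sE : s' = if 0 < vars s1 vok then den M (CSeq (CFor vv (CTry k 2))
   (CSeq (CFor vv (CTry k 1)) (CFor vv (CTry k 0)))) s2 else s2 by [].
have v2 : vars s2 vans = vars s1 vok by [].
have vE : vars s' vans = vars s1 vok.
  rewrite sE; case: ifP => // _.
  have nv : vans \notin wvars (CSeq (CFor vv (CTry k 2))
      (CSeq (CFor vv (CTry k 1)) (CFor vv (CTry k 0)))).
    by rewrite /= !wvars_nest !cats0 !(inE, mem_cat) !mem_iota.
  by rewrite (same_v (den_same M _ _) nv) //= !noio_nest.
split; first by rewrite vE.
- rewrite vE sE => v0; rewrite v0.
  have [|||c rc H] := @phases_correct s2.
  + by move=> u v; rewrite (eq_edge _ E).
  + by move=> u; rewrite !(eq_allowed _ E) !al.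
  + by have [c rc] := proj1 dec v0; exists c; apply: eqT_respects rc => j i jT; rewrite E.
  by exists c => //; apply: eqT_respects rc.
- have J j : j \in warrs (CColour k) -> (j == aL) || (j == aT).
    by rewrite /= !warrs_nest !inE; do !case: eqP => //.
  apply: same_sub J (den_same M _ _) => //.
  by rewrite /= !noio_nest.
Qed.
End Lists.

(** * Computing the folds *)

Section Reduction.
Variable M : nat.
Implicit Types (A : 'I_8 -> nat -> nat).

Definition foldN A (a p q r b u : nat) : nat := if edge M A u a then p else if edge M A u b then r else q.

(** Expressions have no conditional, so the image of [x] is passed to a continuation [K], once for
    each possible value. Variables 5 to 10 hold [a], [p], [q], [r], [b] and [y]. *)
Definition EFold x K := EOr (EAnd (EEdge x (EVar 5)) (K (EVar 6)))
  (EOr (EAnd (EAnd (ENot (EEdge x (EVar 5))) (EEdge x (EVar 9))) (K (EVar 8)))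
       (EAnd (EAnd (ENot (EEdge x (EVar 5))) (ENot (EEdge x (EVar 9)))) (K (EVar 7)))).

Definition inX A u := 0 < A aX u.

Definition validN A a p q r b y := [&& edge M A p q, edge M A q r, ~~ inX A p, ~~ inX A q, ~~ inX A r,
  [exists w : 'I_M, edge M A y w] & [forall u : 'I_M, forall w : 'I_M, inX A u && edge M A u w ==>
    edge M A (foldN A a p q r b u) (if inX A w then foldN A a p q r b w else w)]].

Definition EX x := EArr aX x.
Definition EValid := EConj [:: EEdge (EVar 6) (EVar 7); EEdge (EVar 7) (EVar 8);
  ENot (EX (EVar 6)); ENot (EX (EVar 7)); ENot (EX (EVar 8)); ESum 12 (EEdge (EVar 10) (EVar 12));
  EAll 11 (EAll 12 (EImp (EAnd (EX (EVar 11)) (EEdge (EVar 11) (EVar 12)))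
    (EOr (EAnd (EX (EVar 12)) (EFold (EVar 11) (fun x => EFold (EVar 12) (fun z => EEdge x z))))
         (EAnd (ENot (EX (EVar 12))) (EFold (EVar 11) (fun x => EEdge x (EVar 12)))))))].

Definition CSeed := CFor 11 (CPut aX (EVar 11) (EEq (EVar 11) (EVar 10))).
(** Vertex 12 is forced into [X]: its neighbour 11 in [X] moves to a vertex that is not adjacent to
    it. *)
Definition EEscape := EAnd (EAnd (EX (EVar 11)) (EEdge (EVar 11) (EVar 12)))
  (EAnd (ENot (EFold (EVar 11) (fun x => EEdge x (EVar 12)))) (ENot (EX (EVar 12)))).
Definition CClose := nest [:: 13] (nest [:: 11; 12] (CIf EEscape (CPut aX (EVar 12) (ECst 1)))).
(* A number is the sum over [i] of the truth values of [i < value]. *)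
Definition EImage := ESum 15 (ENot (ENot (EOr
  (EAnd (EX (EArr aR (EVar 11))) (EFold (EArr aR (EVar 11)) (fun x => ELt (EVar 15) x)))
  (EAnd (ENot (EX (EArr aR (EVar 11)))) (ELt (EVar 15) (EArr aR (EVar 11))))))).
(** The new retraction is completed in [aP] before it is copied, because [EImage] still needs the
    old values of [aR] at other vertices. *)
Definition CFold := CSeq CSeed (CSeq CClose (CIf EValid
  (CSeq (CFor 11 (CPut aP (EVar 11) EImage)) (CFor 11 (CPut aR (EVar 11) (EArr aP (EVar 11))))))).

Definition folds := iota 5 6.
Definition CReduce := nest [:: 14] (nest folds CFold).

Lemma eval_count (v : nat -> nat) A z c n : n <= M ->
  (forall i, i < M -> holds M (upd v z i) A c = (i < n)) ->
  eval M v A (ESum z (ENot (ENot c))) = n.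
Proof.
move=> nM H /=.
have -> : [seq 1 - (1 - eval M (upd v z i) A c) | i <- iota 0 M] =
    [seq nat_of_bool (i < n) | i <- iota 0 M].
  apply/eq_in_map => i; rewrite mem_iota => /= iM; rewrite -(H i iM) /holds.
  by case: (eval _ _ _ c) => [|m] //=; rewrite subn0.
rewrite sumn_count -(subnKC nM) iotaD count_cat.
have /eqP -> : count (fun i => i < n) (iota 0 n) == n.
  by rewrite -{3}(size_iota 0 n) -all_count; apply/allP => i; rewrite mem_iota.
have /eqP -> : count (fun i => i < n) (iota (0 + n) (M - n)) == 0.
  by rewrite -leqn0 leqNgt -has_count -all_predC; apply/allP => i; rewrite mem_iota /=; lia.
by rewrite addn0.
Qed.

Lemma holds_cases (v : nat -> nat) A c1 c2 k1 k2 k3 :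
  holds M v A (EOr (EAnd c1 k1) (EOr (EAnd (EAnd (ENot c1) c2) k2)
    (EAnd (EAnd (ENot c1) (ENot c2)) k3))) =
  if holds M v A c1 then holds M v A k1 else if holds M v A c2 then holds M v A k2
  else holds M v A k3.
Proof.
rewrite !holds_or !holds_and !holds_not.
case: (holds M v A c1); case: (holds M v A c2); by rewrite /= ?orbF.
Qed.

Lemma holds_fold (v : nat -> nat) A x K (P : nat -> bool) : indep M x ->
  (forall i, i \in [:: 6; 7; 8] -> holds M v A (K (EVar i)) = P (v i)) ->
  holds M v A (EFold x K) = P (foldN A (v 5) (v 6) (v 7) (v 8) (v 9) (eval M v A x)).
Proof.
move=> ix HK; rewrite /EFold holds_cases !holds_edge // !HK // /foldN.
by rewrite ![eval _ _ _ (EVar _)]/=; do 2 case: (edge M _ _ _).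
Qed.

Lemma holds_valid (v : nat -> nat) A :
  holds M v A EValid = validN A (v 5) (v 6) (v 7) (v 8) (v 9) (v 10).
Proof.
have iv i : i != 1 -> indep M (EVar i) by apply: indep_var.
rewrite /EValid holds_conj /validN /= !holds_edge ?iv //.
rewrite !(holds_not M _ _ (EX _)) andbT; do 5 congr andb.
congr andb; first by rewrite holds_sum; apply: eq_existsb => w; rewrite holds_edge ?iv.
rewrite holds_all; apply: eq_forallb => u; rewrite holds_all; apply: eq_forallb => w.
rewrite holds_imp holds_and holds_edge ?iv //; congr implb.
rewrite holds_or !holds_and holds_not.
set v' := upd _ _ _.
rewrite (@holds_fold _ _ _ _ (fun x => edge M A x (foldN A (v 5) (v 6) (v 7) (v 8) (v 9) w))) ?iv //;
  last first.
  move=> i i3; have i1 : i != 1 by move: i3; rewrite !inE => /or3P[]/eqP->.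
  apply: (@holds_fold v' A (EVar 12) (fun z => EEdge (EVar i) z) (fun z => edge M A (v' i) z)).
    exact: iv.
  by move=> j j3; rewrite holds_edge //; exact: iv.
have -> : holds M v' A (EFold (EVar 11) (fun x => EEdge x (EVar 12))) =
    edge M A (foldN A (v 5) (v 6) (v 7) (v 8) (v 9) u) w.
  apply: (@holds_fold v' A (EVar 11) _ (fun x => edge M A x w)); first exact: iv.
  by move=> i; rewrite !inE => /or3P[]/eqP->; rewrite holds_edge //; exact: iv.
have -> : holds M v' A (EX (EVar 12)) = inX A w by [].
by case: (inX A w); rewrite ?orbF.
Qed.

Definition imageN A a p q r b u :=
  if inX A (A aR u) then foldN A a p q r b (A aR u) else A aR u.

Lemma eval_image (v : nat -> nat) A : let n := imageN A (v 5) (v 6) (v 7) (v 8) (v 9) (v 11) in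
  n <= M -> eval M v A EImage = n.
Proof.
move=> n nM; apply: eval_count => // i iM; rewrite holds_or !holds_and holds_not.
have iR : indep M (EArr aR (EVar 11)) by move=> v' A' i'.
rewrite (@holds_fold _ _ _ _ (fun x => i < x)) //; last first.
  by move=> j; rewrite !inE => /or3P[]/eqP->; rewrite holds_lt.
rewrite holds_lt /n /imageN.
have -> : holds M (upd v 15 i) A (EX (EArr aR (EVar 11))) = inX A (A aR (v 11)) by [].
by case: ifP => /=; rewrite ?orbF.
Qed.
End Reduction.

Lemma eq_foldable (T : finType) (e e' : rel T) a p q r b X : e =2 e' ->
  foldable e a p q r b X = foldable e' a p q r b X.
Proof.
move=> E; rewrite /foldable !E; do 5 congr andb.
by apply: eq_forallb_in => x xX; apply: eq_forallb => u; rewrite /fold_map !E.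
Qed.

Section Folding.
Variables (M : nat) (A0 : 'I_8 -> nat -> nat).
Implicit Types (A : 'I_8 -> nat -> nat).
Local Notation E0 u v := (0 < A0 aE (M * u + v)).
Hypothesis E0_sym : forall u v, u < M -> v < M -> E0 u v = E0 v u.

(** Since the composite of all folds is kept as a homomorphism of the input graph, a colouring of
    the remaining vertices can be pulled back along it at the end. *)
Definition retraction A := [/\ forall i, A aE i = A0 aE i,
  forall u, u < M -> A aR u < M /\ A aR (A aR u) = A aR u &
  forall u v, u < M -> v < M -> E0 u v -> E0 (A aR u) (A aR v)].

Definition ered A : rel 'I_M := fun u v => edge M A u v.

Lemma edge_sym A u v : retraction A -> u < M -> v < M -> edge M A u v = edge M A v u.
Proof.
by move=> [E _ _] uM vM; rewrite /edge !E E0_sym // [(A aR u == u) && _]andbC.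
Qed.

Definition stuck A ds := forall a p q r b y : 'I_M, ds = map val [:: a; p; q; r; b; y] ->
  forall X, foldable (ered A) a p q r b X -> y \in X -> forall u, ~~ ered A y u.

Lemma foldN_val A (a p q r b u : 'I_M) :
  foldN M A a p q r b u = fold_map (ered A) a p q r b u.
Proof. by rewrite /foldN /fold_map /ered; case: ifP => // _; case: ifP. Qed.

Lemma eq_foldN A A' a p q r b u : edge M A =2 edge M A' -> foldN M A a p q r b u = foldN M A' a p q r b u.
Proof. by move=> E; rewrite /foldN !E. Qed.

Section Closure.
Variables (s : state) (a p q r b y : 'I_M).
Hypothesis digE : map (vars s) folds = map val [:: a; p; q; r; b; y].
Let s2 := den M CClose (den M CSeed s).

Lemma close_correct : [/\ forall j i, j != aX -> arrs s2 j i = arrs s j i,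
  forall x, x < 11 -> vars s2 x = vars s x, inX (arrs s2) y,
  forall u w, u < M -> w < M -> inX (arrs s2) u -> edge M (arrs s) u w ->
    edge M (arrs s) (foldN M (arrs s) a p q r b u) w || inX (arrs s2) w &
  forall X : {set 'I_M}, foldable (ered (arrs s)) a p q r b X -> y \in X ->
    forall u : 'I_M, inX (arrs s2) u -> u \in X].
Proof.
have [[va vp vq vr] [vb vy]] : [/\ vars s 5 = a, vars s 6 = p, vars s 7 = q & vars s 8 = r] /\
  vars s 9 = b /\ vars s 10 = y by case: digE.
have := @den_fill M aX 11 (EEq (EVar 11) (EVar 10)) (fun i => 1 - ((i - y) + (y - i))) s.
case; first by move=> i A iM _; rewrite /= /upd /= vy.
rewrite -/CSeed; set s1 := den M CSeed s => F1 F2 F3 _.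
have e1 : edge M (arrs s1) =2 edge M (arrs s) by move=> u v; rewrite /edge !F2.
pose C (ds : seq nat) A := let u := nth 0 ds 0 in let w := nth 0 ds 1 in
  [&& inX A u && edge M A u w, ~~ edge M A (foldN M A a p q r b u) w & A aX w == 0].
pose J A := [/\ forall j i, j != aX -> A j i = arrs s j i, inX A y &
  forall X : {set 'I_M}, foldable (ered (arrs s)) a p q r b X -> y \in X ->
    forall u : 'I_M, inX A u -> u \in X].
have E2 A A' : A =2 A' -> edge M A =2 edge M A' by move=> E u v; rewrite /edge !E.
have [[J1 J2 J3] H] : J (arrs s2) /\ forall ds, size ds = 2 -> all (gtn M) ds -> ~~ C ds (arrs s2).
  apply: (@flag_sweeps M [:: 11; 12] [:: 13] EEscape (EVar 12) aX true C (fun ds => nth 0 ds 1) J M) => //.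
  - move=> v A fr; have fr' x : x < 11 -> v x = vars s x.
      move=> x11; rewrite fr ?F3 ?inE; lia.
    rewrite /EEscape 2!holds_and holds_edge; last by apply: indep_var.
    rewrite holds_and (holds_not _ _ _ (EX _)).
    rewrite holds_not (@holds_fold M v A (EVar 11) _ (fun x => edge M A x (v 12))); last first.
    + by move=> i; rewrite !inE => /or3P[]/eqP->; rewrite holds_edge //; apply: indep_var.
    + by apply: indep_var.
    by rewrite (fr' 5) // (fr' 6) // (fr' 7) // (fr' 8) // (fr' 9) // va vp vq vr vb /C /= -eqn0Ngt.
  - by case=> [|u [|w []]] //= _ /and3P[].
  - move=> ds A A' E; rewrite /C /inX E (E2 _ _ E) (E2 _ _ E) E.
    by rewrite (@eq_foldN A A' _ _ _ _ _ _ (E2 _ _ E)).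
  - by move=> ds A /and3P[_ _ /eqP->].
  - case=> [|u [|w []]] // A _ /and3P[/= uM wM _] /and3P[/andP[/= Xu uw] nf _] [J1 J2 J3].
    have eA : edge M A =2 edge M (arrs s) by move=> i j; rewrite /edge !J1.
    split.
    + by move=> j i jX; rewrite /upda (negbTE jX) /= J1.
    + by rewrite /inX /upda; case: ifP.
    + move=> X fX yX w'; rewrite /inX /upda eqxx /=; case: eqP => [E _|_]; last exact: J3.
      have uX : Ordinal uM \in X by apply: (J3 X).
      have := fX; rewrite /foldable => /and5P[_ _ _ _ /andP[_ /forall_inP /(_ _ uX) /forallP /(_ w')]].
      rewrite {1}/ered E /= -eA uw /=; case: (boolP (w' \in X)) => // _.
      by rewrite /ered -foldN_val /= E -eA -(eq_foldN _ _ _ _ _ _ eA) (negbTE nf).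
  - split; first exact: F2.
      by rewrite /inX F1 // subnn addn0.
    move=> X _ yX u; rewrite /inX F1 // => lt.
    by have -> : u = y by apply: val_inj => /=; lia.
split=> //.
- move=> x x11; rewrite (same_v (den_same M s1 (c := CClose) isT)) ?F3 //; first by lia.
  apply/negP; rewrite /= !inE; lia.
- move=> u w uM wM Xu uw; have eA : edge M (arrs s2) =2 edge M (arrs s).
    by move=> i j; rewrite /edge !J1.
  have := H [:: u; w] erefl; rewrite /= uM wM => /(_ isT).
  rewrite /C /= Xu !eA uw (eq_foldN _ _ _ _ _ _ eA) /inX lt0n /=.
  by rewrite negb_and negbK.
Qed.
End Closure.

Definition eqR s s' := forall i, arrs s' aE i = arrs s aE i /\ arrs s' aR i = arrs s aR i.

Lemma eqR_edge s s' : eqR s s' -> edge M (arrs s') =2 edge M (arrs s).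
Proof.
by move=> E u v; rewrite /edge (proj1 (E _)) (proj2 (E u)) (proj2 (E v)).
Qed.

Lemma eqR_stuck ds s s' : eqR s s' -> stuck (arrs s) ds -> stuck (arrs s') ds.
Proof.
move=> E H a p q r b y eds X fX yX u; have eA := eqR_edge E.
rewrite /ered eA; apply: (H _ _ _ _ _ _ eds X) => //.
by rewrite -(@eq_foldable _ (ered (arrs s'))) // => x z; rewrite /ered eA.
Qed.

Lemma eqR_retraction s s' : eqR s s' -> retraction (arrs s) -> retraction (arrs s').
Proof.
move=> E [H1 H2 H3]; have R i : arrs s' aR i = arrs s aR i by case: (E i).
split=> [i|u uM|u v uM vM]; first by case: (E i) => ->.
  by rewrite !R; apply: H2.
by rewrite !R; apply: H3.
Qed.

Definition alive s := count (fun u => arrs s aR u == u) (iota 0 M).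

(** If any foldable set contains [y], then the closure of [y] is foldable: edges inside it are
    inherited from that set, edges leaving it are respected by closedness. A fold that is carried
    out maps into the complement of the closure, so [y] is no longer a fixed point. *)
Lemma fold_correct s : digits M s folds -> retraction (arrs s) ->
  let s' := den M CFold s in let ds := map (vars s) folds in
  retraction (arrs s') /\ ((eqR s s' /\ stuck (arrs s) ds) \/
    (alive s' < alive s /\ ~ stuck (arrs s) ds)).
Proof.
move=> dg rt s' ds.
have [a [p [q [r [b [y dE]]]]]] : exists a p q r b y : 'I_M, ds = map val [:: a; p; q; r; b; y].
  move: dg; rewrite /digits /= => /and5P[v5 v6 v7 v8 /and3P[v9 v10 _]].
  by exists (Ordinal v5), (Ordinal v6), (Ordinal v7), (Ordinal v8), (Ordinal v9), (Ordinal v10).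
have [H1 H2 Xy H4 H5] := close_correct dE.
rewrite /s' {s'} /CFold !den_seq; set s2 := den M CClose _ in H1 H2 Xy H4 H5 *.
have E2 : eqR s s2 by move=> i; rewrite !H1.
have eA := eqR_edge E2.
have [v5 v6 v7 v8 [v9 v10]] : [/\ vars s2 5 = a, vars s2 6 = p, vars s2 7 = q, vars s2 8 = r &
   vars s2 9 = b /\ vars s2 10 = y] by rewrite !H2 //; case: dE.
rewrite den_if holds_valid v5 v6 v7 v8 v9 v10.
have fN u : foldN M (arrs s2) a p q r b u = foldN M (arrs s) a p q r b u by apply: eq_foldN.
have [R1 R2 R3] := rt.
case: ifP => [V|nV]; last first.
  split; first exact: eqR_retraction rt.
  left; split=> // a' p' q' r' b' y'; rewrite dE => -[] /val_inj<- /val_inj<- /val_inj<- /val_inj<-.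
  move=> /val_inj<- /val_inj<- X fX yX w; apply/negP => yw; case/negP: nV.
  have sub u : inX (arrs s2) u -> u < M -> exists2 u' : 'I_M, u = u' & u' \in X.
    by move=> Xu uM; exists (Ordinal uM) => //; apply: (H5 X).
  have nsub (u : 'I_M) : u \notin X -> ~~ inX (arrs s2) u by apply: contra; apply: H5.
  move: (fX); rewrite /foldable /ered => /and5P[pq qr pX qX /andP[rX /forall_inP cl]].
  rewrite /validN !eA pq qr !nsub //=; apply/andP; split; first by apply/existsP; exists w; rewrite eA.
  apply/forallP => u; apply/forallP => z; apply/implyP; rewrite eA => /andP[Xu uz].
  rewrite eA !fN; case: (boolP (inX _ z)) => Xz.
    have uX := H5 X fX yX u Xu; have zX := H5 X fX yX z Xz.
    by have /forallP /(_ z) := cl u uX; rewrite uz zX /= !foldN_val.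
  by have := H4 u z (ltn_ord u) (ltn_ord z) Xu uz; rewrite (negbTE Xz) orbF.
have := V; rewrite /validN !eA => /and5P[pq qr Xp Xq /and3P[Xr /existsP[w yw] /forallP cl]].
have {}cl u z : u < M -> z < M -> inX (arrs s2) u -> edge M (arrs s) u z ->
    edge M (arrs s) (foldN M (arrs s) a p q r b u)
      (if inX (arrs s2) z then foldN M (arrs s) a p q r b z else z).
  move=> uM zM Xu uz; have /forallP /(_ (Ordinal zM)) /implyP := cl (Ordinal uM).
  by rewrite !eA /= Xu uz => /(_ isT); rewrite !fN.
have nst : ~ stuck (arrs s) ds.
  move=> st; move: yw; rewrite eA; apply/negP.
  apply: (st a p q r b y dE [set u : 'I_M | inX (arrs s2) u]); last by rewrite inE.
  apply/and5P; split; rewrite ?inE //.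
  rewrite Xr; apply/forall_inP => u; rewrite inE => Xu; apply/forallP => z.
  apply/implyP => uz; have := cl u z (ltn_ord u) (ltn_ord z) Xu uz.
  by rewrite inE /ered !foldN_val; case: ifP.
have live (x : 'I_M) : x \in [:: p; q; r] -> arrs s aR x = x /\ ~~ inX (arrs s2) x.
  case/and3P: pq => _ /eqP Ap /eqP Aq; case/and3P: qr => _ _ /eqP Ar.
  by rewrite !inE => /or3P[]/eqP->.
pose im := imageN M (arrs s2) a p q r b.
have imE u : im u = if inX (arrs s2) (arrs s aR u) then foldN M (arrs s) a p q r b (arrs s aR u)
    else arrs s aR u by rewrite /im /imageN !H1 // fN.
have im_live u : u < M -> im u < M /\ arrs s aR (im u) = im u /\ ~~ inX (arrs s2) (im u).
  move=> uM; have [rM rr] := R2 u uM; rewrite imE; case: ifPn => Xu; last by [].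
  rewrite /foldN; case: ifP => _; [|case: ifP => _]; rewrite ltn_ord; split=> //;
    by apply: live; rewrite !inE eqxx ?orbT.
have [|P1 P2 P3 _] := @den_fill M aP 11 EImage im s2.
  move=> i A iM HA; have imA : imageN M A (vars s2 5) (vars s2 6) (vars s2 7) (vars s2 8) (vars s2 9) i = im i.
    rewrite v5 v6 v7 v8 v9 /im /imageN /inX !HA //; case: ifP => // _.
    by apply: eq_foldN => u v; rewrite /edge !HA.
  rewrite eval_image /upd /= ?imA //; by case: (im_live i iM) => /ltnW.
set s3 := den M _ s2 in P1 P2 P3 *.
have [|Q1 Q2 _ _] := @den_fill M aR 11 (EArr aP (EVar 11)) im s3.
  by move=> i A iM HA; rewrite /= /upd /= HA // P1.
set s4 := den M _ s3 in Q1 Q2 *.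
have R4 u : u < M -> arrs s4 aR u = im u by apply: Q1.
have E4 i : arrs s4 aE i = A0 aE i by rewrite Q2 // P2 // H1 // R1.
have im_fix u : u < M -> im (im u) = im u.
  by move=> uM; have [_ [imr imX]] := im_live u uM; rewrite {1}imE imr (negbTE imX).
have E0e u v : u < M -> v < M -> arrs s aR u = u -> arrs s aR v = v -> E0 u v -> edge M (arrs s) u v.
  by move=> uM vM au av uv; rewrite /edge R1 uv au av !eqxx.
have eE0 u v : edge M (arrs s) u v -> E0 u v by rewrite /edge R1 => /andP[].
split; last first.
  right; split=> //; rewrite /alive.
  have yi : val y \in iota 0 M by rewrite mem_iota ltn_ord.
  have /andP[_ /andP[/eqP ay _]] := yw; rewrite H1 // in ay.
  have imy : im y != y.
    have [_ [_ X']] := im_live y (ltn_ord y); apply/eqP => E.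
    by move: X'; rewrite E Xy.
  have /permP pm := perm_to_rem yi; rewrite !pm /= ay eqxx R4 // (negbTE imy).
  rewrite add0n add1n ltnS.
  rewrite (@eq_in_count _ _ (fun u => (arrs s4 aR u == u) && (arrs s aR u == u))).
    by apply: sub_count => u /andP[].
  move=> u /mem_rem; rewrite mem_iota /= => uM; rewrite R4 //.
  case: eqP => // iu; have [_ [H _]] := im_live u uM.
  by rewrite iu in H; rewrite H eqxx.
split=> [//|u uM|u v uM vM uv].
  have [iM _] := im_live u uM; by rewrite R4 // R4 // im_fix.
rewrite !R4 //; have [ruM rru] := R2 u uM; have [rvM rrv] := R2 v vM.
have ruv := E0e _ _ ruM rvM rru rrv (R3 u v uM vM uv).
have rvu : edge M (arrs s) (arrs s aR v) (arrs s aR u) by rewrite edge_sym.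
rewrite !imE; case: (boolP (inX (arrs s2) (arrs s aR u))) => Xu.
  by have := cl _ _ ruM rvM Xu ruv; case: ifP => _ /eE0.
case: (boolP (inX (arrs s2) (arrs s aR v))) => Xv; last exact: R3.
have := cl _ _ rvM ruM Xv rvu; rewrite (negbTE Xu) => /eE0.
rewrite E0_sym //; have [] := im_live v vM; by rewrite imE Xv.
Qed.

(** Each effective fold lowers the number of fixed points, which is at most [M]; so the one counter
    14 provides enough sweeps. *)
Lemma reduce_correct s : retraction (arrs s) -> let s' := den M CReduce s in
  retraction (arrs s') /\ reduced (ered (arrs s')).
Proof.
move=> rt s'; have [] : retraction (arrs s') /\ all_good M folds (fun ds s => stuck (arrs s) ds) s'.
  apply: (@sweeps M CFold folds (fun s => retraction (arrs s)) eqR alive) => //.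
  - by move=> s1 s2 s3 E1 E2 i; case: (E1 i) => <- <-; apply: E2.
  - by move=> s1 s2 E; apply: eq_count => u; case: (E u) => _ ->.
  - move=> ds s1 s2 E; split; first exact: eqR_stuck.
    by apply: eqR_stuck => i; case: (E i) => -> ->.
  - move=> s0 x xf; rewrite (same_v (den_same M s0 (c := CFold) isT)) //.
    by apply/negP; move: xf; rewrite /= !inE; lia.
  - by move=> s0 dg rs; case: (fold_correct dg rs).
  - by move=> s0 dg rs; case: (fold_correct dg rs) => _ [|[]]; [left|right].
  - by move=> s0 dg rs st; case: (fold_correct dg rs) => _ [[]|[_ []]].
  - by rewrite expn1; apply: leq_trans (count_size _ _) _; rewrite size_iota.
move=> rt' g; split=> // a p q r b X fX y yX u.
apply: (g (map val [:: a; p; q; r; b; y])) fX yX u => //.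
by rewrite /= !ltn_ord.
Qed.

End Folding.

(** * Input and output *)

Definition CLoad := CSeq (CFor 2 (CFor 3 (CIf (EAnd (ELt (EVar 2) (EVar 0)) (ELt (EVar 3) (EVar 0)))
    (CSeq (CRead 4) (CPut aE (EIdx (EVar 2) (EVar 3)) (EVar 4))))))
  (CFor 2 (CPut aR (EVar 2) (EVar 2))).

Section Load.
Variables (n : nat) (rows : seq (seq nat)).
Hypothesis rows_size : size rows = n.
Hypothesis row_size : forall row, row \in rows -> size row = n.
Let M := n + 3.

(** The default values of [nth] make all entries outside the matrix zero, so the padding vertices
    are isolated. *)
Definition entry i j := nth 0 (nth [::] rows i) j.

Lemma entry_small i j : entry i j != 0 -> i < n /\ j < n.
Proof.
rewrite /entry; case: (ltnP i n) => lt; last by rewrite (nth_default [::]) ?rows_size ?nth_nil.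
move=> E; split=> //; rewrite ltnNge; apply: contraNN E => le; rewrite nth_default //.
by rewrite row_size // mem_nth // rows_size.
Qed.

Lemma load_correct : let s := den M CLoad (start n (flatten rows)) in
  [/\ forall i j, i < M -> j < M -> arrs s aE (M * i + j) = entry i j,
    forall i, i < M -> arrs s aR i = i, forall i, arrs s aL i = 0,
    vars s 0 = n & out s = [::]].
Proof.
rewrite /CLoad den_seq.
pose I i s := [/\ inp s = flatten (drop i rows), forall i' j', i' < M -> j' < M ->
  arrs s aE (M * i' + j') = if i' < i then entry i' j' else 0,
  forall l, arrs s aL l = 0, vars s 0 = n & out s = [::]].
set s1 := den M (CFor 2 (CFor _ _)) _.
have [_ I2 I3 I4 I5] : I M s1.
  apply: (@den_for M I); first by split=> //; rewrite drop0.
  move=> i s iM [J1 J2 J3 J4 J5].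
  pose J j s := [/\ inp s = drop j (nth [::] rows i) ++ flatten (drop i.+1 rows),
    forall i' j', i' < M -> j' < M ->
      arrs s aE (M * i' + j') = if (i' < i) || ((i' == i) && (j' < j)) then entry i' j' else 0,
    forall l, arrs s aL l = 0, vars s 0 = n /\ vars s 2 = i & out s = [::]].
  suff [K1 K2 K3 [K4 _] K5] : J M (den M (CFor 3 (CIf (EAnd (ELt (EVar 2) (EVar 0))
      (ELt (EVar 3) (EVar 0))) (CSeq (CRead 4) (CPut aE (EIdx (EVar 2) (EVar 3)) (EVar 4)))))
      (setv s 2 i)).
    split=> // [|i' j' i'M j'M].
      rewrite K1 drop_oversize //; case: (ltnP i n) => lt.
        by rewrite row_size ?mem_nth ?rows_size // leq_addr.
      by rewrite nth_default ?rows_size.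
    by rewrite K2 // j'M andbT ltnS [i' <= i]leq_eqVlt orbC.
  apply: (@den_for M J).
    split=> //=; [|by move=> i' j' i'M j'M; rewrite J2 // ltn0 andbF orbF].
    rewrite J1 drop0; case: (ltnP i n) => lt; first by rewrite (drop_nth [::]) ?rows_size.
    by rewrite nth_default ?drop_oversize // rows_size // leqW.
  move=> j s' jM [K1 K2 K3 [K4 K5] K6].
  have c : holds M (vars (setv s' 3 j)) (arrs (setv s' 3 j))
      (EAnd (ELt (EVar 2) (EVar 0)) (ELt (EVar 3) (EVar 0))) = (i < n) && (j < n).
    by rewrite holds_and !holds_lt /= /upd /= K4 K5.
  rewrite den_if c.
  case: ifP => [/andP[lin ljn]|ninj].
    have rs : size (nth [::] rows i) = n by rewrite row_size ?mem_nth ?rows_size.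
    have E : drop j (nth [::] rows i) = entry i j :: drop j.+1 (nth [::] rows i).
      by rewrite (drop_nth 0) ?rs.
    rewrite den_seq den_put eval_idx; last by apply: indep_var.
    split=> //=; first by rewrite K1 E.
    move=> i' j' i'M j'M; rewrite /upda eqxx /= /upd /= K5 K1 E /=.
    case: eqP => [Eij|nij].
      have [-> ->] : i' = i /\ j' = j.
        have := congr1 (divn^~ M) Eij; have := congr1 (modn^~ M) Eij.
        rewrite !(mulnC M) !modnMDl !divnMDl ?(leq_ltn_trans _ iM) // !divn_small // !modn_small //.
        by rewrite !addn0.
      by rewrite eqxx ltnSn orbT.
    rewrite K2 //; congr (if _ then _ else _); congr orb.
    case: eqP => //= ii; rewrite ii in nij *; rewrite ltnS [j' <= j]leq_eqVlt.
    by case: eqP => // jj; rewrite jj in nij.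
  have e0 : entry i j = 0 by apply: contraFeq ninj => /entry_small[-> ->].
  split=> //=.
    rewrite K1; congr (_ ++ _); case: (ltnP i n) ninj => lt /=; last first.
      by move=> _; rewrite nth_default ?rows_size.
    move=> /negbT; rewrite -leqNgt => nj; have rs : size (nth [::] rows i) = n.
      by rewrite row_size ?mem_nth ?rows_size.
    by rewrite !drop_oversize ?rs // leqW.
  move=> i' j' i'M j'M; rewrite K2 //; rewrite ltnS [j' <= j]leq_eqVlt.
  case: (i' =P i) => [->|_] //=; case: (j' =P j) => [->|] //=.
  by rewrite e0 !ltnn /=.
have [|F1 F2 F3 [_ F4]] := @den_fill M aR 2 (EVar 2) id s1; first by [].
split=> [i j iM jM|i iM|i||].
- by rewrite F2 // I2 // iM.
- exact: F1.
- by rewrite F2.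
- by rewrite F3.
- by rewrite F4.
Qed.
End Load.

(** When this is evaluated every list is a single colour, so the sum, with colour 2 counted twice,
    decodes it into the output range 1 to 3. A folded vertex takes the colour of its image under the
    retraction. *)
Definition EColour := let u := EArr aR (EVar vv) in
  EAdd (ECst 1) (EAdd (EAllowed u (ECst 1)) (EAdd (EAllowed u (ECst 2)) (EAllowed u (ECst 2)))).
Definition CPrint := CSeq (CIf (ENot (EVar vans)) (CWrite (ECst 0)))
  (CIf (EVar vans) (CSeq (CWrite (ECst 1))
     (CFor vv (CIf (ELt (EVar vv) (EVar 0)) (CWrite EColour))))).

Section Print.
Variable M : nat.

Lemma eval_allowed (v : nat -> nat) A e1 e2 : indep M e1 ->
  eval M v A (EAllowed e1 e2) = allowed M A (eval M v A e1) (eval M v A e2).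
Proof.
move=> i1; rewrite -holds_allowed // /holds.
have : eval M v A (EAllowed e1 e2) <= 1 by rewrite /= leq_subr.
by case: (eval _ _ _ _) => [|[]].
Qed.

Lemma print_none s : out s = [::] -> vars s vans = 0 -> out (den M CPrint s) = [:: 0].
Proof. by move=> o v0; rewrite /CPrint den_seq !den_if /holds /= v0 /= v0 o. Qed.

Lemma print_colours s n (c : nat -> nat) : n <= M -> out s = [::] -> 0 < vars s vans ->
  vars s 0 = n -> (forall v a, v < n -> allowed M (arrs s) (arrs s aR v) a = (a == c v)) ->
  out (den M CPrint s) = 1 :: [seq (c v).+1 | v <- iota 0 n].
Proof.
move=> nM o vp v0 H; have vh : holds M (vars s) (arrs s) (EVar vans) by [].
have E1 : den M (CIf (ENot (EVar vans)) (CWrite (ECst 0))) s = s by rewrite den_if holds_not vh.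
rewrite /CPrint den_seq E1 den_if vh den_seq.
pose I i s' := [/\ vars s' 0 = n, arrs s' = arrs s &
  out s' = 1 :: [seq (c v).+1 | v <- iota 0 (minn i n)]].
set s1 := den M (CWrite (ECst 1)) s.
have [_ _] : I M (den M (CFor vv (CIf (ELt (EVar vv) (EVar 0)) (CWrite EColour))) s1).
  apply: (@den_for M I); first by split; rewrite //= o min0n.
  move=> i s2 iM [I1 I2 I3]; rewrite den_if holds_lt.
  have -> : eval M (vars (setv s2 vv i)) (arrs (setv s2 vv i)) (EVar vv) = i by [].
  have -> : eval M (vars (setv s2 vv i)) (arrs (setv s2 vv i)) (EVar 0) = n by [].
  case: ltnP => lt; last by split=> //=; rewrite I3; congr (_ :: map _ (iota _ _)); lia.
  have ix : indep M (EArr aR (EVar vv)) by [].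
  have cE : eval M (vars (setv s2 vv i)) (arrs (setv s2 vv i)) EColour = (c i).+1.
    rewrite /EColour -[eval _ _ _ _]/(1 + (eval M (vars (setv s2 vv i)) (arrs (setv s2 vv i))
      (EAllowed (EArr aR (EVar vv)) (ECst 1)) + (eval M (vars (setv s2 vv i)) (arrs (setv s2 vv i))
      (EAllowed (EArr aR (EVar vv)) (ECst 2)) + eval M (vars (setv s2 vv i)) (arrs (setv s2 vv i))
      (EAllowed (EArr aR (EVar vv)) (ECst 2))))).
    rewrite !eval_allowed //= /upd /= I2 !H //.
    have : c i < 3 by have := H i (c i) lt; rewrite eqxx => /andP[].
    by case: (c i) => [|[|[]]].
  split; [exact: I1|exact: I2|].
  rewrite -[out _]/(rcons (out s2) (eval M (vars (setv s2 vv i)) (arrs (setv s2 vv i)) EColour)).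
  rewrite cE I3 (minn_idPl lt) (minn_idPl (ltnW lt)).
  by rewrite -[in iota 0 i.+1]addn1 iotaD map_cat cats1.
by rewrite (minn_idPr nM).
Qed.
End Print.

(** * From excluded induced subgraphs to walks and paths *)

Section OddCycle.
Variables (T : finType) (e : rel T).
Hypothesis e_sym : symmetric e.
Hypothesis e_irr : irreflexive e.

Lemma segment_walk (g : nat -> T) l i j : (forall i, i < l -> e (g i) (g i.+1)) ->
  i <= j -> j <= l -> walk e (j - i) (g i) (g j).
Proof.
move=> gs ij jl; rewrite -{2}(subnKC ij).
have : i + (j - i) <= l by rewrite subnKC.
move: (j - i) => k; elim: k i {ij} => [|k IH] i le /=; first by rewrite addn0.
exists (g i.+1); first by apply: gs; lia.
by rewrite addnS -addSn; apply: IH; lia.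
Qed.

(* A chord of a shortest odd closed walk splits it into two shorter closed
   walks, one of which is odd. *)
Lemma induced_odd_cycle j u : odd j -> walk e j u u -> exists l (f : 'I_l -> T),
  [/\ 3 <= l <= j, odd l, injective f & forall x y, e (f x) (f y) = cycle_adj x y].
Proof.
move=> oj Wj; pose P l := odd l /\ exists u, walk e l u u.
have [l [[[ol [w Wl]] minl] lj]] : exists l, (P l /\ forall m, m < l -> ~ P m) /\ l <= j.
  have : P j by split=> //; exists u.
  elim/ltn_ind: {oj Wj} j => n IH Pn.
  case: (classic (exists2 m, m < n & P m)) => [[m mn /(IH m mn)[l [Pl lm]]]|no].
    by exists l; split=> //; apply: leq_trans lm (ltnW mn).
  by exists n; split=> //; split=> // m mn Pm; apply: no; exists m.
have short m v : odd m -> walk e m v v -> l <= m.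
  by move=> om W; rewrite leqNgt; apply/negP => lt; apply: (minl m lt); split=> //; exists v.
have [g [g0 gl gs]] := walk_fun Wl.
have l3 : 3 <= l.
  case: (l) ol Wl => [|[|[|n]]] // _ [z wz /= zw].
  by rewrite zw e_irr in wz.
have seg := segment_walk gs.
have around i k : i <= k -> k <= l -> walk e (l - k + i) (g k) (g i).
  move=> ik kl; apply: walk_cat (seg k l kl (leqnn _)) _; rewrite gl -g0.
  by rewrite -{1}(subn0 i); apply: seg => //; apply: leq_trans kl.
have chord i k : i < k -> k < l -> e (g i) (g k) -> k = i.+1 \/ i = 0 /\ k.+1 = l.
  move=> ik kl ed; have W1 := walk_cat (seg i k (ltnW ik) (ltnW kl)) (walk1 (etrans (e_sym _ _) ed)).
  have W2 := walk_cat (around i k (ltnW ik) (ltnW kl)) (walk1 ed).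
  case: (boolP (odd (k - i + 1))) => o1; first by have := short _ _ o1 W1; lia.
  have o2 : odd (l - k + i + 1) by lia.
  by have := short _ _ o2 W2; lia.
have inj i k : i < k -> k < l -> g i <> g k.
  move=> ik kl E; have W1 := seg i k (ltnW ik) (ltnW kl).
  have W2 := around i k (ltnW ik) (ltnW kl); rewrite E in W1 W2.
  case: (boolP (odd (k - i))) => o1; first by have := short _ _ o1 W1; lia.
  have o2 : odd (l - k + i) by lia.
  by have := short _ _ o2 W2; lia.
exists l, (fun i => g i); split=> //; first by rewrite l3.
  move=> x y E; apply: val_inj; case: (ltngtP (val x) (val y)) => // lt.
    by case: (inj _ _ lt (ltn_ord y) E).
  by case: (inj _ _ lt (ltn_ord x) (esym E)).
have main (x y : 'I_l) : x < y -> e (g x) (g y) = cycle_adj x y.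
  move=> lt; rewrite /cycle_adj; have -> : x != y by apply: contraTneq lt => ->; rewrite ltnn.
  have xl := ltn_ord x; have yl := ltn_ord y.
  have -> : (ordS x == y) = (y == x.+1 :> nat).
    by rewrite -val_eqE /= eq_sym modn_small //; lia.
  have -> : (ordS y == x) = (x == 0 :> nat) && (y.+1 == l).
    rewrite -val_eqE /=; case: (y.+1 =P l) => [->|ne]; first by rewrite modnn andbT eq_sym.
    rewrite modn_small ?andbF; first by apply/eqP; lia.
    by lia.
  rewrite andTb; apply/idP/orP => [/(chord _ _ lt yl)[->|[-> ->]]|[/eqP->|/andP[/eqP-> /eqP E]]].
  - by left.
  - by right; rewrite !eqxx.
  - by apply: gs; lia.
  - by have := gs y yl; rewrite E gl -g0 e_sym.
move=> x y; case: (ltngtP (val x) (val y)) => lt.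
- exact: main.
- by rewrite e_sym main // cycle_adj_sym.
- by rewrite (val_inj lt) e_irr cycle_adj_irrefl.
Qed.

Lemma induced_path t (s : seq T) : 3 < t -> size s = t -> ipath e s ->
  exists f : 'I_t -> T, [/\ injective f, forall x y, e (f x) (f y) = path_adj x y &
    forall x, f x \in s].
Proof.
case: s => [|x0 s'] t3 sz ip; first by rewrite -sz in t3.
move: (x0 :: s') sz ip => {s'} s sz ip; have N := ipath_nth e_irr x0 ip.
exists (fun i => nth x0 s i); split=> [x y E|x y|x]; last by rewrite mem_nth ?sz.
  apply: val_inj; have xs := ltn_ord x; have ys := ltn_ord y.
  case: (ltngtP (val x) (val y)) => // lt; [have := E|have := esym E];
    by case/(ipath_inj e_sym e_irr); rewrite ?sz.
have xs : x < size s by rewrite sz.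
have ys : y < size s by rewrite sz.
rewrite /path_adj; case: (ltngtP (val x) (val y)) => lt.
- have ne : (y.+1 == x) = false by move: lt => /= lt; apply/negbTE/eqP; lia.
  by rewrite N // ne orbF eq_sym.
- have ne : (x.+1 == y) = false by move: lt => /= lt; apply/negbTE/eqP; lia.
  by rewrite e_sym N // ne eq_sym.
- by rewrite (val_inj lt) e_irr orbb gtn_eqF.
Qed.
End OddCycle.

(** As [j] and [t] are odd, [j < t - 2] means [j <= t - 4], and a shortest odd closed walk is an
    induced odd cycle of at most that length. *)
Lemma no_short_odd_walk t (G : sgraph) : family_free (odd_cycles_upto (t - 4)) G ->
  forall j (u : G), odd j -> odd t -> j < t - 2 -> ~ walk (@adj G) j u u.
Proof.
move=> fr j u oj ot jt /(induced_odd_cycle (@adj_sym G) (@adj_irrefl G) oj).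
case=> l [f [/andP[l3 lj] ol fi fe]].
apply: (fr (cycle_graph l)); last by exists f.
by constructor=> //; rewrite l3; lia.
Qed.

Definition CMain t := CSeq CLoad (CSeq CReduce (CSeq (CColour (8 * t + 11)) CPrint)).

(** * The machine indices and the vertices of the input graph *)

Section Encoding.
Variable G : sgraph.
Definition rows := [seq [seq nat_of_bool (adj x y) | y <- enum G] | x <- enum G].
Definition ix (x : G) := index x (enum G).

Lemma encodeE : encode G = #|G| :: flatten rows.
Proof. by []. Qed.

Lemma ix_lt x : ix x < #|G|.
Proof. by rewrite cardE index_mem mem_enum. Qed.

Lemma ix_inj : injective ix.
Proof.
by move=> x y E; rewrite -(nth_index x (mem_enum G x)) -/(ix x) E nth_index ?mem_enum.
Qed.

Lemma ix_surj i : i < #|G| -> exists x, i = ix x.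
Proof.
move=> lt; exists (enum_val (Ordinal lt)).
by rewrite /ix /enum_val index_uniq ?enum_uniq // -cardE.
Qed.

Lemma iota_ix : iota 0 #|G| = map ix (enum G).
Proof.
apply: (@eq_from_nth _ 0) => [|i]; first by rewrite size_iota size_map -cardE.
rewrite size_iota => lt; rewrite nth_iota // add0n; have [x E] := ix_surj lt.
by rewrite (nth_map x) -?cardE // {2}E nth_index ?mem_enum.
Qed.

Lemma entry_ix x y : entry rows (ix x) (ix y) = adj x y.
Proof.
by rewrite /entry (nth_map x) ?index_mem ?mem_enum // (nth_map x) ?index_mem ?mem_enum //
  !nth_index ?mem_enum.
Qed.

Lemma rows_size : size rows = #|G|.
Proof. by rewrite size_map cardE. Qed.

Lemma row_size row : row \in rows -> size row = #|G|.
Proof. by case/mapP => x _ ->; rewrite size_map cardE. Qed.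

Lemma entryP i j : 0 < entry rows i j -> exists x y, [/\ i = ix x, j = ix y & adj x y].
Proof.
move=> pos; have ne : entry rows i j != 0 by rewrite -lt0n.
have [/ix_surj[x Ex] /ix_surj[y Ey]] := entry_small rows_size row_size ne.
by exists x, y; split=> //; move: pos; rewrite Ex Ey entry_ix; case: adj.
Qed.

Lemma entry_sym i j : entry rows i j = entry rows j i.
Proof.
case: (posnP (entry rows i j)) => [e0|/entryP[x [y [-> -> _]]]]; last first.
  by rewrite !entry_ix adj_sym.
case: (posnP (entry rows j i)) => [->|/entryP[x [y [Ex Ey _]]]]; first by rewrite e0.
by rewrite Ex Ey !entry_ix adj_sym.
Qed.

Section Program.
Variable t : nat.
Hypothesis t_odd : odd t.
Hypothesis t_ge9 : 9 <= t.
Hypothesis nopath : free (path_graph t) G.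
Hypothesis nocycle : family_free (odd_cycles_upto (t - 4)) G.
Let n := #|G|.
Let M := n + 3.
Let s1 := den M CLoad (start n (flatten rows)).
Let s2 := den M CReduce s1.
Let e := @ered M (arrs s2).
Let nM : n <= M. Proof. exact: leq_addr. Qed.
Let ixM (x : G) : ix x < M. Proof. exact: leq_trans (ix_lt x) nM. Qed.

Lemma E0_ix x y : (0 < arrs s1 aE (M * ix x + ix y)) = adj x y.
Proof.
have [L _ _ _ _] := load_correct rows_size row_size.
by rewrite L // entry_ix; case: adj.
Qed.

Lemma reduce_facts : retraction M (arrs s1) (arrs s2) /\ reduced e.
Proof.
have [L1 L2 _ _ _] := load_correct rows_size row_size.
apply: reduce_correct; first by move=> u v uM vM; rewrite !L1 // entry_sym.
split=> // [u uM|u v uM vM]; first by rewrite !L2.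
by rewrite (L2 u) // (L2 v).
Qed.

Lemma edgeP (u v : nat) : u < M -> v < M -> edge M (arrs s2) u v ->
  exists x y, [/\ u = ix x, v = ix y & adj x y].
Proof.
have [L1 _ _ _ _] := load_correct rows_size row_size; have [[E _ _] _] := reduce_facts.
by move=> uM vM /and3P[]; rewrite E L1 // => /entryP.
Qed.

Lemma e_walk j (u v : 'I_M) : walk e j u v -> forall x, val u = ix x ->
  exists2 y, val v = ix y & walk (@adj G) j x y.
Proof.
elim: j u => [|j IH] u /=; first by move=> -> x Ex; exists x.
case=> w uw /IH{}IH x Ex.
have [x' [z [Ex' Ez xz]]] := edgeP (ltn_ord u) (ltn_ord w) uw.
have Exx : x' = x by apply: ix_inj; rewrite -Ex' -Ex.
by have [y Ey W] := IH z Ez; exists y => //; exists z; rewrite // -Exx.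
Qed.

Lemma kept_sym : symmetric e.
Proof.
have [L1 _ _ _ _] := load_correct rows_size row_size; have [rt _] := reduce_facts.
move=> u v; rewrite /e /ered (@edge_sym M (arrs s1)) // => i j iM jM.
by rewrite !L1 // entry_sym.
Qed.

Lemma kept_irr : irreflexive e.
Proof.
move=> u; apply/negP => uu; have [x [y [Ex Ey]]] := edgeP (ltn_ord u) (ltn_ord u) uu.
by rewrite (_ : y = x) ?adj_irrefl //; apply: ix_inj; rewrite -Ex -Ey.
Qed.

Lemma kept_no_short_odd_walk j (u : 'I_M) : odd j -> j < t - 2 -> ~ walk e j u u.
Proof.
move=> oj jt W; have [w uw] : exists w, e u w by case: j oj W {jt} => // j _ [w uw _]; exists w.
have [x [_ [Ex _ _]]] := edgeP (ltn_ord u) (ltn_ord w) uw.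
have [y Ey Wy] := e_walk W Ex; have E : y = x by apply: ix_inj; rewrite -Ex -Ey.
by rewrite E in Wy; apply: (no_short_odd_walk nocycle oj t_odd jt Wy).
Qed.

(** Every vertex of the path has an incident edge, so none of them is padding and the path can be
    pulled back to [G]. *)
Lemma kept_no_ipath : no_ipath e t.
Proof.
move=> s sz; apply/negP => ip.
have [|f [fi fe _]] := induced_path kept_sym kept_irr _ sz ip; first by lia.
have nb (i : 'I_t) : exists j, e (f i) (f j).
  have it := ltn_ord i; case: (posnP i) => i0.
    have lt : 1 < t by lia.
    by exists (Ordinal lt); rewrite fe /path_adj /= i0.
  have lt : i.-1 < t by lia.
  by exists (Ordinal lt); rewrite fe /path_adj /= prednK // eqxx orbT.
have ex i : exists x, val (f i) == ix x.
  have [j /(edgeP (ltn_ord _) (ltn_ord _))[x [_ [E _ _]]]] := nb i.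
  by exists x; apply/eqP.
pose h i := xchoose (ex i).
have hE i : val (f i) = ix (h i) by apply/eqP/(xchooseP (ex i)).
apply: nopath; exists h; split=> [x y E|x y]; first by apply: fi; apply: val_inj; rewrite !hE E.
rewrite [RHS]/adj /= -fe -E0_ix -!hE /e /ered /edge.
have [[-> _ _] _] := reduce_facts.
have [x' /and3P[_ -> _]] := nb x; have [y' /and3P[_ -> _]] := nb y.
by rewrite !andbT.
Qed.

Lemma reduce_same : [/\ forall i, arrs s2 aL i = 0, vars s2 0 = n & out s2 = [::]].
Proof.
have [_ _ L3 L4 L5] := load_correct rows_size row_size.
have sm := den_same M s1 (c := CReduce) isT.
by split=> [i||]; rewrite ?(same_a sm) ?(same_v sm) ?(same_o sm).
Qed.

Lemma main_correct : answer3col G (out (den M (CMain t) (start n (flatten rows)))).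
Proof.
have [[R1 R2 R3] red] := reduce_facts; have [al v0 o0] := reduce_same.
have M3 : 2 < M by rewrite /M; lia.
have all_allowed u a : a < 3 -> allowed M (arrs s2) u a by rewrite /allowed al => ->.
have [K1 K2 K3] := colour_correct M3 kept_sym kept_irr t_odd t_ge9 kept_no_short_odd_walk kept_no_ipath red
  (s := s2) (fun u v => erefl) all_allowed.
set s3 := den M (CColour _) s2 in K1 K2 K3.
have o3 : out s3 = [::] by rewrite (same_o K3).
have v3 : vars s3 0 = n.
  have nv : 0 \notin wvars (CColour (8 * t + 11)).
    by rewrite /= !wvars_nest !cats0 !(inE, mem_cat) !mem_iota.
  by rewrite (same_v K3).
have -> : out (den M (CMain t) (start n (flatten rows))) = out (den M CPrint s3) by [].
have colours : 0 < vars s3 vans -> exists2 c : G -> nat, colouring3 c &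
    out (den M CPrint s3) = 1 :: [seq c x | x <- enum G].
  (* The colouring is composed with the retraction, which maps edges to edges, and shifted from 0,
     1, 2 to 1, 2, 3. *)
  move=> vp; have [c rc ac] := K2 vp; exists (fun x => (c (arrs s2 aR (ix x))).+1).
    split=> [x|x y xy].
      by have [uM _] := R2 _ (ixM x); have [/andP[c3 _] _] := rc _ uM.
    have [uM uu] := R2 _ (ixM x); have [vM vv'] := R2 _ (ixM y).
    move=> [E]; have [_ pr] := rc _ uM; apply: (pr _ vM) E.
    rewrite /edge R1 uu vv' !eqxx R3 // E0_ix; exact: xy.
  rewrite (print_colours (c := fun v => c (arrs s2 aR v)) nM) //.
    by rewrite iota_ix -map_comp.
  move=> v a vn; have [uM _] := R2 v (leq_trans vn nM).
  by rewrite (same_a K3) // ac.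
split=> [[c [c3 cp]]|nc]; last first.
  apply: print_none => //; case: (posnP (vars s3 vans)) => // /colours[c cc _].
  by case: nc; exists c.
suff /colours[c' cc E] : 0 < vars s3 vans by exists c'.
(* The default 1, lowered by one, gives colour 0 to the padding vertices. *)
apply/K1; pose c' i := nth 1 [seq c x | x <- enum G] i - 1.
have c'E x : c' (ix x) = c x - 1 by rewrite /c' (nth_map x) ?nth_index ?index_mem ?mem_enum.
exists c' => v vM; split.
  apply: all_allowed; case: (ltnP v n) => lt.
    by have [x ->] := ix_surj lt; rewrite c'E; have := c3 x; lia.
  by rewrite /c' nth_default // size_map -cardE.
move=> w wM /(edgeP vM wM)[x [y [-> -> xy]]]; rewrite !c'E.
by have := c3 x; have := c3 y; have := cp x y xy; lia.
Qed.
End Program.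
End Encoding.

Theorem theorem1p1 (t : nat) (t_odd : odd t) (t_ge9 : 9 <= t) :
  exists P : program,
    polytime_3colouring_algorithm
      (fun G : sgraph =>
         free (path_graph t) G /\ family_free (odd_cycles_upto (t - 4)) G)
      P.
Proof.
exists (compile (CMain t)); have [C [D HT]] := time_poly (CMain t).
(* For a nonempty graph [#|G| + 3] is at most four times [#|G|], whence [4 ^ D]; the term with
   [3 ^ D] serves the empty graph, and 3 is the header of the compiled program. *)
exists (C * 4 ^ D + C * 3 ^ D + 3), D => G [nopath nocycle].
eexists; split; last exact: main_correct t_odd t_ge9 nopath nocycle.
rewrite encodeE; apply: compile_correct.
apply: (@leq_trans (C * (#|G| + 3) ^ D + 3)).
  by rewrite leq_add2r; apply: HT; rewrite addn_gt0 orbT.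
case: (posnP #|G|) => [->|pos]; first by rewrite add0n; nia.
have : (#|G| + 3) ^ D <= 4 ^ D * #|G| ^ D.
  by rewrite -expnMn; case: (D) => // d; rewrite leq_exp2r //; lia.
nia.
Qed.
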